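(* Let $k\ge1$. There exists $C_k>0$ such that the following holds. Let $\mu\in H^{-1}(0,1)$, $T>0$ and $u\in L^2(0,T)$. For $\omega\in\mathbb R$, set $$K_{\mu,k}(\omega)=\sum_{n\ge1}\frac{\langle\mu,\varphi_n\rangle}{n}\left(\frac{\langle\mu,\varphi_{n+k}\rangle}{n+k}+\frac{\langle\mu,\varphi_{|n-k|}\rangle}{|n-k|}\mathbb 1_{n\ne k}\right)\frac{\lambda_{n,k}}{\lambda_{n,k}^2+\omega^2}$$ and $v_{k,T}(t):=u(t)e^{\frac{\lambda_kt}2}\mathbb 1_{(0,T)}(t)$. Then $$\begin{aligned}&\left|\langle y_2(T),\varphi_k\rangle-\frac{ke^{-\lambda_kT}}{4\pi^2\sqrt2}\int_{\mathbb R}|\widehat{v_{k,T}}(\omega)|^2K_{\mu,k}(\omega)\,d\omega\right|\\ \le\ &C_k\|y_1(T)\|_{H^{-1}}^2+C_k\|\mu\|_{H^{-1}}\sum_{n\ge1}\mathbb 1_{n^2<\frac{k^2}2}\left|\langle y_1(T),\varphi_n\rangle\right|\left|\int_0^Tu(t)e^{(\lambda_k-\lambda_n)t}\,dt\right|.\end{aligned}$$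
   Context: All functions are real-valued. For $j\ge1$, $\lambda_j=(j\pi)^2$, $\varphi_j(x)=\sqrt2\sin(j\pi x)$; $\langle\cdot,\cdot\rangle$ is the $L^2(0,1)$ scalar product (extended by duality); $\|y\|_{H^{-1}}^2=\sum_j\lambda_j^{-1}\langle y,\varphi_j\rangle^2$. $\lambda_{n,k}:=\lambda_n-\frac{\lambda_k}2$. Fourier transform: $\widehat u(\omega)=\int_{\mathbb R}u(t)e^{-i\omega t}dt$. $y_1$ is the solution of the linearized problem $\partial_ty_1-\partial_x^2y_1=u(t)\mu(x)$ on $(0,T)\times(0,1)$, with zero Dirichlet boundary conditions and $y_1(0)=0$; $y_2$ is the solution of $\partial_ty_2-\partial_x^2y_2+y_1\partial_xy_1=0$ on $(0,T)\times(0,1)$, with zero Dirichlet boundary conditions and $y_2(0)=0$. *)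

(* Defs.v *)
From HB Require Import structures.
From mathcomp Require Import all_boot all_order all_algebra.
From mathcomp Require Import all_classical all_reals all_analysis.
From mathcomp Require Import complex.

Set Implicit Arguments.
Unset Strict Implicit.
Unset Printing Implicit Defensive.

Import Order.TTheory GRing.Theory Num.Theory.
Import numFieldNormedType.Exports.

Local Open Scope classical_set_scope.
Local Open Scope ring_scope.

(* sum over n >= 1; the terms are summed in increasing order of n *)
Definition sum1 (R : realType) (c : nat -> R) : R :=
  limn (fun N => \sum_(1 <= n < N) c n).

Definition L2 (d : measure_display) (X : measurableType d) (R : realType)
    (m : {measure set X -> \bar R}) (D : set X) (f : X -> R) : Prop :=
  measurable_fun D f /\ m.-integrable D (fun x => (f x ^+ 2)%:E).

Section Dirichlet.
Variable R : realType.
Local Notation leb := (@lebesgue_measure R).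

Definition lambda (j : nat) : R := (j%:R * pi) ^+ 2.

Definition phi (j : nat) (x : R) : R := Num.sqrt 2 * sin (j%:R * pi * x).

Definition inner (f g : R -> R) : R :=
  \int[leb]_(x in `]0, 1[) (f x * g x).

(* H^1_0(0,1), up to equality almost everywhere: df is the weak derivative of f,
   the absolutely continuous representative of f vanishes at 0 and at 1. *)
Definition H10 (f df : R -> R) : Prop :=
  [/\ L2 leb `]0, 1[ f,
      L2 leb `]0, 1[ df,
      {ae leb, forall x : R, x \in `]0, 1[ -> f x = \int[leb]_(z in `]0, x[) df z}
    & \int[leb]_(z in `]0, 1[) df z = 0].

(* H^{-1}(0,1), the dual space of H^1_0(0,1). An element l acts on functions
   R -> R; only its values on H^1_0 matter. *)
Definition Hm1 (l : (R -> R) -> R) : Prop :=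
  (forall (a : R) (f df g dg : R -> R), H10 f df -> H10 g dg ->
     l (fun x => a * f x + g x) = a * l f + l g) /\
  (exists M : R, forall f df : R -> R, H10 f df ->
     `|l f| <= M * Num.sqrt (inner df df)).

(* The duality bracket <l, f> is l f; a function y in L^2 is the functional
   inner y. *)
Definition Hm1_norm (l : (R -> R) -> R) : R :=
  Num.sqrt (sum1 (fun j => (lambda j)^-1 * l (phi j) ^+ 2)).

(* y in C([0,T]; L^2(0,1)) and in L^2(0,T; H^1_0(0,1)), with dy = \partial_x y;
   the value y t x is at time t and at the point x. *)
Definition energy_space (T : R) (y dy : R -> R -> R) : Prop :=
  [/\ (forall t : R, t \in `[0, T] -> L2 leb `]0, 1[ (y t)),
      (forall t0 : R, t0 \in `[0, T] ->
         inner (fun x => y t x - y t0 x) (fun x => y t x - y t0 x)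
           @[t --> within `[0, T] (nbhs t0)] --> (0 : R)),
      L2 (leb \x leb)%E (`]0, T[ `*` `]0, 1[) (fun p => y p.1 p.2),
      L2 (leb \x leb)%E (`]0, T[ `*` `]0, 1[) (fun p => dy p.1 p.2)
    & {ae leb, forall t : R, t \in `]0, T[ -> H10 (y t) (dy t)}].

(* Weak solution of \partial_t y - \partial_x^2 y = F on (0,T) x (0,1), with zero
   Dirichlet boundary conditions and y(0) = 0, for a source F with values in
   H^{-1}. This is the variational formulation integrated over (0,t). *)
Definition heat_solution (T : R) (F : R -> (R -> R) -> R)
    (y dy : R -> R -> R) : Prop :=
  [/\ energy_space T y dy,
      {ae leb, forall x : R, x \in `]0, 1[ -> y 0 x = 0}
    & forall v dv : R -> R, H10 v dv -> forall t : R, t \in `[0, T] ->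
        inner (y t) v + \int[leb]_(s in `]0, t[) inner (dy s) dv
        = \int[leb]_(s in `]0, t[) F s v].

Definition linearized_solution (T : R) (mu : (R -> R) -> R) (u : R -> R)
    (y1 dy1 : R -> R -> R) : Prop :=
  heat_solution T (fun s v => u s * mu v) y1 dy1.

Definition quadratic_solution (T : R) (y1 dy1 y2 dy2 : R -> R -> R) : Prop :=
  heat_solution T (fun s v => - inner (fun x => y1 s x * dy1 s x) v) y2 dy2.

(* the integral of f(t) e^{-iwt}, by real and imaginary parts *)
Definition fourier (f : R -> R) (w : R) : R[i] :=
  ((\int[leb]_t (f t * cos (w * t))) +i* (- \int[leb]_t (f t * sin (w * t))))%C.

Definition lambda2 (n k : nat) : R := lambda n - lambda k / 2.

Definition Kmu (mu : (R -> R) -> R) (k : nat) (w : R) : R :=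
  sum1 (fun n =>
    mu (phi n) / n%:R
    * (mu (phi (n + k)) / (n + k)%:R
       + mu (phi `|n - k|%N) / `|n - k|%N%:R * (n != k)%:R)
    * (lambda2 n k / (lambda2 n k ^+ 2 + w ^+ 2))).

Definition weighted_control (k : nat) (T : R) (u : R -> R) (t : R) : R :=
  u t * expR (lambda k * t / 2) * \1_(`]0, T[) t.

End Dirichlet.

(* Main.v *)
Require Import Defs.
From HB Require Import structures.
From mathcomp Require Import all_boot all_order all_algebra.
From mathcomp Require Import all_classical all_reals all_analysis.
From mathcomp Require Import measurable_realfun complex zify ring lra.

(** Write a_n(t) for the coefficient of y_1(t) on phi_n, m_n = <mu, phi_n>,
    v(t) = u(t) e^{lambda_k t / 2} and l_n = lambda_n - lambda_k / 2.

    Both equations are diagonal in the sine basis. The variation of constants formula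
    gives <y_2(T), phi_k> as e^{- lambda_k T} times the integral over (0,T) of
    e^{lambda_k s} f(s), where f = - <y_1 d_x y_1, phi_k>. An integration by parts turns
    f into a multiple of the integral of y_1^2 cos(k pi x), whose expansion in the modes
    of y_1 only contains the products a_n a_p with |n - p| = k or n + p = k
    ([trilinearE]). The expansion may be truncated ([H10_quadratic_error]): a function g
    of H^1_0 is at a uniform distance at most |g'| / sqrt N of its N-th sine sum
    ([sine_sum_error_le]), which rests on the identity
    sum_n 2 sin(n pi x)^2 / (n pi)^2 = x - x^2 with a rate of convergence.

    The heart of the matter is a resonance identity ([trilinear_coupling]): the
    coefficient of a_n a_p is, up to a constant, (lambda_k - lambda_n - lambda_p) / (n p).
    This is exactly the factor that appears when e^{lambda_k s} a_n a_p is differentiated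
    in time ([product_moment]). Hence the time integrals disappear, and there remain
    boundary terms a_n(T) a_p(T) / (n p), which the norm of y_1(T) in H^{-1} controls
    because a mode is coupled to at most two others ([coupling_form_le]), and forcing
    terms (m_n / n) (m_p / p) L(l_n). Here L(l) is the integral of
    e^{- l (s - t)} v(t) v(s) over t < s ([causal_form]).

    If l > 0 then L(l) is, by the Fourier transform of the Lorentzian ([cos_lorentzE]),
    the integral of |vhat|^2 l / (l^2 + w^2) divided by 2 pi: this gives the n-th term of
    Kmu. If l < 0, an additional product of two exponential moments of v appears
    ([causal_form_spectral]); for l = l_n these are the integral of
    u(t) e^{(lambda_k - lambda_n) t} and, after multiplication by m_n,
    e^{lambda_n T} a_n(T). This is the second error term, and l_n < 0 means
    n^2 < k^2 / 2. The case l_n = 0 does not occur since 2 is not a rational square,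
    and |l_n| is even bounded below ([lambda2_gap]); this allows the summation over n to
    be exchanged with the integration over w ([lorentz_series_exchange]). Collecting the
    constants, C = k pi suffices. *)

Set Implicit Arguments.
Unset Strict Implicit.
Unset Printing Implicit Defensive.

Import Order.TTheory GRing.Theory Num.Theory.
Import numFieldNormedType.Exports.

Local Open Scope classical_set_scope.
Local Open Scope ring_scope.

(** * Real-valued integrals, square-integrable functions and Fubini's theorem *)

Section integrable_real.
Context d (T : measurableType d) (R : realType) (m : {measure set T -> \bar R}).
Variable D : set T.
Hypothesis mD : measurable D.
Implicit Types f g : T -> R.

Local Notation itg f := (m.-integrable D (EFin \o f)).

Lemma integrable_measurable f : itg f -> measurable_fun D f.
Proof. by move=> /(measurable_int m)/measurable_EFinP. Qed.

Lemma integrable_ext f g : {in D, f =1 g} -> itg f -> itg g.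
Proof.
by move=> fg; apply: eq_integrable => // x xD; rewrite /= fg.
Qed.

Lemma integrable_add f g : itg f -> itg g -> itg (fun x => f x + g x).
Proof. by move=> fi gi; exact: (integrableD mD fi gi). Qed.

Lemma integrable_sub f g : itg f -> itg g -> itg (fun x => f x - g x).
Proof. by move=> fi gi; exact: (integrableB mD fi gi). Qed.

Lemma integrable_scale (c : R) f : itg f -> itg (fun x => c * f x).
Proof. by move=> fi; exact: (integrableZl mD c fi). Qed.

Lemma integrable_mul_bounded (M : R) f g : measurable_fun D f ->
  (forall x, D x -> `|f x| <= M) -> itg g -> itg (fun x => f x * g x).
Proof.
move=> mf fM gi; apply: (integrableMr mD mf _ gi).
exists M; split; first exact: num_real.
by move=> x Mx y Dy; apply: le_trans (ltW Mx); exact: fM.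
Qed.

Lemma integrable_bound f g : measurable_fun D f -> itg g ->
  (forall x, D x -> `|f x| <= g x) -> itg f.
Proof.
move=> mf gi fg; apply: le_integrable gi => //; first exact/measurable_EFinP.
by move=> x Dx; rewrite /= lee_fin (le_trans (fg x Dx))// ler_norm.
Qed.

Lemma integrable_sum_real (I : Type) (s : seq I) (P : pred I) (h : I -> T -> R) :
  (forall i, P i -> itg (h i)) -> itg (fun x => \sum_(i <- s | P i) h i x).
Proof.
move=> hi; have : m.-integrable D (fun x => (\sum_(i <- s | P i) (h i x)%:E)%E).
  exact: integrable_sum.
by apply: eq_integrable => // x xD; rewrite /= sumEFin.
Qed.

Lemma Rintegral_sum (I : Type) (s : seq I) (P : pred I) (h : I -> T -> R) :
  (forall i, P i -> itg (h i)) ->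
  \int[m]_(x in D) (\sum_(i <- s | P i) h i x) =
  \sum_(i <- s | P i) \int[m]_(x in D) h i x.
Proof.
move=> hi; elim: s => [|i s IH].
  rewrite big_nil; under eq_Rintegral do rewrite big_nil.
  by rewrite /Rintegral integral0.
rewrite big_cons -IH; under eq_Rintegral do rewrite big_cons.
have [Pi|] // := boolP (P i).
by rewrite RintegralD//; [exact: hi | exact: integrable_sum_real].
Qed.

Lemma ae_eq_Rintegral f g : measurable_fun D f -> measurable_fun D g ->
  {ae m, forall x, D x -> f x = g x} ->
  \int[m]_(x in D) f x = \int[m]_(x in D) g x.
Proof.
move=> mf mg fg; congr fine; apply: ae_eq_integral => //.
- exact/measurable_EFinP.
- exact/measurable_EFinP.
- by apply: filterS fg => x fg Dx; rewrite fg.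
Qed.

Lemma ae_le_Rintegral f g : itg f -> itg g ->
  {ae m, forall x, D x -> f x <= g x} ->
  \int[m]_(x in D) f x <= \int[m]_(x in D) g x.
Proof.
move=> fi gi fg.
have mf := integrable_measurable fi; have mg := integrable_measurable gi.
(* Num.min (f x) (g x) is equal to f x almost everywhere and below g x everywhere. *)
rewrite (@ae_eq_Rintegral f (fun x => Num.min (f x) (g x)))//.
- apply: le_Rintegral => //.
  + apply: (@integrable_bound _ (fun x => `|f x| + `|g x|)).
    * exact: measurable_minr.
    * apply: integrable_add.
      - exact: (integrable_norm fi).
      - exact: (integrable_norm gi).
    * move=> x _; rewrite /Num.min; case: ifP => _.
      - by rewrite lerDl.
      - by rewrite lerDr.
  + by move=> x _; rewrite ge_min lexx orbT.
- exact: measurable_minr.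
- by apply: filterS fg => x fg Dx; rewrite min_l// fg.
Qed.

Lemma Rintegral_norm_le f g : itg f -> itg g ->
  (forall x, D x -> `|f x| <= g x) ->
  `|\int[m]_(x in D) f x| <= \int[m]_(x in D) g x.
Proof.
move=> fi gi fg; apply: le_trans (le_normr_Rintegral mD fi) _.
by apply: le_Rintegral => //; exact: (integrable_norm fi).
Qed.

Lemma ae_Rintegral_norm_le f g : itg f -> itg g ->
  {ae m, forall x, D x -> `|f x| <= g x} ->
  `|\int[m]_(x in D) f x| <= \int[m]_(x in D) g x.
Proof.
move=> fi gi fg; apply: le_trans (le_normr_Rintegral mD fi) _.
by apply: ae_le_Rintegral => //; exact: (integrable_norm fi).
Qed.

End integrable_real.

Section almost_everywhere_facts.
Context d (T : measurableType d) (R : realType) (m : {measure set T -> \bar R}).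

Lemma ae_imply (P Q : T -> Prop) : (forall x, P x -> Q x) ->
  {ae m, forall x, P x} -> {ae m, forall x, Q x}.
Proof. by move=> PQ; apply: filterS. Qed.

Lemma ae_and (P Q : T -> Prop) : {ae m, forall x, P x} -> {ae m, forall x, Q x} ->
  {ae m, forall x, P x /\ Q x}.
Proof. by move=> aP aQ; near=> x; split; near: x. Unshelve. all: end_near. Qed.

End almost_everywhere_facts.

Section L2_facts.
Context d (T : measurableType d) (R : realType) (m : {measure set T -> \bar R}).
Variable D : set T.
Hypothesis mD : measurable D.
Implicit Types f g : T -> R.

Lemma L2_mul_integrable f g : L2 m D f -> L2 m D g ->
  m.-integrable D (EFin \o (fun x => f x * g x)).
Proof.
move=> [mf fi] [mg gi]; apply: (integrable_bound mD (measurable_funM mf mg)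
  (integrable_add mD fi gi)) => x _.
rewrite /= ler_norml; apply/andP; split.
  have := sqr_ge0 (f x + g x); have := sqr_ge0 (f x); have := sqr_ge0 (g x); nra.
have := sqr_ge0 (f x - g x); have := sqr_ge0 (f x); have := sqr_ge0 (g x); nra.
Qed.

Lemma bounded_L2 (M : R) f : (m D < +oo)%E -> measurable_fun D f ->
  (forall x, D x -> `|f x| <= M) -> L2 m D f.
Proof.
move=> Doo mf fM; split=> //.
apply: measurable_bounded_integrable => //; first exact: measurable_funX.
exists (M ^+ 2); split; first exact: num_real.
move=> y My x Dx /=; rewrite normrX (le_trans _ (ltW My))// lerXn2r ?nnegrE//.
  exact: le_trans (fM x Dx).
exact: fM.
Qed.

Lemma L2_integrable f : (m D < +oo)%E -> L2 m D f ->
  m.-integrable D (EFin \o f).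
Proof.
move=> Doo fL2.
have oneL2 : L2 m D (fun=> 1).
  by apply: (@bounded_L2 1) => // x _; rewrite normr1.
apply: (integrable_ext mD _ (L2_mul_integrable fL2 oneL2)) => x _.
by rewrite mulr1.
Qed.

Lemma L2_add f g : L2 m D f -> L2 m D g -> L2 m D (fun x => f x + g x).
Proof.
move=> fL gL; have [mf fi] := fL; have [mg gi] := gL; split.
  exact: measurable_funD.
have fg := L2_mul_integrable fL gL.
apply: (integrable_ext mD _ (integrable_add mD (integrable_add mD fi gi)
  (integrable_scale mD 2 fg))) => x _ /=; ring.
Qed.

Lemma L2_scale c f : L2 m D f -> L2 m D (fun x => c * f x).
Proof.
move=> [mf fi]; split; first exact: measurable_funM.
by apply: (integrable_ext mD _ (integrable_scale mD (c ^+ 2) fi)) => x _ /=; ring.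
Qed.

Lemma L2_sub f g : L2 m D f -> L2 m D g -> L2 m D (fun x => f x - g x).
Proof.
move=> fL /(L2_scale (- 1)) gL.
by have := L2_add fL gL; under eq_fun do rewrite mulN1r.
Qed.

Lemma Cauchy_Schwarz f g : L2 m D f -> L2 m D g ->
  (\int[m]_(x in D) (f x * g x)) ^+ 2 <=
  (\int[m]_(x in D) (f x ^+ 2)) * \int[m]_(x in D) (g x ^+ 2).
Proof.
move=> fL gL; have [mf fi] := fL; have [mg gi] := gL.
have fg := L2_mul_integrable fL gL.
set a := \int[m]_(x in D) (f x ^+ 2); set b := \int[m]_(x in D) (g x ^+ 2).
set c := \int[m]_(x in D) (f x * g x).
(* the integral of (s f + t g)^2 is nonnegative *)
have key s t : 0 <= s ^+ 2 * a + 2 * s * t * c + t ^+ 2 * b.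
  rewrite /a /b /c -!RintegralZl// -RintegralD//; last 2 first.
  - exact: integrable_scale.
  - exact: integrable_scale.
  rewrite -RintegralD//; last 2 first.
  - by apply: integrable_add => //; exact: integrable_scale.
  - exact: integrable_scale.
  apply: Rintegral_ge0 => x _.
  suff -> : s ^+ 2 * f x ^+ 2 + 2 * s * t * (f x * g x) + t ^+ 2 * g x ^+ 2
    = (s * f x + t * g x) ^+ 2 by exact: sqr_ge0.
  ring.
have a0 : 0 <= a by apply: Rintegral_ge0 => x _; exact: sqr_ge0.
have b0 : 0 <= b by apply: Rintegral_ge0 => x _; exact: sqr_ge0.
(* s = c and t = - a give the inequality multiplied by a; if a = 0 the roles of f and g
   are exchanged. *)
have [a1|a1] := ltP 0 a.
  have := key c (- a); have -> : c ^+ 2 * a + 2 * c * - a * c + (- a) ^+ 2 * b =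
    a * (a * b - c ^+ 2) by ring.
  by rewrite pmulr_rge0// subr_ge0.
have az : a = 0 by apply/le_anti; rewrite a1 a0.
rewrite az mul0r.
have [b1|b1] := ltP 0 b.
  have := key (- b) c; rewrite az => h.
  have : 0 <= b * (- c ^+ 2) by move: h; nra.
  by rewrite pmulr_rge0// oppr_ge0.
have bz : b = 0 by apply/le_anti; rewrite b1 b0.
have := key 1 c; have := key 1 (- c); rewrite az bz; nra.
Qed.

End L2_facts.

Section Fubini_real.
Context d1 d2 (T1 : measurableType d1) (T2 : measurableType d2) (R : realType).
Variable m1 : {sigma_finite_measure set T1 -> \bar R}.
Variable m2 : {sigma_finite_measure set T2 -> \bar R}.
Variables (A : set T1) (B : set T2) (mA : measurable A) (mB : measurable B).
Variable f : T1 * T2 -> R.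
Hypothesis fi : (m1 \x m2)%E.-integrable (A `*` B) (EFin \o f).

Let F := (EFin \o f) \_ (A `*` B).
Let Fi : (m1 \x m2)%E.-integrable setT F.
Proof. by apply: (integrable_mkcond _ (measurableX mA mB)).1. Qed.

Let FE x y : A x -> F (x, y) = ((EFin \o (fun y => f (x, y))) \_ B) y.
Proof. by move=> Ax; rewrite /F /patch in_setX (mem_set Ax). Qed.

Let FE2 x y : B y -> F (x, y) = ((EFin \o (fun x => f (x, y))) \_ A) x.
Proof. by move=> Ay; rewrite /F /patch in_setX (mem_set Ay) andbT. Qed.

Lemma Fubini_ae_integrable1 :
  {ae m1, forall x, A x -> m2.-integrable B (EFin \o (fun y => f (x, y)))}.
Proof.
apply: filterS (ae_integrable1 Fi) => x xi Ax.
apply: (integrable_mkcond _ mB).2.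
by apply: eq_integrable xi => // y _; rewrite /= FE.
Qed.

(** On the null set of the x whose section is not integrable, the real-valued inner
    integral may differ from the extended one (an infinite value is read as 0); it is
    always dominated by it. *)
Lemma Fubini_integrable1 :
  m1.-integrable A (EFin \o (fun x => \int[m2]_(y in B) f (x, y))).
Proof.
have := integrable_fubini_F Fi => /(integrableS measurableT mA (@subsetT _ _)) FFi.
have FFE x : A x -> fubini_F m2 F x = (\int[m2]_(y in B) (f (x, y))%:E)%E.
  move=> Ax; rewrite /fubini_F [RHS]integral_mkcond.
  by apply: eq_integral => y _; rewrite FE.
apply: (le_integrable mA _ _ FFi) => /=.
  apply/measurable_EFinP; apply: measurableT_comp => //=.
  apply: eq_measurable_fun (measurable_int _ FFi) => x /set_mem Ax.
  by rewrite FFE.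
move=> x Ax; rewrite FFE// /Rintegral.
by case: (integral _ _ _) => [r| |] /=; rewrite ?normr0 ?lee_fin// leey.
Qed.

Lemma Fubini_integral1 :
  \int[m1]_(x in A) \int[m2]_(y in B) f (x, y) =
  \int[(m1 \x m2)%E]_(z in A `*` B) f z.
Proof.
rewrite [RHS]/Rintegral integral_mkcond -/F -(integral12_prod_meas1 Fi).
have FFE x : A x -> fubini_F m2 F x = (\int[m2]_(y in B) (f (x, y))%:E)%E.
  move=> Ax; rewrite /fubini_F [RHS]integral_mkcond.
  by apply: eq_integral => y _; rewrite FE.
have -> : (\int[m1]_x fubini_F m2 F x)%E = (\int[m1]_(x in A) fubini_F m2 F x)%E.
  rewrite [RHS]integral_mkcond; apply: eq_integral => x _; rewrite /patch.
  case: ifPn => // xA; apply: integral0_eq => y _.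
  by rewrite /F /patch in_setX (negbTE xA).
have FFi := integrableS measurableT mA (@subsetT _ _) (integrable_fubini_F Fi).
congr fine; apply: ae_eq_integral => //.
- exact: (measurable_int m1 Fubini_integrable1).
- exact: (measurable_int m1 FFi).
- apply: filterS Fubini_ae_integrable1 => x xi Ax.
  rewrite FFE// /Rintegral fineK//.
  by apply: integrable_fin_num => //; exact: xi.
Qed.

Lemma Fubini_ae_integrable2 :
  {ae m2, forall y, B y -> m1.-integrable A (EFin \o (fun x => f (x, y)))}.
Proof.
apply: filterS (ae_integrable2 Fi) => y yi By.
apply: (integrable_mkcond _ mA).2.
by apply: eq_integrable yi => // x _; rewrite /= FE2.
Qed.

Let Gi : m2.-integrable setT (fubini_G m1 F).
Proof.
have mF := measurable_int _ Fi.
apply/integrableP; split; first exact: (measurable_fubini_G Fi).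
have h : (\int[m2]_y \int[m1]_x `|F (x, y)| < +oo)%E.
  exact: (@integrable21ltyP _ _ _ _ _ m1 m2 F mF).1.
apply: (le_lt_trans _ h).
apply: ge0_le_integral => //.
- by apply: measurableT_comp => //; exact: (measurable_fubini_G Fi).
- apply: (measurable_fun_fubini_tonelli_G (abse \o F)); last by move=> z /=.
  exact: (measurableT_comp _ mF).
- move=> y _; apply: le_abse_integral => //.
  exact: (measurableT_comp mF (@measurable_pair2 _ _ _ _ y)).
Qed.

Lemma Fubini_integrable2 :
  m2.-integrable B (EFin \o (fun y => \int[m1]_(x in A) f (x, y))).
Proof.
have := Gi => /(integrableS measurableT mB (@subsetT _ _)) FFi.
have FFE y : B y -> fubini_G m1 F y = (\int[m1]_(x in A) (f (x, y))%:E)%E.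
  move=> By; rewrite /fubini_G [RHS]integral_mkcond.
  by apply: eq_integral => x _; rewrite FE2.
apply: (le_integrable mB _ _ FFi) => /=.
  apply/measurable_EFinP; apply: measurableT_comp => //=.
  apply: eq_measurable_fun (measurable_int _ FFi) => x /set_mem Ax.
  by rewrite FFE.
move=> x Ax; rewrite FFE// /Rintegral.
by case: (integral _ _ _) => [r| |] /=; rewrite ?normr0 ?lee_fin// leey.
Qed.

Lemma Fubini_integral2 :
  \int[m2]_(y in B) \int[m1]_(x in A) f (x, y) =
  \int[(m1 \x m2)%E]_(z in A `*` B) f z.
Proof.
rewrite [RHS]/Rintegral integral_mkcond -/F -(integral21_prod_meas1 Fi).
have FFE y : B y -> fubini_G m1 F y = (\int[m1]_(x in A) (f (x, y))%:E)%E.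
  move=> By; rewrite /fubini_G [RHS]integral_mkcond.
  by apply: eq_integral => x _; rewrite FE2.
have -> : (\int[m2]_y fubini_G m1 F y)%E = (\int[m2]_(y in B) fubini_G m1 F y)%E.
  rewrite [RHS]integral_mkcond; apply: eq_integral => y _; rewrite /patch.
  case: ifPn => // yB; apply: integral0_eq => x _.
  by rewrite /F /patch in_setX (negbTE yB) andbF.
have FFi := integrableS measurableT mB (@subsetT _ _) Gi.
congr fine; apply: ae_eq_integral => //.
- exact: (measurable_int m2 Fubini_integrable2).
- exact: (measurable_int m2 FFi).
- apply: filterS Fubini_ae_integrable2 => x xi Ax.
  rewrite FFE// /Rintegral fineK//.
  by apply: integrable_fin_num => //; exact: xi.
Qed.

Lemma Fubini_swap :
  \int[m1]_(x in A) \int[m2]_(y in B) f (x, y) =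
  \int[m2]_(y in B) \int[m1]_(x in A) f (x, y).
Proof. by rewrite Fubini_integral1 Fubini_integral2. Qed.

End Fubini_real.

Section tensor.
Context d1 d2 (T1 : measurableType d1) (T2 : measurableType d2) (R : realType).
Variable m1 : {sigma_finite_measure set T1 -> \bar R}.
Variable m2 : {sigma_finite_measure set T2 -> \bar R}.
Variables (A : set T1) (B : set T2) (mA : measurable A) (mB : measurable B).

Lemma integrable_tensor (f : T1 -> R) (g : T2 -> R) :
  m1.-integrable A (EFin \o f) -> m2.-integrable B (EFin \o g) ->
  (m1 \x m2)%E.-integrable (A `*` B) (EFin \o (fun z => f z.1 * g z.2)).
Proof.
move=> fi gi; have mAB := measurableX mA mB.
pose f0 := f \_ A; pose g0 := g \_ B.
have f0i : m1.-integrable setT (EFin \o f0).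
  have := (integrable_mkcond _ mA).1 fi.
  by apply: eq_integrable => // x _; rewrite /f0 /patch /=; case: ifP.
have g0i : m2.-integrable setT (EFin \o g0).
  have := (integrable_mkcond _ mB).1 gi.
  by apply: eq_integrable => // x _; rewrite /g0 /patch /=; case: ifP.
have mf0 := integrable_measurable f0i.
have mg0 := integrable_measurable g0i.
suff h : (m1 \x m2)%E.-integrable setT (EFin \o (fun z => f0 z.1 * g0 z.2)).
  have := integrableS measurableT mAB (@subsetT _ _) h.
  apply: integrable_ext => // -[x y]; rewrite in_setX => /andP[/= xA yB].
  by rewrite /f0 /g0 /patch xA yB.
apply/integrable12ltyP.
  apply/measurable_EFinP; apply: measurable_funM.
    exact: (measurableT_comp mf0 measurable_fst).
  exact: (measurableT_comp mg0 measurable_snd).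
have /integrableP[_ f0oo] := f0i; have /integrableP[_ g0oo] := g0i.
under eq_integral.
  move=> x _; under eq_integral do rewrite /= normrM EFinM.
  rewrite ge0_integralZl//; last first.
    by apply/measurable_EFinP; exact: measurableT_comp.
  over.
rewrite ge0_integralZr//; last first.
- exact: integral_ge0.
- by apply/measurable_EFinP; exact: measurableT_comp.
rewrite lte_mul_pinfty//; first exact: integral_ge0.
rewrite ge0_fin_numE//; exact: integral_ge0.
Qed.

(** This is how Fubini's theorem becomes applicable below: h is the indicator function of
    a triangle, or a trigonometric kernel. *)
Lemma integrable_tensor_bounded (f : T1 -> R) (g : T2 -> R) (h : T1 * T2 -> R) (M : R) :
  m1.-integrable A (EFin \o f) -> m2.-integrable B (EFin \o g) ->
  measurable_fun (A `*` B) h -> (forall z, `|h z| <= M) ->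
  (m1 \x m2)%E.-integrable (A `*` B) (EFin \o (fun z => h z * (f z.1 * g z.2))).
Proof.
move=> fi gi mh hM; apply: (@integrable_mul_bounded _ _ _ _ _ _ M) => //.
- exact: measurableX.
- exact: integrable_tensor.
Qed.

End tensor.

(** * Primitives of integrable functions *)

Section primitives.
Variable R : realType.
Local Notation leb := (@lebesgue_measure R).
Implicit Types f g F G : R -> R.

Local Notation mR := (measurableTypeR R).

Lemma measurable_oo (a b : R) : measurable (`]a, b[%classic : set mR).
Proof. exact: measurable_itv. Qed.

Lemma lebesgue_itv_lty (a b : R) : (leb `]a, b[ < +oo)%E.
Proof. by rewrite lebesgue_measure_itv/=; case: ifP => _; rewrite ?ltry// EFinN -EFinD ltry. Qed.

Lemma integrable_itv_sub (a b c d : R) f : c <= a -> b <= d ->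
  leb.-integrable `]c, d[ (EFin \o f) -> leb.-integrable `]a, b[ (EFin \o f).
Proof.
move=> ca bd; apply: integrableS => //.
by apply: subset_itvW.
Qed.

Lemma Rintegral_oc (a b : R) f : leb.-integrable `]a, b[ (EFin \o f) ->
  \int[leb]_(x in `]a, b]) f x = \int[leb]_(x in `]a, b[) f x.
Proof. by move=> fi; rewrite -Rintegral_itv_bndo_bndc. Qed.

Lemma Rintegral_cut (T x : R) f : x <= T ->
  \int[leb]_(y in `]0, T[) ((y < x)%R%:R * f y) = \int[leb]_(y in `]0, x[) f y.
Proof.
move=> xT; have -> : `]0, x[%classic = `]0, T[ `&` [set y | y < x].
  apply/seteqP; split=> y /=; rewrite !in_itv/=.
    by move=> /andP[-> yx]; rewrite yx (lt_le_trans yx xT).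
  by move=> [/andP[-> _] ->].
rewrite Rintegral_mkcondr; apply: eq_Rintegral => y _; rewrite /patch.
case: ifPn => [|/negP]; rewrite inE/=.
  by move=> ->; rewrite mul1r.
by move=> /negP/negbTE ->; rewrite mul0r.
Qed.

Lemma Rintegral_cut_le (T x : R) f : x < T ->
  leb.-integrable `]0, T[ (EFin \o f) ->
  \int[leb]_(y in `]0, T[) ((y <= x)%R%:R * f y) = \int[leb]_(y in `]0, x[) f y.
Proof.
move=> xT fi; rewrite -[RHS]Rintegral_oc; last first.
  exact: (integrable_itv_sub (lexx 0) (ltW xT) fi).
have -> : `]0, x]%classic = `]0, T[ `&` [set y | y <= x].
  apply/seteqP; split=> y /=; rewrite !in_itv/=.
    by move=> /andP[-> yx]; rewrite yx (le_lt_trans yx xT).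
  by move=> [/andP[-> _] ->].
rewrite Rintegral_mkcondr; apply: eq_Rintegral => y _; rewrite /patch.
case: ifPn => [|/negP]; rewrite inE/=.
  by move=> ->; rewrite mul1r.
by move=> /negP/negbTE ->; rewrite mul0r.
Qed.

Lemma measurable_boolR d (X : measurableType d) (D : set X) (p : X -> bool) :
  measurable_fun D p -> measurable_fun D (fun x => (p x)%:R : R).
Proof.
move=> mp; have mb : measurable_fun [set: bool] (fun b : bool => b%:R : R) by [].
exact: (measurableT_comp mb mp).
Qed.

Lemma measurable_ltR (D : set (R * R)) :
  measurable_fun D (fun z : R * R => (z.2 < z.1)%R%:R : R).
Proof.
apply: measurable_boolR; apply: measurable_fun_ltr; apply: measurable_funTS.
  exact: measurable_snd.
exact: measurable_fst.
Qed.

Lemma measurable_leR (D : set (R * R)) :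
  measurable_fun D (fun z : R * R => (z.1 <= z.2)%R%:R : R).
Proof.
apply: measurable_boolR; apply: measurable_fun_ler; apply: measurable_funTS.
  exact: measurable_fst.
exact: measurable_snd.
Qed.

Let normr_bool (b : bool) : `|b%:R : R| <= 1.
Proof. by case: b; rewrite ?normr1 ?normr0. Qed.

Lemma integrable_mul_primitive (T : R) f g :
  leb.-integrable `]0, T[ (EFin \o f) -> leb.-integrable `]0, T[ (EFin \o g) ->
  leb.-integrable `]0, T[ (EFin \o (fun s => f s * \int[leb]_(x in `]0, s[) g x)).
Proof.
move=> fi gi.
have i1 := integrable_tensor_bounded (measurable_oo _ _) (measurable_oo _ _)
  fi gi (@measurable_ltR (`]0, T[ `*` `]0, T[)) (fun z => normr_bool (z.2 < z.1)).
have := Fubini_integrable1 (measurable_oo _ _) (measurable_oo _ _) i1.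
apply: integrable_ext => // x; rewrite inE/= in_itv/= => /andP[x0 xT].
under eq_Rintegral do rewrite mulrCA.
rewrite RintegralZl//; last first.
  apply: (@integrable_mul_bounded _ _ _ _ _ _ 1) => //.
  by apply: measurable_boolR; apply: measurable_fun_ltr.
by rewrite Rintegral_cut// ltW.
Qed.

(** The square (0,T)^2 is cut along its diagonal, and the order of integration is
    exchanged in the upper triangle. *)
Lemma Rintegral_mul_triangle (T : R) f g :
  leb.-integrable `]0, T[ (EFin \o f) -> leb.-integrable `]0, T[ (EFin \o g) ->
  (\int[leb]_(s in `]0, T[) f s) * (\int[leb]_(s in `]0, T[) g s) =
  \int[leb]_(s in `]0, T[) (f s * \int[leb]_(x in `]0, s[) g x) +
  \int[leb]_(s in `]0, T[) (g s * \int[leb]_(x in `]0, s[) f x).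
Proof.
move=> fi gi; set D : set mR := `]0, T[%classic.
have mD : measurable D by exact: measurable_oo.
have gb (p : R -> bool) : measurable_fun D p ->
    leb.-integrable D (EFin \o (fun y => (p y)%:R * g y)).
  move=> mp; apply: (@integrable_mul_bounded _ _ _ _ _ _ 1) => //.
  exact: measurable_boolR.
have fb (p : R -> bool) : measurable_fun D p ->
    leb.-integrable D (EFin \o (fun y => (p y)%:R * f y)).
  move=> mp; apply: (@integrable_mul_bounded _ _ _ _ _ _ 1) => //.
  exact: measurable_boolR.
have i2 := integrable_tensor_bounded mD mD
  fi gi (@measurable_leR (D `*` D)) (fun z => normr_bool (z.1 <= z.2)).
rewrite -RintegralZr//.
have eqx : forall x, x \in D -> f x * \int[leb]_(s in D) g s =
   f x * \int[leb]_(y in `]0, x[) g y +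
   \int[leb]_(y in D) ((x <= y)%R%:R * (f x * g y)).
  move=> x; rewrite inE /D/= in_itv/= => /andP[x0 xT].
  under [X in _ = _ + X]eq_Rintegral do rewrite mulrCA.
  rewrite [X in _ = _ + X]RintegralZl//; last by apply: gb; exact: measurable_fun_ler.
  rewrite -mulrDr; congr (_ * _).
  rewrite -[X in _ = X + _](@Rintegral_cut T _ _ (ltW xT)).
  rewrite -RintegralD//; last 2 first.
  - by apply: gb; exact: measurable_fun_ltr.
  - by apply: gb; exact: measurable_fun_ler.
  apply: eq_Rintegral => y _; rewrite -mulrDl leNgt -natrD.
  by case: (y < x); rewrite ?mul1r.
rewrite (eq_Rintegral _ eqx) RintegralD//; last 2 first.
- exact: integrable_mul_primitive.
- exact: (Fubini_integrable1 mD mD i2).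
congr (_ + _).
rewrite [LHS](Fubini_swap mD mD i2).
apply: eq_Rintegral => y; rewrite inE /D/= in_itv/= => /andP[y0 yT].
under eq_Rintegral do rewrite mulrA [_ * g y]mulrC.
rewrite RintegralZl//; last by apply: fb; exact: measurable_fun_ler.
by rewrite Rintegral_cut_le.
Qed.

(** F is absolutely continuous on [0,T] with density f. The densities met below are not
    continuous (the control u is merely square-integrable), so that F need not be
    differentiable in the classical sense. *)
Definition primitive (T : R) f F := leb.-integrable `]0, T[ (EFin \o f) /\
  forall t, 0 <= t <= T -> F t = F 0 + \int[leb]_(s in `]0, t[) f s.

Lemma primitive_bounded T f F t : primitive T f F -> 0 <= t <= T ->
  `|F t| <= `|F 0| + \int[leb]_(s in `]0, T[) `|f s|.
Proof.
move=> [fi fF] tT; rewrite fF//; apply: le_trans (ler_normD _ _) _.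
rewrite lerD2l; case/andP: tT => t0 tT.
apply: le_trans (le_normr_Rintegral _ (integrable_itv_sub (lexx 0) tT fi)) _ => //.
rewrite -(Rintegral_cut _ tT); apply: le_Rintegral => //.
- apply: (@integrable_mul_bounded _ _ _ _ _ _ 1) => //.
  + by apply: measurable_boolR; exact: measurable_fun_ltr.
  + exact: (integrable_norm fi).
- exact: (integrable_norm fi).
- by move=> x _; case: (_ < _); rewrite ?mul1r ?mul0r.
Qed.

Lemma integrable_const (a b c : R) : leb.-integrable `]a, b[ (EFin \o (fun=> c)).
Proof.
apply: measurable_bounded_integrable => //; first exact: lebesgue_itv_lty.
by exists `|c|; split; [exact: num_real | move=> x cx y _; exact: ltW].
Qed.

Lemma primitive_integrable T f F : primitive T f F ->
  leb.-integrable `]0, T[ (EFin \o F).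
Proof.
move=> [fi fF].
have := integrable_mul_primitive (integrable_const 0 T 1) fi.
move=> /(integrable_add (measurable_oo _ _) (integrable_const 0 T (F 0))).
apply: integrable_ext => // t; rewrite inE/= in_itv/= => /andP[t0 tT].
by rewrite mul1r [RHS]fF// (ltW t0) (ltW tT).
Qed.

Lemma primitive_measurable T f F : primitive T f F ->
  measurable_fun (`]0, T[ : set mR) F.
Proof. by move=> /primitive_integrable; exact: integrable_measurable. Qed.

Lemma primitive_mul_integrable T f F g : primitive T f F ->
  leb.-integrable `]0, T[ (EFin \o g) ->
  leb.-integrable `]0, T[ (EFin \o (fun s => F s * g s)).
Proof.
move=> fF gi; apply: (@integrable_mul_bounded _ _ _ _ _ _
  (`|F 0| + \int[leb]_(s in `]0, T[) `|f s|)) => //.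
- exact: primitive_measurable fF.
- move=> x /=; rewrite in_itv/= => /andP[x0 xT].
  by apply: (primitive_bounded fF); rewrite !ltW.
Qed.

(** Writing F = F 0 + (integral of f), and the same for G, only the product of the two
    integrals is not linear; [Rintegral_mul_triangle] on (0,t) expands it. *)
Lemma primitiveM T f F g G : primitive T f F -> primitive T g G ->
  primitive T (fun s => f s * G s + F s * g s) (fun s => F s * G s).
Proof.
move=> fF gG; have [fi hF] := fF; have [gi hG] := gG.
have i1 : leb.-integrable `]0, T[ (EFin \o (fun s => f s * G s)).
  apply: (integrable_ext _ _ (primitive_mul_integrable gG fi)) => // x _.
  by rewrite mulrC.
have i2 := primitive_mul_integrable fF gi.
split; first exact: integrable_add.
move=> t /[dup] tT /andP[t0 tT'].
have sub h : leb.-integrable `]0, T[ (EFin \o h) ->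
  leb.-integrable `]0, t[ (EFin \o h) by exact: integrable_itv_sub.
rewrite (hF _ tT) (hG _ tT) RintegralD//; [|exact: sub..].
have eF : \int[leb]_(x in `]0, t[) (F x * g x) = F 0 * \int[leb]_(x in `]0, t[) g x
    + \int[leb]_(x in `]0, t[) (g x * \int[leb]_(s in `]0, x[) f s).
  rewrite -[F 0 * _](RintegralZl _ (measurable_oo _ _) (sub _ gi)).
  rewrite -RintegralD//; last 2 first.
  - by apply: integrable_scale => //; exact: sub.
  - by apply: integrable_mul_primitive; exact: sub.
  apply: eq_Rintegral => x; rewrite inE/= in_itv/= => /andP[x0 xt].
  rewrite hF; first by rewrite mulrDl [X in _ + X]mulrC.
  by rewrite (ltW x0) (le_trans (ltW xt)).
have eG : \int[leb]_(x in `]0, t[) (f x * G x) = G 0 * \int[leb]_(x in `]0, t[) f x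
    + \int[leb]_(x in `]0, t[) (f x * \int[leb]_(s in `]0, x[) g s).
  rewrite -[G 0 * _](RintegralZl _ (measurable_oo _ _) (sub _ fi)).
  rewrite -RintegralD//; last 2 first.
  - by apply: integrable_scale => //; exact: sub.
  - by apply: integrable_mul_primitive; exact: sub.
  apply: eq_Rintegral => x; rewrite inE/= in_itv/= => /andP[x0 xt].
  rewrite hG; first by rewrite mulrDr [f x * G 0]mulrC.
  by rewrite (ltW x0) (le_trans (ltW xt)).
rewrite eF eG mulrDl !mulrDr (Rintegral_mul_triangle (sub _ fi) (sub _ gi)).
set a := F 0; set b := G 0; set c := Rintegral _ _ _; set e := Rintegral _ _ _.
set h := Rintegral _ _ _; set k := Rintegral _ _ _.
by clearbody a b c e h k; ring.
Qed.

Lemma primitive_ext T f g F : {in `]0, T[, f =1 g} -> primitive T f F -> primitive T g F.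
Proof.
move=> fg [fi hF]; split; first by apply: (integrable_ext _ _ fi) => // x; rewrite inE; exact: fg.
move=> t /[dup] tT /andP[t0 tT']; rewrite hF//; congr (_ + _).
apply: eq_Rintegral => x; rewrite inE/= in_itv/= => /andP[x0 xt].
by apply: fg; rewrite in_itv/= x0 (lt_le_trans xt).
Qed.

Lemma primitive_ae (T : R) f g F : measurable_fun (`]0, T[ : set mR) g ->
  {ae leb, forall x, x \in `]0, T[ -> f x = g x} ->
  primitive T f F -> primitive T g F.
Proof.
move=> mg fg [fi hF]; have mf := integrable_measurable fi; split.
  apply/integrableP; split; first exact/measurable_EFinP.
  have /integrableP[_] := fi; apply: le_lt_trans.
  rewrite le_eqVlt; apply/orP; left; apply/eqP.
  apply: ae_eq_integral => //.
  - by apply: measurableT_comp => //; exact/measurable_EFinP.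
  - by apply: measurableT_comp => //; exact/measurable_EFinP.
  - by apply: ae_imply fg => x fg xT; rewrite /= fg.
move=> t /[dup] tT /andP[t0 tT']; rewrite hF//; congr (_ + _).
have sub : `]0, t[ `<=` `]0, T[ by apply: subset_itvW.
apply: ae_eq_Rintegral => //.
- exact: measurable_funS mf.
- exact: measurable_funS mg.
- by apply: ae_imply fg => x fg xT; apply: fg; exact: sub.
Qed.

Lemma primitive_end T f F : 0 <= T -> primitive T f F ->
  \int[leb]_(s in `]0, T[) f s = F T - F 0.
Proof.
by move=> T0 [_ ->]; rewrite ?T0 ?lexx//; ring.
Qed.

Lemma continuous_integrable_itv (a b : R) f : continuous f ->
  leb.-integrable `]a, b[ (EFin \o f).
Proof.
move=> cf; apply: (@integrableS _ _ _ _ (`[a, b]%classic : set mR)) => //.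
  exact: subset_itv_oo_cc.
apply: continuous_compact_integrable; first exact: segment_compact.
exact: continuous_subspaceT.
Qed.

Lemma Rintegral_derive (a b : R) f F : a <= b -> (forall x : R, is_derive x (1 : R) F (f x)) ->
  continuous f -> \int[leb]_(x in `]a, b[) f x = F b - F a.
Proof.
move=> ab dF cf; move: ab; rewrite le_eqVlt => /predU1P[->|ab].
  by rewrite set_itv_ge ?bnd_simp// Rintegral_set0 subrr.
have cF : continuous F.
  by move=> x; apply/differentiable_continuous/derivable1_diffP; apply: ex_derive.
have dLR : derivable_oo_LRcontinuous F a b.
  split.
  - by move=> x _; apply: ex_derive.
  - by apply: cvg_at_right_filter; exact: cF.
  - by apply: cvg_at_left_filter; exact: cF.
have h := @continuous_FTC2 R f F a b ab (continuous_subspaceT cf) dLR.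
rewrite -Rintegral_oc; last exact: continuous_integrable_itv.
rewrite Rintegral_itv_obnd_cbnd; last first.
  apply: (@integrableS _ _ _ _ (`[a, b]%classic : set mR)) => //.
    exact: subset_itv_oc_cc.
  apply: continuous_compact_integrable; first exact: segment_compact.
  exact: continuous_subspaceT.
rewrite /Rintegral h /=; first by ring.
by move=> x _; rewrite derive1E; apply: derive_val.
Qed.

Lemma derive_primitive T f F : (forall x : R, is_derive x (1 : R) F (f x)) ->
  continuous f -> primitive T f F.
Proof.
move=> dF cf; split; first exact: continuous_integrable_itv.
by move=> t /andP[t0 tT]; rewrite (Rintegral_derive t0 dF cf); ring.
Qed.

End primitives.

(** * Derivatives and oscillating integrals *)

Section derivative_rules.
Variable R : realType.
Implicit Types (f g : R -> R) (x c a b : R).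

Lemma is_derive_congr f x a b : a = b -> is_derive x (1 : R) f a -> is_derive x (1 : R) f b.
Proof. by move=> ->. Qed.

Lemma is_derive_add f g x a b : is_derive x (1 : R) f a -> is_derive x (1 : R) g b ->
  is_derive x (1 : R) (fun y => f y + g y) (a + b).
Proof. by move=> fa gb; exact: (@is_deriveD _ _ _ f g). Qed.

Lemma is_derive_sub f g x a b : is_derive x (1 : R) f a -> is_derive x (1 : R) g b ->
  is_derive x (1 : R) (fun y => f y - g y) (a - b).
Proof. by move=> fa gb; exact: (@is_deriveB _ _ _ f g). Qed.

Lemma is_derive_mul f g x a b : is_derive x (1 : R) f a -> is_derive x (1 : R) g b ->
  is_derive x (1 : R) (fun y => f y * g y) (a * g x + f x * b).
Proof.
move=> fa gb; have := @is_deriveM _ _ f g x 1 a b fa gb.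
apply: is_derive_congr; rewrite addrC; congr (_ + _).
exact: mulrC.
Qed.

Lemma is_derive_scale f x a c : is_derive x (1 : R) f a ->
  is_derive x (1 : R) (fun y => c * f y) (c * a).
Proof. by move=> fa; exact: (is_deriveZ c). Qed.

Lemma is_derive_const c x : is_derive x (1 : R) (fun=> c) 0.
Proof. exact: is_derive_cst. Qed.

Lemma is_derive_lin c x : is_derive x (1 : R) (fun y => c * y) c.
Proof.
have := @is_derive_scale id x 1 c (is_derive_id _ _); by rewrite mulr1.
Qed.

Lemma is_derive_bigsum (I : Type) (s : seq I) (h : I -> R -> R) (dh : I -> R) x :
  (forall i, is_derive x (1 : R) (h i) (dh i)) ->
  is_derive x (1 : R) (fun y => \sum_(i <- s) h i y) (\sum_(i <- s) dh i).
Proof.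
move=> hd; elim: s => [|i s IH].
  by under eq_fun do rewrite big_nil; rewrite big_nil; exact: is_derive_const.
by under eq_fun do rewrite big_cons; rewrite big_cons; exact: is_derive_add.
Qed.

Lemma is_derive_comp_lin f a c x : is_derive (c * x) (1 : R) f a ->
  is_derive x (1 : R) (fun y => f (c * y)) (c * a).
Proof.
move=> fa; have := @is_derive1_comp R f (fun y => c * y) x a c fa (is_derive_lin _ _).
by rewrite mulrC.
Qed.

Lemma is_derive_expRM c x : is_derive x (1 : R) (fun y => expR (c * y)) (c * expR (c * x)).
Proof. exact: is_derive_comp_lin. Qed.

Lemma is_derive_sinM c x : is_derive x (1 : R) (fun y => sin (c * y)) (c * cos (c * x)).
Proof. exact: is_derive_comp_lin. Qed.

Lemma is_derive_cosM c x : is_derive x (1 : R) (fun y => cos (c * y)) (- (c * sin (c * x))).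
Proof. by rewrite -mulrN; exact: is_derive_comp_lin. Qed.

Lemma is_derive_inv f a x : f x != 0 -> is_derive x (1 : R) f a ->
  is_derive x (1 : R) (fun y => (f y)^-1) (- (a / (f x) ^+ 2)).
Proof.
move=> fx fa; have := @is_deriveV R f x a 1 fx fa.
by apply: is_derive_congr; rewrite mulrC -mulNr.
Qed.

Lemma is_derive_cont f a x : is_derive x (1 : R) f a -> {for x, continuous f}.
Proof.
move=> fa; apply/differentiable_continuous/derivable1_diffP; exact: ex_derive.
Qed.

Lemma mean_value f (f' : R -> R) (a b : R) : a <= b ->
  (forall x, a <= x <= b -> is_derive x (1 : R) f (f' x)) ->
  exists2 c, a <= c <= b & f b - f a = f' c * (b - a).
Proof.
move=> ab fd; have [||c] := @MVT_segment R f f' a b ab.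
- by move=> x; rewrite in_itv/= => /andP[ax xb]; apply: fd; rewrite !ltW.
- apply: continuous_in_subspaceT => x; rewrite inE/= in_itv/= => /fd.
  exact: is_derive_cont.
by rewrite in_itv/= => cab e; exists c.
Qed.

Lemma mean_value_le f (f' : R -> R) (a b K : R) : a <= b ->
  (forall x, a <= x <= b -> is_derive x (1 : R) f (f' x)) ->
  (forall x, a <= x <= b -> `|f' x| <= K) ->
  `|f b - f a| <= K * (b - a).
Proof.
move=> ab fd fK; have [c cab ->] := mean_value ab fd.
by rewrite normrM (@ger0_norm _ (b - a)) ?subr_ge0// ler_wpM2r ?subr_ge0// fK.
Qed.

Lemma nondecreasing_derive f (f' : R -> R) (a b : R) : a <= b ->
  (forall x, a <= x <= b -> is_derive x (1 : R) f (f' x)) ->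
  (forall x, a <= x <= b -> 0 <= f' x) -> f a <= f b.
Proof.
move=> ab fd f0; have [c cab e] := mean_value ab fd.
by rewrite -subr_ge0 e mulr_ge0 ?f0// subr_ge0.
Qed.

(** Adding cos(M x) rho(x) / M to f replaces the derivative sin(M x) rho(x), which does not
    tend to 0, by cos(M x) rho'(x) / M, which is at most S' / M in absolute value. S is
    any function whose derivative dominates |rho'|: when rho is monotone, rho or - rho. *)
Lemma oscillation (M a b : R) f (rho rho' S S' : R -> R) : 0 < M -> a <= b ->
  (forall x, a <= x <= b -> is_derive x (1 : R) f (sin (M * x) * rho x)) ->
  (forall x, a <= x <= b -> is_derive x (1 : R) rho (rho' x)) ->
  (forall x, a <= x <= b -> is_derive x (1 : R) S (S' x)) ->
  (forall x, a <= x <= b -> `|rho' x| <= S' x) ->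
  `|f b - f a| <= (`|rho a| + `|rho b| + (S b - S a)) / M.
Proof.
move=> M0 ab df drho dS rS; have Mn0 : M != 0 by rewrite gt_eqF.
pose Q x := f x + M^-1 * (cos (M * x) * rho x).
have dQ x : a <= x <= b -> is_derive x (1 : R) Q (M^-1 * (cos (M * x) * rho' x)).
  move=> xab; rewrite /Q; apply: (@is_derive_congr _ _
    (sin (M * x) * rho x + M^-1 * (- (M * sin (M * x)) * rho x + cos (M * x) * rho' x))).
    by field.
  apply: is_derive_add; first exact: df.
  apply: is_derive_scale; apply: is_derive_mul; [exact: is_derive_cosM|exact: drho].
have cb x : a <= x <= b -> `|cos (M * x) * rho' x| <= S' x.
  move=> xab; rewrite normrM (le_trans _ (rS x xab))//.
  by rewrite ler_piMl// cos_max.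
have h1 : Q b - M^-1 * S b <= Q a - M^-1 * S a.
  rewrite -[leLHS]opprK -[leRHS]opprK lerN2.
  have := @nondecreasing_derive (fun x => M^-1 * S x - Q x)
    (fun x => M^-1 * S' x - M^-1 * (cos (M * x) * rho' x)) a b ab.
  rewrite !opprB; apply.
    by move=> x xab; apply: is_derive_sub; [apply: is_derive_scale; exact: dS|exact: dQ].
  move=> x xab; rewrite -mulrBr mulr_ge0 ?invr_ge0 ?(ltW M0)// subr_ge0.
  by have := cb x xab; rewrite ler_norml => /andP[].
have h2 : Q a + M^-1 * S a <= Q b + M^-1 * S b.
  apply: (@nondecreasing_derive (fun x => Q x + M^-1 * S x)
    (fun x => M^-1 * (cos (M * x) * rho' x) + M^-1 * S' x) a b ab).
    by move=> x xab; apply: is_derive_add; [exact: dQ|apply: is_derive_scale; exact: dS].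
  move=> x xab; rewrite -mulrDr mulr_ge0 ?invr_ge0 ?(ltW M0)//.
  by have := cb x xab; rewrite ler_norml -subr_ge0 opprK addrC => /andP[].
have ca : `|cos (M * a) * rho a| <= `|rho a|.
  by rewrite normrM ler_piMl// cos_max.
have cb' : `|cos (M * b) * rho b| <= `|rho b|.
  by rewrite normrM ler_piMl// cos_max.
move: ca cb' h1 h2; rewrite /Q !ler_norml => /andP[a1 a2] /andP[b1 b2].
have Mi : 0 < M^-1 by rewrite invr_gt0.
move: (cos (M * a) * rho a) (cos (M * b) * rho b) a1 a2 b1 b2 => A B.
move=> a1 a2 b1 b2 h1 h2.
have a1' : M^-1 * (- `|rho a|) <= M^-1 * A by rewrite ler_pM2l.
have a2' : M^-1 * A <= M^-1 * `|rho a| by rewrite ler_pM2l.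
have b1' : M^-1 * (- `|rho b|) <= M^-1 * B by rewrite ler_pM2l.
have b2' : M^-1 * B <= M^-1 * `|rho b| by rewrite ler_pM2l.
rewrite ![_ / M]mulrC !mulrDr mulrN; apply/andP; split; lra.
Qed.

End derivative_rules.

(** * The sine series of the parabola x - x ^ 2 *)

Section parabola_series.
Variable R : realType.
Implicit Types (x : R) (n N : nat).

Lemma sin_natpi n : sin (n%:R * pi) = 0 :> R.
Proof.
elim: n => [|n IH]; first by rewrite mul0r sin0.
by rewrite -natr1 mulrDl mul1r sinD IH sinpi mul0r mulr0 addr0.
Qed.

Lemma cos_natpi_sqr n : cos (n%:R * pi) ^+ 2 = 1 :> R.
Proof. by rewrite cos2sin2 sin_natpi expr0n subr0. Qed.

Definition sin2_series N x : R :=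
  \sum_(1 <= n < N.+1) 2 * sin (n%:R * pi * x) ^+ 2 / (n%:R * pi) ^+ 2.

(** The Dirichlet kernel 1 + 2 sum_n cos(2 n pi x), with cos(2 n pi x) in the form in which
    it occurs as the derivative of sin(n pi x) cos(n pi x) / (n pi). *)
Definition dirichlet N x : R :=
  1 + 2 * \sum_(1 <= n < N.+1) (cos (n%:R * pi * x) ^+ 2 - sin (n%:R * pi * x) ^+ 2).

Lemma dirichletE N x : dirichlet N x * sin (pi * x) = sin ((2 * N%:R + 1) * pi * x).
Proof.
rewrite /dirichlet; elim: N => [|N IH].
  by rewrite big_geq// mulr0 addr0 add0r !mul1r.
rewrite big_nat_recr//= mulrDr addrA mulrDl {}IH.
set A := N.+1%:R * pi * x.
have -> : (2 * N%:R + 1) * pi * x = A + A - pi * x.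
  by rewrite /A -natr1; ring.
have -> : (2 * N.+1%:R + 1) * pi * x = A + A + pi * x.
  by rewrite /A -natr1; ring.
rewrite sinB !sinD !cosD; ring.
Qed.

Definition parabola_error N x : R := sin2_series N x - (x - x ^+ 2).
Definition dparabola_error N x : R :=
  \sum_(1 <= n < N.+1) 4 * (sin (n%:R * pi * x) * cos (n%:R * pi * x)) / (n%:R * pi)
  - (1 - 2 * x).

Lemma natpi_neq0 n : (0 < n)%N -> n%:R * pi != 0 :> R.
Proof. by move=> n0; rewrite mulf_neq0 ?pnatr_eq0 ?gt_eqF ?pi_gt0//. Qed.

Lemma is_derive_bigsum_nat (h : nat -> R -> R) (dh : nat -> R) a b x :
  (forall i, (a <= i)%N -> is_derive x (1 : R) (h i) (dh i)) ->
  is_derive x (1 : R) (fun y => \sum_(a <= i < b) h i y) (\sum_(a <= i < b) dh i).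
Proof.
move=> hd; under eq_fun do rewrite big_nat_cond big_mkcond.
rewrite [X in is_derive _ _ _ X]big_nat_cond big_mkcond.
apply: is_derive_bigsum => i; case: ifP => [/andP[/andP[ai _] _]|_]; first exact: hd.
exact: is_derive_const.
Qed.

Lemma is_derive_parabola_error N x :
  is_derive x (1 : R) (parabola_error N) (dparabola_error N x).
Proof.
rewrite /parabola_error /dparabola_error; apply: is_derive_sub.
  apply: is_derive_bigsum_nat => n n1.
  have n0 := natpi_neq0 n1.
  have ds := is_derive_sinM (n%:R * pi) x.
  under eq_fun do rewrite expr2 mulrAC.
  apply: is_derive_congr (is_derive_scale _ (is_derive_mul ds ds)).
  by move: (n%:R * pi : R) n0 => w w0; field.
under eq_fun do rewrite expr2.
have di := is_derive_lin 1 x.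
under eq_fun do rewrite -[X in X - _]mul1r -[X in _ - X * _]mul1r -[X in _ - _ * X]mul1r.
by apply: is_derive_congr (is_derive_sub di (is_derive_mul di di)); ring.
Qed.

Lemma is_derive_dparabola_error N x :
  is_derive x (1 : R) (dparabola_error N) (2 * dirichlet N x).
Proof.
rewrite /dparabola_error /dirichlet; set D := (X in 2 * X).
have -> : 2 * D = \sum_(1 <= n < N.+1)
    4 * (cos (n%:R * pi * x) ^+ 2 - sin (n%:R * pi * x) ^+ 2) - (0 - 2).
  by rewrite /D -mulr_sumr; ring.
apply: is_derive_sub; last first.
  by apply: is_derive_sub; exact: is_derive_lin.
apply: is_derive_bigsum_nat => n n1; have n0 := natpi_neq0 n1.
have ds := is_derive_sinM (n%:R * pi) x.
have dc := is_derive_cosM (n%:R * pi) x.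
under eq_fun do rewrite mulrAC.
apply: is_derive_congr (is_derive_scale _ (is_derive_mul ds dc)).
by move: (n%:R * pi : R) n0 => w w0; field.
Qed.

Lemma dparabola_error_half N : dparabola_error N (1 / 2) = 0.
Proof.
rewrite /dparabola_error (_ : 1 - 2 * (1 / 2) = 0 :> R) ?subr0; last by field.
rewrite big_nat_cond big1// => n _.
have /eqP : sin (n%:R * pi * (1 / 2) + n%:R * pi * (1 / 2)) = 0 :> R.
  by rewrite -mulrDr (_ : 1 / 2 + 1 / 2 = 1 :> R) ?mulr1 ?sin_natpi//; field.
rewrite sinD [cos _ * _]mulrC -mulr2n mulrn_eq0/= => /eqP ->.
by rewrite mulr0 mul0r.
Qed.

Lemma sin_pi_ge (d x : R) : 0 < d -> d <= x <= 1 / 2 -> sin (pi * d) <= sin (pi * x).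
Proof.
move=> d0 /andP[dx x2]; have p0 := pi_gt0 R.
have p1 : pi * d <= pi / 2 by nra.
have p2 : pi * x <= pi / 2 by nra.
have p3 : pi * d <= pi * x by rewrite ler_pM2l.
have p4 : 0 < pi * d by rewrite mulr_gt0.
move: p3; rewrite le_eqVlt => /predU1P[->//|p3]; apply: ltW.
by rewrite ltr_sin// in_itv/=; apply/andP; split; lra.
Qed.

(** The derivative of [dparabola_error] is twice the Dirichlet kernel, that is
    sin((2 N + 1) pi x) times 2 / sin(pi x), and [dparabola_error] vanishes at 1/2:
    away from 0 it is an oscillating integral. *)
Lemma dparabola_error_le (d x : R) N : 0 < d -> d <= x <= 1 / 2 ->
  `|dparabola_error N x| <= 4 / sin (pi * d) / ((2 * N%:R + 1) * pi).
Proof.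
move=> d0 /andP[dx x2]; have p0 := pi_gt0 R.
have sd : 0 < sin (pi * d).
  by apply: sin_gt0_pi; apply/andP; split; [rewrite mulr_gt0|nra].
have sy y : x <= y <= 1 / 2 -> sin (pi * d) <= sin (pi * y).
  by move=> /andP[xy y2]; apply: sin_pi_ge => //; rewrite y2 (le_trans dx).
have sy0 y : x <= y <= 1 / 2 -> sin (pi * y) != 0.
  by move=> /sy h; rewrite gt_eqF// (lt_le_trans sd).
pose rho (y : R) := 2 * (sin (pi * y))^-1.
pose rho' (y : R) := 2 * - ((pi * cos (pi * y)) / sin (pi * y) ^+ 2).
have drho y : x <= y <= 1 / 2 -> is_derive y (1 : R) rho (rho' y).
  move=> h; apply: is_derive_scale; apply: is_derive_inv; first exact: sy0.
  exact: is_derive_sinM.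
have M0 : 0 < (2 * N%:R + 1) * pi :> R.
  by rewrite mulr_gt0// ltr_wpDl// mulr_ge0.
have := @oscillation R ((2 * N%:R + 1) * pi) x (1 / 2) (dparabola_error N) rho rho'
  (fun y => - rho y) (fun y => - rho' y) M0 x2.
rewrite dparabola_error_half sub0r normrN => h.
apply: le_trans (h _ drho _ _) _.
- move=> y yx; apply: is_derive_congr (is_derive_dparabola_error N y).
  by rewrite -dirichletE /rho; field; exact: sy0.
- move=> y yx; rewrite -mulN1r.
  by under eq_fun do rewrite -mulN1r; apply: is_derive_scale; exact: drho.
- move=> y yx; rewrite ler0_norm// /rho' mulrN oppr_le0 mulr_ge0//.
  rewrite divr_ge0 ?sqr_ge0// mulr_ge0 ?(ltW p0)//.
  case/andP: yx => xy y2.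
  by apply: cos_ge0_pihalf; apply/andP; split; nra.
- have rx : 0 <= rho x <= 2 / sin (pi * d).
    have := sy x; rewrite lexx x2 => /(_ isT) sx.
    have sx0 := lt_le_trans sd sx.
    by rewrite /rho divr_ge0 ?(ltW sx0)//= ler_pM2l// lef_pV2.
  have r2 : 0 <= rho (1 / 2).
    have := sy (1 / 2); rewrite lexx x2 => /(_ isT) s2.
    by rewrite /rho divr_ge0// (le_trans (ltW sd)).
  rewrite ler_pM2r ?invr_gt0//; case/andP: rx => rx0 rx1.
  rewrite !ger0_norm//; lra.
Qed.

(** The terms are compared with the telescoping 1 / (n - 1) - 1 / n. *)
Lemma sin2_series_le N m x : (0 < N)%N -> (N <= m)%N ->
  0 <= sin2_series m x - sin2_series N x <= N%:R^-1.
Proof.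
move=> N0 Nm; rewrite /sin2_series (@big_cat_nat _ _ _ N.+1 1 m.+1)//= addrAC subrr add0r.
apply/andP; split.
  rewrite big_nat_cond sumr_ge0// => n _.
  by rewrite divr_ge0// ?sqr_ge0// mulr_ge0// sqr_ge0.
have -> : N%:R^-1 = m%:R^-1 + \sum_(N.+1 <= n < m.+1) ((n.-1)%:R^-1 - n%:R^-1) :> R.
  elim: m Nm => [|m IH]; first by rewrite leqn0 => /eqP ->; rewrite big_geq// addr0.
  rewrite leq_eqVlt => /predU1P[->|Nm]; first by rewrite big_geq// addr0.
  by rewrite big_nat_recr//= IH//; ring.
apply: ler_wpDl; first by rewrite invr_ge0.
rewrite big_nat_cond [leRHS]big_nat_cond; apply: ler_sum => n /andP[/andP[Nn _] _].
case: n Nn => // n; rewrite ltnS => Nn /=.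
have n0 : (0 < n)%N by exact: leq_trans Nn.
have n1 : (1 : R) <= n%:R by rewrite ler1n.
have -> : n%:R^-1 - n.+1%:R^-1 = (n%:R * n.+1%:R)^-1 :> R.
  have a0 : n%:R != 0 :> R by rewrite pnatr_eq0 -lt0n.
  have b0 : n%:R + 1 != 0 :> R by rewrite natr1 pnatr_eq0.
  by rewrite -natr1; field; rewrite a0 b0.
have s1 : sin (n.+1%:R * pi * x) ^+ 2 <= 1.
  have := cos2Dsin2 (n.+1%:R * pi * x).
  have := sqr_ge0 (cos (n.+1%:R * pi * x)); lra.
have p2 := pi_ge2 R.
apply: (@le_trans _ _ (2 / (n.+1%:R * pi) ^+ 2)).
  rewrite ler_pM2r; first by rewrite -[leRHS]mulr1 ler_pM2l.
  by rewrite invr_gt0 exprn_gt0// mulr_gt0// pi_gt0.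
have q0 : 0 < (n.+1%:R * pi) ^+ 2 :> R by rewrite exprn_gt0// mulr_gt0// pi_gt0.
rewrite ler_pdivrMr// mulrC ler_pdivlMr ?mulr_gt0// ?ltr0n//.
have nn : n.+1%:R = n%:R + 1 :> R by rewrite natr1.
rewrite nn exprMn; have : 4 <= (pi : R) ^+ 2 by nra.
move: (pi ^+ 2 : R) => q q4; nra.
Qed.

(** A point d close to 0 is chosen where the error is small for all large N at once, by
    continuity of a single partial sum at 0 and the tail bound of [sin2_series_le]. The
    error then varies by O(1/N) between d and x. *)
Lemma parabola_error_cvg_half x : 0 <= x <= 1 / 2 ->
  (fun N => parabola_error N x) @ \oo --> (0 : R).
Proof.
move=> /andP[]; rewrite le_eqVlt => /predU1P[<- _|x0 x2].
  have -> : (fun N => parabola_error N 0) = (fun=> 0 : R).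
    apply/funext => N; rewrite /parabola_error /sin2_series.
    rewrite big_nat_cond big1 ?expr0n/= ?subrr// => n _.
    by rewrite mulr0 sin0 expr0n/= mulr0 mul0r.
  exact: cvg_cst.
apply/cvgrPdist_le => e e0; near \oo => m.
have m0 : (0 < m)%N by near: m; exact: nbhs_infty_gt.
have me : m%:R^-1 <= e / 4.
  rewrite -[leRHS]invrK lef_pV2 ?posrE ?invr_gt0 ?divr_gt0 ?ltr0n//.
  by near: m; exact: nbhs_infty_ger.
have cm : {for (0 : R), continuous (parabola_error m)}.
  exact: (is_derive_cont (is_derive_parabola_error m 0)).
have pm0 : parabola_error m 0 = 0.
  rewrite /parabola_error /sin2_series big_nat_cond big1 ?expr0n/= ?subrr// => n _.
  by rewrite mulr0 sin0 expr0n/= mulr0 mul0r.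
have /cvgrPdist_le := cm; rewrite pm0 => /(_ (e / 4)).
rewrite divr_gt0// => /(_ isT) [r /= r0 hr].
pose d := Num.min x (r / 2).
have d0 : 0 < d by rewrite lt_min x0 divr_gt0.
have dx : d <= x by rewrite ge_min lexx.
have dr : `|parabola_error m d| <= e / 4.
  rewrite -normrN -sub0r; apply: hr => /=.
  rewrite sub0r normrN gtr0_norm// (@le_lt_trans _ _ (r / 2))//.
    by rewrite ge_min lexx orbT.
  by rewrite ltr_pdivrMr// ltr_pMr// ltr1n.
near=> N; rewrite sub0r normrN.
have mN : (m <= N)%N by near: N; exact: nbhs_infty_ge.
have tail : `|parabola_error N d - parabola_error m d| <= e / 4.
  have -> : parabola_error N d - parabola_error m d =
      sin2_series N d - sin2_series m d by rewrite /parabola_error; ring.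
  have /andP[t0 t1] := sin2_series_le d m0 mN.
  by rewrite ger0_norm// (le_trans t1).
have p0 := pi_gt0 R.
have sd : 0 < sin (pi * d).
  by apply: sin_gt0_pi; apply/andP; split; [rewrite mulr_gt0|nra].
set K := 4 / sin (pi * d).
have K0 : 0 < K by rewrite divr_gt0.
have osc : `|parabola_error N x - parabola_error N d| <=
    K / ((2 * N%:R + 1) * pi) * (x - d).
  apply: (mean_value_le dx) => y; first by move=> _; exact: is_derive_parabola_error.
  move=> /andP[dy yx]; apply: dparabola_error_le => //.
  by rewrite dy (le_trans yx).
have N0 : 0 < (2 * N%:R + 1 : R) by rewrite ltr_wpDl// mulr_ge0.
have NK : K / ((2 * N%:R + 1) * pi) * (x - d) <= e / 4.
  have NKe : K / (e / 4) <= N%:R by near: N; exact: nbhs_infty_ger.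
  have e4 : 0 < e / 4 by rewrite divr_gt0.
  rewrite ler_pdivrMr// in NKe.
  rewrite mulrAC ler_pdivrMr ?mulr_gt0//.
  have p2 := pi_ge2 R.
  have xd : 0 <= x - d <= 1 by apply/andP; split; lra.
  have : K * (x - d) <= K by case/andP: xd => ? ?; rewrite ger_pMr.
  move=> h; apply: (le_trans h); apply: (le_trans NKe); rewrite mulrC.
  rewrite ler_pM2l//.
  have : N%:R <= 2 * N%:R + 1 :> R by have : 0 <= N%:R :> R by []; lra.
  move=> h2; apply: (le_trans h2); rewrite ler_peMr ?(ltW N0)//; lra.
have := ler_normD (parabola_error N x - parabola_error N d)
  (parabola_error N d - parabola_error m d + parabola_error m d).
have := ler_normD (parabola_error N d - parabola_error m d) (parabola_error m d).
rewrite !subrK; lra.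
Unshelve. all: by end_near. Qed.

Lemma sin2_series_cvg x : 0 <= x <= 1 ->
  (fun N => sin2_series N x) @ \oo --> x - x ^+ 2.
Proof.
move=> /andP[x0 x1].
(* both sides are invariant under x |-> 1 - x *)
wlog x2 : x x0 x1 / x <= 1 / 2.
  move=> H; have [x2|x2] := leP x (1 / 2); first exact: H.
  have -> : x - x ^+ 2 = (1 - x) - (1 - x) ^+ 2 by ring.
  have -> : (fun N => sin2_series N x) = (fun N => sin2_series N (1 - x)).
    apply/funext => N; rewrite /sin2_series; apply: eq_bigr => n _.
    congr (2 * _ / _); rewrite mulrBr mulr1 sinB sin_natpi mul0r sub0r sqrrN.
    by rewrite exprMn cos_natpi_sqr mul1r.
  by apply: H; lra.
have -> : (fun N => sin2_series N x) = (fun N => parabola_error N x + (x - x ^+ 2)).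
  by apply/funext => N; rewrite /parabola_error subrK.
rewrite -[X in _ --> X]add0r; apply: cvgD; last exact: cvg_cst.
by apply: parabola_error_cvg_half; rewrite x0.
Qed.

(** Limit of [sin2_series_le] as m tends to infinity. *)
Lemma sin2_series_rate x N : 0 <= x <= 1 -> (0 < N)%N ->
  x - x ^+ 2 - sin2_series N x <= N%:R^-1.
Proof.
move=> x01 N0; have cv := sin2_series_cvg x01.
rewrite lerBlDr; apply: (cvgr_to_le cv).
near=> m; have Nm : (N <= m)%N by near: m; exact: nbhs_infty_ge.
by have /andP[_] := sin2_series_le x N0 Nm; rewrite lerBlDr.
Unshelve. all: by end_near. Qed.

End parabola_series.

Ltac nonneg := lazymatch goal with
  | |- is_true (0 <= _ * _) => apply: mulr_ge0; nonneg
  | |- is_true (0 <= _ + _) => apply: addr_ge0; nonneg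
  | |- is_true (0 <= _^-1) => rewrite invr_ge0; nonneg
  | |- is_true (0 <= _ ^+ _) => apply: exprn_ge0; nonneg
  | |- is_true (0 <= `|_|) => exact: normr_ge0
  | |- _ => first [exact: expR_ge0 | exact: pi_ge0 | by [] | exact: ltW]
  end.

(** * The Fourier transform of the Lorentzian *)

Section continuity_rules.
Variable R : realType.
Implicit Types (f g : R -> R) (c : R).

Lemma continuous_add f g : continuous f -> continuous g -> continuous (fun x => f x + g x).
Proof. by move=> cf cg x; apply: continuousD; [exact: cf|exact: cg]. Qed.

Lemma continuous_mul f g : continuous f -> continuous g -> continuous (fun x => f x * g x).
Proof. by move=> cf cg x; apply: continuousM; [exact: cf|exact: cg]. Qed.

Lemma continuous_id_fun : continuous (fun x : R => x).
Proof. by move=> x; exact: cvg_id. Qed.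

Lemma continuous_const c : continuous (fun _ : R => c).
Proof. by move=> x; exact: cst_continuous. Qed.

Lemma continuous_lin c : continuous (fun x : R => c * x).
Proof. exact (continuous_mul (@continuous_const c) continuous_id_fun). Qed.

Lemma continuous_comp_fun f g : continuous f -> continuous g -> continuous (fun x => f (g x)).
Proof. by move=> cf cg x; apply: continuous_comp; [exact: cg|exact: cf]. Qed.

Lemma continuous_inv f : (forall x, f x != 0) -> continuous f -> continuous (fun x => (f x)^-1).
Proof. by move=> f0 cf x; apply: continuousV; [exact: f0|exact: cf]. Qed.

Lemma continuous_cosM c : continuous (fun x : R => cos (c * x)).
Proof. by apply: continuous_comp_fun; [exact: continuous_cos|exact: continuous_lin]. Qed.

Lemma continuous_sinM c : continuous (fun x : R => sin (c * x)).
Proof. by apply: continuous_comp_fun; [exact: continuous_sin|exact: continuous_lin]. Qed.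

Lemma continuous_expRM c : continuous (fun x : R => expR (c * x)).
Proof. by apply: continuous_comp_fun; [exact: continuous_expR|exact: continuous_lin]. Qed.

End continuity_rules.

Section Lorentzian.
Variable R : realType.
Local Notation leb := (@lebesgue_measure R).
Local Notation mR := (measurableTypeR R).
Implicit Types (x w A : R).

Lemma Rintegral_const_oo (a b c : R) : a <= b -> \int[leb]_(_ in `]a, b[) c = c * (b - a).
Proof.
move=> ab; rewrite (Rintegral_derive ab (is_derive_lin c) (@continuous_const R c)).
by rewrite mulrBr.
Qed.

Lemma is_derive_Rintegral (B : set mR) (f df : R -> R -> R) (G : R -> R) (a : R) :
  measurable B -> (forall x, leb.-integrable B (EFin \o f x)) ->
  (forall x w, B w -> is_derive x (1 : R) (f ^~ w) (df x w)) ->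
  (forall w, 0 <= G w) -> leb.-integrable B (EFin \o G) ->
  (forall x w, B w -> `|df x w| <= G w) ->
  is_derive a (1 : R) (fun x => \int[leb]_(w in B) f x w) (\int[leb]_(w in B) df a w).
Proof.
move=> mB fi fd G0 Gi dG.
have aI : (`]a - 1, a + 1[%classic : set R) a.
  by rewrite /= in_itv/=; apply/andP; split; lra.
have d1 x w : B w -> partial1of2 f x w = df x w.
  by move=> Bw; rewrite partial1of2E; have ? := fd x w Bw; apply: derive_val.
have h1 x w : (`]a - 1, a + 1[%classic : set R) x -> B w -> derivable (f ^~ w) x 1.
  by move=> _ Bw; have ? := fd x w Bw; exact: ex_derive.
have h2 x w : (`]a - 1, a + 1[%classic : set R) x -> B w -> `|partial1of2 f x w| <= G w.
  by move=> _ Bw; rewrite d1// dG.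
have fi' x : (`]a - 1, a + 1[%classic : set R) x -> leb.-integrable B (EFin \o f x) by [].
split; first exact: (derivable_under_integral mB aI fi' h1 G0 Gi h2).
rewrite -derive1E (differentiation_under_integral mB aI fi' h1 G0 Gi h2).
by apply: eq_Rintegral => w /set_mem Bw; rewrite d1.
Qed.

Variable l : R.
Hypothesis l0 : 0 < l.

Definition lorentz w : R := l / (l ^+ 2 + w ^+ 2).

Let den_gt0 w : 0 < l ^+ 2 + w ^+ 2.
Proof. by rewrite ltr_wpDr ?sqr_ge0// exprn_gt0. Qed.

Let den_neq0 w : l ^+ 2 + w ^+ 2 != 0. Proof. by rewrite gt_eqF. Qed.

Let continuous_den : continuous (fun w : R => l ^+ 2 + w ^+ 2).
Proof.
under eq_fun do rewrite [X in _ + X]expr2.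
by apply: continuous_add; [exact: continuous_const|apply: continuous_mul; exact: continuous_id_fun].
Qed.

Lemma lorentz_ge0 w : 0 <= lorentz w.
Proof. by rewrite divr_ge0// ltW. Qed.

Lemma continuous_lorentz : continuous lorentz.
Proof.
apply: continuous_mul; first exact: continuous_const.
exact: continuous_inv.
Qed.

Lemma is_derive_atan_lorentz w :
  is_derive w (1 : R) (fun w => atan (l^-1 * w)) (lorentz w).
Proof.
apply: is_derive_congr (is_derive_comp_lin _); rewrite /lorentz.
by field; rewrite den_neq0 gt_eqF.
Qed.

Lemma integral_lorentz :
  (\int[leb]_w (lorentz w)%:E = (pi : R)%:E)%E.
Proof.
rewrite ge0_symfun_integralT; last 3 first.
- exact: lorentz_ge0.
- exact: continuous_lorentz.
- by move=> w; rewrite /lorentz /= sqrrN.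
rewrite -set_itvcy (@ge0_continuous_FTC2y R lorentz (fun w => atan (l^-1 * w)) 0 (pi / 2)).
- by rewrite mulr0 atan0 sube0 -EFinM; congr (_%:E); field.
- by move=> x _; exact: lorentz_ge0.
- by apply: continuous_subspaceT; exact: continuous_lorentz.
- apply: (cvg_comp _ _ _ (@cvgy_atan R)).
  by apply: gt0_cvgMry; [rewrite invr_gt0|exact: cvg_id].
- by move=> x _; have ? := is_derive_atan_lorentz x; exact: ex_derive.
- apply: cvg_at_right_filter; exact: is_derive_cont (is_derive_atan_lorentz 0).
- by move=> x _; rewrite derive1E; have ? := is_derive_atan_lorentz x; apply: derive_val.
Qed.

Lemma integrable_lorentz : leb.-integrable setT (EFin \o lorentz).
Proof.
apply/integrableP; split.
  by apply/measurable_EFinP; exact: continuous_measurable_fun continuous_lorentz.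
under eq_integral do rewrite /= ger0_norm ?lorentz_ge0//.
by rewrite integral_lorentz ltry.
Qed.

Lemma integrable_bounded_lorentz (h : R -> R) : measurable_fun setT h ->
  (forall w, `|h w| <= 1) -> leb.-integrable setT (EFin \o (fun w => h w * lorentz w)).
Proof.
move=> mh h1; apply: (@integrable_mul_bounded _ _ _ _ _ _ 1) => //.
exact: integrable_lorentz.
Qed.

Definition cos_lorentz x : R := \int[leb]_w (cos (w * x) * lorentz w).

Let cosMr_cont x : continuous (fun w : R => cos (w * x)).
Proof. by under eq_fun do rewrite mulrC; exact: continuous_cosM. Qed.

Let sinMr_cont x : continuous (fun w : R => sin (w * x)).
Proof. by under eq_fun do rewrite mulrC; exact: continuous_sinM. Qed.

Lemma integrable_cos_lorentz x : leb.-integrable setT (EFin \o (fun w => cos (w * x) * lorentz w)).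
Proof.
apply: integrable_bounded_lorentz; last by move=> w; exact: cos_max.
exact: continuous_measurable_fun.
Qed.

Lemma cos_lorentz0 : cos_lorentz 0 = pi.
Proof.
rewrite /cos_lorentz; under eq_Rintegral do rewrite mulr0 cos0 mul1r.
by rewrite /Rintegral integral_lorentz.
Qed.

Lemma continuous_cos_lorentz : continuous cos_lorentz.
Proof.
move=> x.
have := @continuity_under_integral R _ mR leb (fun x w => cos (w * x) * lorentz w) setT
  measurableT (x - 1) (x + 1) _ _ lorentz integrable_lorentz.
apply.
- by move=> y _; exact: integrable_cos_lorentz.
- apply: aeW => w _ y _.
  have h : continuous (fun y => cos (w * y) * lorentz w).
    by apply: continuous_mul; [exact: continuous_cosM|exact: continuous_const].
  exact: h.
- move=> y _; apply: aeW => w _; rewrite normrM (@ger0_norm _ (lorentz w)) ?lorentz_ge0//.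
  by rewrite ler_piMl ?lorentz_ge0// cos_max.
- by rewrite inE/= in_itv/=; apply/andP; split; lra.
Qed.

(** A truncated integral whose even part in x is the truncation of [cos_lorentz], as
    [trunc_cos_lorentzE] shows. The sine is added because the derivative of e^{l x} times this
    integral is then the oscillating function 2 e^{l x} sin(A x) / x, by
    [exp_lorentz_ode]; the truncation makes differentiation under the integral sign
    legitimate. *)
Definition exp_lorentz A x : R :=
  \int[leb]_(w in `]- A, A[) ((l * cos (w * x) + w * sin (w * x)) / (l ^+ 2 + w ^+ 2)).

Let kernel_cont x : continuous (fun w => (l * cos (w * x) + w * sin (w * x)) / (l ^+ 2 + w ^+ 2)).
Proof.
apply: continuous_mul; last exact: continuous_inv.
apply: continuous_add; apply: continuous_mul => //; first exact: continuous_const.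
exact: continuous_id_fun.
Qed.

Let dkernel_cont x : continuous
  (fun w => (- (l * w * sin (w * x)) + w ^+ 2 * cos (w * x)) / (l ^+ 2 + w ^+ 2)).
Proof.
apply: continuous_mul; last exact: continuous_inv.
under eq_fun do rewrite -mulNr expr2 -mulNr.
apply: continuous_add; apply: continuous_mul => //; first exact: continuous_lin.
by apply: continuous_mul; exact: continuous_id_fun.
Qed.

Lemma is_derive_exp_lorentz A x : is_derive x (1 : R) (exp_lorentz A)
  (\int[leb]_(w in `]- A, A[)
     ((- (l * w * sin (w * x)) + w ^+ 2 * cos (w * x)) / (l ^+ 2 + w ^+ 2))).
Proof.
apply: (@is_derive_Rintegral _ (fun x w => (l * cos (w * x) + w * sin (w * x)) / (l ^+ 2 + w ^+ 2))
  (fun x w => (- (l * w * sin (w * x)) + w ^+ 2 * cos (w * x)) / (l ^+ 2 + w ^+ 2))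
  (fun w => 2)).
- exact: measurable_oo.
- by move=> y; exact: continuous_integrable_itv.
- move=> y w _; under eq_fun do rewrite mulrC.
  apply: is_derive_congr (is_derive_scale _ (is_derive_add
    (is_derive_scale _ (is_derive_cosM _ _)) (is_derive_scale _ (is_derive_sinM _ _)))).
  by ring.
- by [].
- by apply: continuous_integrable_itv; exact: continuous_const.
(* |l w| + w^2 <= 2 (l^2 + w^2) gives the dominating constant 2 *)
- move=> y w _; rewrite normrM normfV (@gtr0_norm _ (l ^+ 2 + _))// ler_pdivrMr//.
  have := sin_max (w * y); have := cos_max (w * y).
  rewrite !ler_norml => /andP[c1 c2] /andP[s1 s2].
  have := sqr_ge0 w; have := sqr_ge0 (l - w); have := sqr_ge0 (l + w).
  move: (cos _) (sin _) c1 c2 s1 s2 => c s c1 c2 s1 s2 h1 h2 h3.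
  have e2 : `|l * w * s| <= `|l * w| by rewrite normrM ler_piMr// ler_norml s1.
  have e3 : `|w ^+ 2 * c| <= w ^+ 2 by rewrite normrM (ger0_norm h3) ler_piMr// ler_norml c1.
  have e1 : `|l * w| <= (l ^+ 2 + w ^+ 2) / 2 by rewrite ler_norml; apply/andP; split; lra.
  have /ler_normlP[? ?] := e2; have /ler_normlP[? ?] := e3.
  have := sqr_ge0 l => ?; apply/andP; split; lra.
Qed.

(** The two integrands add up to cos(w x). *)
Lemma exp_lorentz_ode A x : 0 < A -> x != 0 ->
  l * exp_lorentz A x + \int[leb]_(w in `]- A, A[)
     ((- (l * w * sin (w * x)) + w ^+ 2 * cos (w * x)) / (l ^+ 2 + w ^+ 2))
  = 2 * sin (A * x) / x.
Proof.
move=> A0 x0.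
rewrite /exp_lorentz -RintegralZl; last 2 first.
- exact: measurable_oo.
- exact: continuous_integrable_itv.
rewrite -RintegralD; last 3 first.
- exact: measurable_oo.
- by apply: integrable_scale; [exact: measurable_oo|exact: continuous_integrable_itv].
- exact: continuous_integrable_itv.
under eq_Rintegral => w _.
  have -> : l * ((l * cos (w * x) + w * sin (w * x)) / (l ^+ 2 + w ^+ 2)) +
   (- (l * w * sin (w * x)) + w ^+ 2 * cos (w * x)) / (l ^+ 2 + w ^+ 2) = cos (w * x).
    by field.
  over.
have AA : - A <= A by lra.
have d1 (w : R) : is_derive w (1 : R) (fun w => x^-1 * sin (x * w)) (cos (w * x)).
  apply: is_derive_congr (is_derive_scale _ (is_derive_sinM _ _)).
  by rewrite mulrA mulVf// mul1r mulrC.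
rewrite (Rintegral_derive AA d1 (@cosMr_cont x)).
by rewrite mulrN sinN [x * A]mulrC; field.
Qed.

Lemma exp_lorentz_bound A x : 0 < A -> `|exp_lorentz A x| <= 4 * A / l.
Proof.
move=> A0; have ln0 : l != 0 by rewrite gt_eqF.
apply: (@le_trans _ _ (\int[leb]_(w in `]- A, A[) (2 / l))).
  apply: Rintegral_norm_le; first exact: measurable_oo.
  - exact: continuous_integrable_itv.
  - exact: integrable_const.
  move=> w _ /=; rewrite normrM normfV (@gtr0_norm _ (l ^+ 2 + _))// ler_pdivrMr//.
  apply: le_trans (ler_normD _ _) _; rewrite !normrM.
  have h1 : `|l| * `|cos (w * x)| <= l.
    by rewrite (gtr0_norm l0) ler_piMr ?cos_max// ltW.
  have h2 : `|w| * `|sin (w * x)| <= `|w| by rewrite ler_piMr// sin_max.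
  apply: le_trans (lerD h1 h2) _.
  rewrite mulrAC ler_pdivlMr//.
  have := sqr_ge0 (l - `|w|); rewrite sqrrB real_normK ?num_real//.
  have := sqr_ge0 w; have := sqr_ge0 l; nra.
rewrite Rintegral_const_oo; last lra.
rewrite le_eqVlt; apply/orP; left; apply/eqP; by field.
Qed.

(** e^{l x} [exp_lorentz] A x is thus almost constant in x > 0 when A is large; the factor
    1 / x in its derivative excludes 0. *)
Lemma exp_lorentz_osc (a b : R) A : 0 < a -> a <= b -> 0 < A ->
  `|expR (l * b) * exp_lorentz A b - expR (l * a) * exp_lorentz A a| <=
  (4 * expR (l * b) / a + 2 * expR (l * b) * (l / a + (a ^+ 2)^-1) * (b - a)) / A.
Proof.
move=> a0 ab A0.
pose rho (y : R) := 2 * expR (l * y) * y^-1.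
pose rho' (y : R) := 2 * (l * expR (l * y)) * y^-1 + 2 * expR (l * y) * - (1 / y ^+ 2).
pose L := 2 * expR (l * b) * (l / a + (a ^+ 2)^-1).
have pos y : a <= y <= b -> 0 < y by case/andP => ay _; exact: lt_le_trans ay.
have eb y : a <= y <= b -> expR (l * y) <= expR (l * b).
  by move=> /andP[_ yb]; rewrite ler_expR ler_pM2l.
have yi y : a <= y <= b -> y^-1 <= a^-1.
  by move=> /[dup] /pos y0 /andP[ay _]; rewrite lef_pV2.
apply: le_trans (@oscillation R A a b (fun y => expR (l * y) * exp_lorentz A y) rho rho'
  (fun y => L * y) (fun=> L) A0 ab _ _ _ _) _.
- move=> y /pos y0; have yn0 : y != 0 by rewrite gt_eqF.
  apply: is_derive_congr (is_derive_mul (is_derive_expRM l y) (is_derive_exp_lorentz A y)).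
  rewrite -[l * _ * _]mulrA [l * (_ * _)]mulrCA -mulrDr exp_lorentz_ode// /rho.
  by field.
- move=> y /pos y0; have yn0 : y != 0 by rewrite gt_eqF.
  apply: is_derive_mul.
    by apply: is_derive_scale; exact: is_derive_expRM.
  by apply: (@is_derive_inv R id 1 y).
- by move=> y _; exact: is_derive_lin.
- move=> y yab; have y0 := pos _ yab.
  apply: le_trans (ler_normD _ _) _; rewrite !normrM normrN div1r.
  rewrite !normfV normrX !(gtr0_norm y0) (gtr0_norm l0) !(gtr0_norm (expR_gt0 _)) normr_nat.
  have h1 := eb _ yab; have h2 := yi _ yab.
  have e0 := expR_gt0 (l * y).
  have yi0 : 0 < y^-1 by rewrite invr_gt0.
  have h3 : expR (l * y) * y^-1 <= expR (l * b) * a^-1 by apply: ler_pM => //; nonneg.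
  have h4 : expR (l * y) * y^-1 * y^-1 <= expR (l * b) * a^-1 * a^-1.
    by apply: ler_pM => //; nonneg.
  have h5 := ler_wpM2l (ltW l0) h3.
  rewrite /L -!exprVn !expr2; lra.
- rewrite ler_pM2r ?invr_gt0// -mulrBr; apply: lerD => //.
  have aab : a <= a <= b by rewrite lexx.
  have bab : a <= b <= b by rewrite lexx ab.
  have r y : a <= y <= b -> `|rho y| <= 2 * expR (l * b) / a.
    move=> yab; have y0 := pos _ yab; rewrite ger0_norm; last first.
      by rewrite /rho; nonneg.
    rewrite /rho; have h3 : expR (l * y) * y^-1 <= expR (l * b) * a^-1.
      by apply: ler_pM; [nonneg|nonneg|exact: eb|exact: yi].
    lra.
  have := r _ aab; have := r _ bab; lra.
Qed.

(** At negative arguments the exponential weight is e^{- l x}, so that the weighted function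
    vanishes at infinity: the oscillation bound on (x, X), with X tending to infinity,
    then bounds the function and not only its variation. *)
Lemma exp_lorentz_neg_le A x : 0 < A -> 0 < x ->
  `|exp_lorentz A (- x)| <= 4 / (x * A).
Proof.
move=> A0 x0.
pose k (y : R) := expR (- l * y) * exp_lorentz A (- 1 * y).
pose rho (y : R) := - 2 * expR (- l * y) * y^-1.
pose rho' (y : R) := - 2 * (- l * expR (- l * y)) * y^-1 + - 2 * expR (- l * y) * - (1 / y ^+ 2).
have dk (y : R) : 0 < y -> is_derive y (1 : R) k (sin (A * y) * rho y).
  move=> y0; have yn0 : - 1 * y != 0 by rewrite mulN1r oppr_eq0 gt_eqF.
  apply: is_derive_congr (is_derive_mul (is_derive_expRM (- l) y)
    (is_derive_comp_lin (is_derive_exp_lorentz A (- 1 * y)))).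
  have := exp_lorentz_ode A0 yn0; rewrite !mulN1r.
  set g := exp_lorentz A _; set h := Rintegral _ _ _; rewrite mulrN sinN => e.
  have -> : - l * expR (- l * y) * g + expR (- l * y) * - h = - expR (- l * y) * (l * g + h).
    by ring.
  by rewrite e /rho; field; rewrite gt_eqF.
have drho (y : R) : 0 < y -> is_derive y (1 : R) rho (rho' y).
  move=> y0; have yn0 : y != 0 by rewrite gt_eqF.
  apply: is_derive_mul.
    by apply: is_derive_scale; exact: is_derive_expRM.
  by apply: (@is_derive_inv R id 1 y).
have rho'0 (y : R) : 0 < y -> 0 <= rho' y.
  move=> y0; have -> : rho' y = 2 * (l * expR (- l * y)) * y^-1 +
      2 * expR (- l * y) * (y ^+ 2)^-1 by rewrite /rho' div1r; ring.
  nonneg.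
have rhoE (y : R) : 0 < y -> `|rho y| = - rho y.
  move=> y0; rewrite ler0_norm// /rho !mulNr oppr_le0; nonneg.
have kx : `|k x| <= 4 * expR (- l * x) / (x * A).
  apply/ler_addgt0Pr => e e0.
  have B0 : 0 <= 4 * A / l by nonneg.
  (* e^{l X} >= 1 + l X makes the bound 4 A / l of [exp_lorentz_bound] at X smaller than e *)
  pose X := x + (4 * A / l) / (l * e).
  have xX : x <= X by rewrite lerDl; nonneg.
  have X0 : 0 < X by exact: lt_le_trans xX.
  have pos y : x <= y <= X -> 0 < y by case/andP => xy _; exact: lt_le_trans xy.
  have o := @oscillation R A x X k rho rho' rho rho' A0 xX
    (fun y h => dk y (pos y h)) (fun y h => drho y (pos y h)) (fun y h => drho y (pos y h)).
  have {o} : `|k X - k x| <= 4 * expR (- l * x) / (x * A).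
    apply: le_trans (o _) _; first by move=> y /pos y0; rewrite ger0_norm// rho'0.
    rewrite !rhoE// le_eqVlt; apply/orP; left; apply/eqP; rewrite /rho.
    by field; rewrite !gt_eqF.
  have : `|k X| <= e.
    rewrite /k normrM (gtr0_norm (expR_gt0 _)) [- l * X]mulNr mulN1r expRN.
    apply: (@le_trans _ _ ((expR (l * X))^-1 * (4 * A / l))).
      rewrite ler_pM2l ?invr_gt0 ?expR_gt0//; exact: exp_lorentz_bound.
    rewrite mulrC ler_pdivrMr ?expR_gt0//.
    apply: (@le_trans _ _ (e * (l * X))); last first.
      by rewrite ler_pM2l// (le_trans _ (expR_ge1Dx _))// lerDr.
    rewrite /X; have -> : e * (l * (x + 4 * A / l / (l * e))) = e * (l * x) + 4 * A / l.
      by field; rewrite !gt_eqF.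
    by rewrite lerDr; nonneg.
  have := ler_normB (k X) (k X - k x); rewrite opprB addrC subrK; lra.
move: kx; rewrite /k normrM (gtr0_norm (expR_gt0 _)) mulN1r.
have -> : 4 * expR (- l * x) / (x * A) = expR (- l * x) * (4 / (x * A)) by ring.
by rewrite ler_pM2l ?expR_gt0.
Qed.

Definition trunc_cos_lorentz A x : R := \int[leb]_(w in `]- A, A[) (cos (w * x) * lorentz w).

Lemma trunc_cos_lorentzE A x :
  2 * trunc_cos_lorentz A x = exp_lorentz A x + exp_lorentz A (- x).
Proof.
rewrite /trunc_cos_lorentz /exp_lorentz -RintegralZl; last 2 first.
- exact: measurable_oo.
- apply: continuous_integrable_itv; apply: continuous_mul => //; exact: continuous_lorentz.
rewrite -RintegralD; last 3 first.
- exact: measurable_oo.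
- exact: continuous_integrable_itv.
- exact: continuous_integrable_itv.
apply: eq_Rintegral => w _; rewrite mulrN cosN sinN /lorentz.
by field; exact: den_neq0.
Qed.

(** The arctangent is a primitive of the Lorentzian. *)
Lemma trunc_cos_lorentz_tail A x : 0 < A ->
  `|cos_lorentz x - trunc_cos_lorentz A x| <= pi - 2 * atan (l^-1 * A).
Proof.
move=> A0.
have trunc (f : R -> R) : leb.-integrable setT (EFin \o f) ->
    \int[leb]_w f w - \int[leb]_(w in `]- A, A[) f w =
    \int[leb]_w (f w * \1_(~` `]- A, A[) w).
  move=> fi; rewrite [X in _ - X]Rintegral_mkcond -RintegralB//; last first.
    rewrite -restrict_EFin; apply: (integrable_mkcond _ (measurable_oo _ _)).1.
    exact: (integrableS measurableT (measurable_oo _ _) (@subsetT _ _) fi).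
  apply: eq_Rintegral => w _; rewrite /patch indicE in_setC.
  by case: (w \in _); rewrite /= ?subrr ?mulr0// mulr1 subr0.
have mC : measurable (~` (`]- A, A[%classic : set mR)).
  by apply: measurableC; exact: measurable_oo.
have -> : pi - 2 * atan (l^-1 * A) = \int[leb]_w (lorentz w * \1_(~` `]- A, A[) w).
  rewrite -trunc; last exact: integrable_lorentz.
  rewrite (@Rintegral_derive _ _ _ _ _ _ is_derive_atan_lorentz continuous_lorentz); last lra.
  by rewrite {1}/Rintegral integral_lorentz/= mulrN atanN; ring.
rewrite /cos_lorentz /trunc_cos_lorentz trunc; last exact: integrable_cos_lorentz.
have ind1 w : `|\1_(~` `]- A, A[) w : R| <= 1.
  by rewrite indicE; case: (_ \in _); rewrite ?normr1 ?normr0.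
have mI : measurable_fun setT (\1_(~` (`]- A, A[ : set mR)) : mR -> R).
  exact: measurable_indic.
apply: Rintegral_norm_le => //.
- under [X in _.-integrable _ X]eq_fun do rewrite /= mulrC.
  by apply: (@integrable_mul_bounded _ _ _ _ _ _ 1) => //; exact: integrable_cos_lorentz.
- under [X in _.-integrable _ X]eq_fun do rewrite /= mulrC.
  by apply: (@integrable_mul_bounded _ _ _ _ _ _ 1) => //; exact: integrable_lorentz.
- move=> w _; rewrite [X in X <= _]normrM [`|_ * lorentz w|]normrM (ger0_norm (lorentz_ge0 w)).
  rewrite (@ger0_norm _ (\1_ _ _)); last by rewrite indicE.
  rewrite ler_wpM2r//.
  by rewrite ler_piMl ?lorentz_ge0// cos_max.
Qed.

(** Let A tend to infinity along the integers: twice the truncated integral is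
    [exp_lorentz] A x + [exp_lorentz] A (- x), where the second term tends to 0 and the first
    one, multiplied by e^{l x}, becomes constant. *)
Lemma cos_lorentz_decay (a b : R) : 0 < a -> a <= b ->
  expR (l * a) * cos_lorentz a = expR (l * b) * cos_lorentz b.
Proof.
move=> a0 ab; have b0 : 0 < b := lt_le_trans a0 ab.
pose K := 4 * expR (l * b) / a + 2 * expR (l * b) * (l / a + (a ^+ 2)^-1) * (b - a).
pose tail (n : nat) := pi - 2 * atan (l^-1 * n.+1%:R).
pose E (n : nat) := (expR (l * a) + expR (l * b)) * tail n +
  (K + expR (l * b) * 4 / b + expR (l * a) * 4 / a) * n.+1%:R^-1.
have tail0 : tail @ \oo --> (0 : R).
  rewrite [X in _ --> X](_ : 0 = pi - 2 * (pi / 2)); last by field.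
  apply: cvgB; first exact: cvg_cst.
  have lim_atan : atan (l^-1 * r) @[r --> +oo] --> (pi / 2 : R).
    apply: (cvg_comp _ _ _ (@cvgy_atan R)).
    by apply: gt0_cvgMry; [rewrite invr_gt0|exact: cvg_id].
  apply: cvgM; first exact: cvg_cst.
  apply: (cvg_comp (fun n : nat => n.+1%:R : R) _ _ lim_atan).
  apply: (cvg_comp (fun n => n.+1) (fun n => n%:R : R) _ cvgr_idn).
  by under eq_fun do rewrite -addn1; exact: cvg_addnr.
have E0 : E @ \oo --> (0 : R).
  rewrite [X in _ --> X](_ : 0 = (expR (l * a) + expR (l * b)) * 0 +
     (K + expR (l * b) * 4 / b + expR (l * a) * 4 / a) * 0); last by rewrite !mulr0 addr0.
  by apply: cvgD; apply: cvgM; [exact: cvg_cst|done|exact: cvg_cst|exact: cvg_harmonic].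
suff bound n : `|expR (l * a) * cos_lorentz a - expR (l * b) * cos_lorentz b| <= E n.
  apply/eqP; rewrite -subr_eq0 -normr_le0.
  apply: (cvgr_to_ge E0); exact: nearW.
have A0 : 0 < n.+1%:R :> R by [].
set A : R := n.+1%:R.
have ta := trunc_cos_lorentz_tail a A0; have tb := trunc_cos_lorentz_tail b A0.
have ea := expR_gt0 (l * a); have eb := expR_gt0 (l * b).
have osc := exp_lorentz_osc a0 ab A0; have na := exp_lorentz_neg_le A0 a0.
have nb := exp_lorentz_neg_le A0 b0.
have Ta := trunc_cos_lorentzE A a; have Tb := trunc_cos_lorentzE A b.
rewrite -/A -/K in ta tb osc na nb.
have -> : E n = (expR (l * a) * (pi - 2 * atan (l^-1 * A)) +
   expR (l * b) * (pi - 2 * atan (l^-1 * A))) + K / A +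
   expR (l * b) * (4 / (b * A)) + expR (l * a) * (4 / (a * A)).
  by rewrite /E /tail -/A; field; rewrite !gt_eqF.
have ta' : `|expR (l * a) * (cos_lorentz a - trunc_cos_lorentz A a)| <=
    expR (l * a) * (pi - 2 * atan (l^-1 * A)).
  by rewrite normrM (gtr0_norm ea) ler_pM2l.
have tb' : `|expR (l * b) * (cos_lorentz b - trunc_cos_lorentz A b)| <=
    expR (l * b) * (pi - 2 * atan (l^-1 * A)).
  by rewrite normrM (gtr0_norm eb) ler_pM2l.
have na' : `|expR (l * a) * exp_lorentz A (- a)| <= expR (l * a) * (4 / (a * A)).
  by rewrite normrM (gtr0_norm ea) ler_pM2l.
have nb' : `|expR (l * b) * exp_lorentz A (- b)| <= expR (l * b) * (4 / (b * A)).
  by rewrite normrM (gtr0_norm eb) ler_pM2l.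
have Ea : trunc_cos_lorentz A a = (exp_lorentz A a + exp_lorentz A (- a)) / 2 by lra.
have Eb : trunc_cos_lorentz A b = (exp_lorentz A b + exp_lorentz A (- b)) / 2 by lra.
rewrite Ea in ta'; rewrite Eb in tb'.
have comb (p q Ca Cb ya za yb zb u v k c d : R) :
    `|p * (Ca - (ya + za) / 2)| <= u -> `|q * (Cb - (yb + zb) / 2)| <= v ->
    `|p * za| <= c -> `|q * zb| <= d -> `|q * yb - p * ya| <= k ->
    `|p * Ca - q * Cb| <= u + v + k + d + c.
  move=> h1 h2 h3 h4 h5.
  have ? := le_trans (normr_ge0 _) h3; have ? := le_trans (normr_ge0 _) h4.
  have ? := le_trans (normr_ge0 _) h5.
  move: h1 h2 h3 h4 h5 => /ler_normlP[? ?] /ler_normlP[? ?] /ler_normlP[? ?]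
    /ler_normlP[? ?] /ler_normlP[? ?].
  apply/ler_normlP; split; lra.
exact: (comb _ _ _ _ _ _ _ _ _ _ _ _ _ ta' tb' na' nb' osc).
Qed.

(** e^{l x} [cos_lorentz] x is constant for x > 0 and continuous at 0, where it is pi. *)
Lemma cos_lorentz_gt0 (b : R) : 0 < b -> cos_lorentz b = pi * expR (- (l * b)).
Proof.
move=> b0; pose g x := expR (l * x) * cos_lorentz x.
have cg : continuous g.
  by apply: continuous_mul; [exact: continuous_expRM|exact: continuous_cos_lorentz].
have g1 : g x @[x --> 0^'+] --> g 0 by apply: cvg_at_right_filter; exact: cg.
have g2 : g x @[x --> 0^'+] --> g b.
  apply: cvg_near_cst; near=> x.
  apply: cos_lorentz_decay; first by near: x; exact: nbhs_right_gt.
  by near: x; exact: nbhs_right_le.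
have : g b = g 0 by exact: (cvg_unique _ g2 g1).
rewrite /g mulr0 expR0 mul1r cos_lorentz0 => <-.
by rewrite mulrAC expRxMexpNx_1 mul1r.
Unshelve. all: by end_near. Qed.

Lemma cos_lorentzE x : cos_lorentz x = pi * expR (- (l * `|x|)).
Proof.
have [x0|x0|->] := ltrgt0P x.
- exact: cos_lorentz_gt0.
- rewrite -cos_lorentz_gt0 ?oppr_gt0//; apply: eq_Rintegral => w _.
  by rewrite mulrN cosN.
- by rewrite mulr0 oppr0 expR0 mulr1 cos_lorentz0.
Qed.

End Lorentzian.

(** * Sine sums of functions vanishing at 0 and 1 *)

Section sine_expansion.
Variable R : realType.
Local Notation leb := (@lebesgue_measure R).
Local Notation mR := (measurableTypeR R).
Local Notation D := (`]0, 1[%classic : set mR).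

Let mD : measurable D. Proof. exact: measurable_oo. Qed.

Lemma sin_intpi (j : int) : sin (j%:~R * pi) = 0 :> R.
Proof.
case: j => n; first by rewrite -pmulrn sin_natpi.
by rewrite NegzE mulrNz -pmulrn mulNr sinN sin_natpi oppr0.
Qed.

Lemma Rintegral_cos_int (j : int) :
  \int[leb]_(x in D) cos (j%:~R * pi * x) = (j == 0)%:R.
Proof.
have [->|j0] := eqVneq j 0.
  under eq_Rintegral do rewrite !mul0r cos0.
  by rewrite Rintegral_const_oo// subr0 mulr1.
have w0 : j%:~R * pi != 0 :> R.
  by apply: mulf_neq0; [rewrite intr_eq0|rewrite gt_eqF// pi_gt0].
have d1 (x : R) : is_derive x (1 : R) (fun x => (j%:~R * pi)^-1 * sin (j%:~R * pi * x))
    (cos (j%:~R * pi * x)).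
  apply: is_derive_congr (is_derive_scale _ (is_derive_sinM _ _)).
  by rewrite mulrA mulVf// mul1r.
rewrite (Rintegral_derive ler01 d1 (@continuous_cosM _ _)).
by rewrite mulr1 mulr0 sin0 sin_intpi !mulr0 subrr.
Qed.

Lemma cosM_L2 (c : R) : L2 leb D (fun x => cos (c * x)).
Proof.
apply: (@bounded_L2 _ _ _ _ _ _ 1) => //.
- exact: lebesgue_itv_lty.
- by apply: measurable_funTS; apply: continuous_measurable_fun; exact: continuous_cosM.
- by move=> x _; exact: cos_max.
Qed.

Lemma sinM_L2 (c : R) : L2 leb D (fun x => sin (c * x)).
Proof.
apply: (@bounded_L2 _ _ _ _ _ _ 1) => //.
- exact: lebesgue_itv_lty.
- by apply: measurable_funTS; apply: continuous_measurable_fun; exact: continuous_sinM.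
- by move=> x _; exact: sin_max.
Qed.

Lemma const_L2 (c : R) : L2 leb D (fun=> c).
Proof.
apply: (@bounded_L2 _ _ _ _ _ _ `|c|) => //; exact: lebesgue_itv_lty.
Qed.

Lemma cut_L2 (x : R) : L2 leb D (fun z => (z < x)%R%:R).
Proof.
apply: (@bounded_L2 _ _ _ _ _ _ 1) => //.
- exact: lebesgue_itv_lty.
- by apply: measurable_boolR; exact: measurable_fun_ltr.
- by move=> z _; case: (z < x); rewrite ?normr1 ?normr0.
Qed.

Let int2 (f g : R -> R) : L2 leb D f -> L2 leb D g ->
  leb.-integrable D (EFin \o (fun x => f x * g x)).
Proof. exact: L2_mul_integrable. Qed.

Let int1 (f : R -> R) : L2 leb D f -> leb.-integrable D (EFin \o f).
Proof. by apply: L2_integrable => //; exact: lebesgue_itv_lty. Qed.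

Lemma Rintegral_cos_mul (n m : nat) : (0 < n)%N -> (0 < m)%N ->
  \int[leb]_(x in D) (cos (n%:R * pi * x) * cos (m%:R * pi * x)) = (n == m)%:R / 2.
Proof.
move=> n0 m0.
under eq_Rintegral => x _.
  have -> : cos (n%:R * pi * x) * cos (m%:R * pi * x) =
     1 / 2 * cos ((n%:Z + m%:Z)%:~R * pi * x) + 1 / 2 * cos ((n%:Z - m%:Z)%:~R * pi * x).
    rewrite rmorphD rmorphB /= -!pmulrn !mulrBl !mulrDl cosD cosB; lra.
  over.
rewrite RintegralD//; last 2 first.
- by apply: integrable_scale => //; apply: int1; exact: cosM_L2.
- by apply: integrable_scale => //; apply: int1; exact: cosM_L2.
rewrite !RintegralZl//; [|by apply: int1; exact: cosM_L2..].
rewrite !Rintegral_cos_int -PoszD subr_eq0.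
have -> : (Posz (n + m) == 0) = false by rewrite eqz_nat addn_eq0 -leqn0 leqNgt n0.
by rewrite eqz_nat; case: (n == m); rewrite /= ?mulr0 ?mulr1 ?add0r ?mul0r.
Qed.

Lemma Rintegral_cos_nat (n : nat) : (0 < n)%N ->
  \int[leb]_(x in D) cos (n%:R * pi * x) = 0.
Proof.
move=> n0; have := Rintegral_cos_int n%:Z; rewrite -pmulrn => ->.
by rewrite eqz_nat gtn_eqF.
Qed.

Lemma Rintegral_cut_D (x : R) (f : R -> R) : x <= 1 ->
  \int[leb]_(z in D) ((z < x)%R%:R * f z) = \int[leb]_(z in `]0, x[) f z.
Proof. exact: Rintegral_cut. Qed.

Lemma Rintegral_cut_cos (n : nat) (x : R) : (0 < n)%N -> 0 <= x <= 1 ->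
  \int[leb]_(z in D) ((z < x)%R%:R * cos (n%:R * pi * z)) = sin (n%:R * pi * x) / (n%:R * pi).
Proof.
move=> n0 /andP[x0 x1]; rewrite Rintegral_cut_D//.
have w0 := natpi_neq0 R n0.
have d1 (y : R) : is_derive y (1 : R) (fun x => (n%:R * pi)^-1 * sin (n%:R * pi * x))
    (cos (n%:R * pi * y)).
  apply: is_derive_congr (is_derive_scale _ (is_derive_sinM _ _)).
  by rewrite mulrA mulVf// mul1r.
rewrite (Rintegral_derive x0 d1 (@continuous_cosM _ _)).
by rewrite mulr0 sin0 mulr0 subr0 mulrC.
Qed.

(** The indicator function of z < x minus the N-th partial sum of its cosine series. It is
    the kernel that maps F' to the error F x - [sine_sum] F N x. *)
Fixpoint cut_remainder (x : R) (N : nat) (z : R) : R :=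
  if N is N'.+1 then cut_remainder x N' z
    - 2 * sin (N%:R * pi * x) / (N%:R * pi) * cos (N%:R * pi * z)
  else (z < x)%R%:R - x.

Lemma cut_remainder_L2 x N : L2 leb D (cut_remainder x N).
Proof.
elim: N => [|N IH] /=.
  by apply: L2_sub => //; [exact: cut_L2|exact: const_L2].
by apply: L2_sub => //; apply: L2_scale => //; exact: cosM_L2.
Qed.

Lemma cut_remainder_cos x N m : 0 <= x <= 1 -> (N < m)%N ->
  \int[leb]_(z in D) (cut_remainder x N z * cos (m%:R * pi * z)) =
  sin (m%:R * pi * x) / (m%:R * pi).
Proof.
move=> x01; elim: N => [|N IH] Nm.
  under eq_Rintegral => z _ do rewrite /= mulrBl.
  rewrite RintegralB//; last 2 first.
  - by apply: int2; [exact: cut_L2|exact: cosM_L2].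
  - by apply: int2; [exact: const_L2|exact: cosM_L2].
  rewrite RintegralZl//; last by apply: int1; exact: cosM_L2.
  by rewrite Rintegral_cos_nat// mulr0 subr0 Rintegral_cut_cos.
under eq_Rintegral => z _.
  have -> : cut_remainder x N.+1 z * cos (m%:R * pi * z) =
      cut_remainder x N z * cos (m%:R * pi * z) -
      2 * sin (N.+1%:R * pi * x) / (N.+1%:R * pi) *
        (cos (N.+1%:R * pi * z) * cos (m%:R * pi * z)) by rewrite /=; ring.
  over.
rewrite RintegralB//; last 2 first.
- by apply: int2; [exact: cut_remainder_L2|exact: cosM_L2].
- apply: integrable_scale => //.
  by apply: int2; exact: cosM_L2.
rewrite RintegralZl//; last by apply: int2; exact: cosM_L2.
rewrite IH; last exact: ltnW.
rewrite Rintegral_cos_mul//; last exact: leq_trans Nm.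
by rewrite (ltn_eqF Nm) mul0r mulr0 subr0.
Qed.

(** Bessel's identity: the coefficient of the indicator function on cos(n pi z) is
    sin(n pi x) / (n pi), and its square norm minus its squared mean is x - x ^ 2. *)
Lemma cut_remainder_sqr x N : 0 <= x <= 1 ->
  \int[leb]_(z in D) (cut_remainder x N z ^+ 2) = x - x ^+ 2 - sin2_series N x.
Proof.
move=> /[dup] x01 /andP[x0 x1]; elim: N => [|N IH].
  rewrite /sin2_series big_geq// subr0.
  under eq_Rintegral => z _.
    have -> : cut_remainder x 0 z ^+ 2 = (1 - 2 * x) * ((z < x)%R%:R * 1) + x ^+ 2.
      by rewrite /=; case: (z < x); rewrite /=; ring.
    over.
  rewrite RintegralD//; last 2 first.
  - apply: integrable_scale => //; apply: int2; [exact: cut_L2|exact: const_L2].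
  - by apply: int1; exact: const_L2.
  rewrite RintegralZl//; last by apply: int2; [exact: cut_L2|exact: const_L2].
  rewrite Rintegral_cut_D// !Rintegral_const_oo//; ring.
have w0 := natpi_neq0 R (ltn0Sn N).
set c := 2 * sin (N.+1%:R * pi * x) / (N.+1%:R * pi).
have rL := cut_remainder_L2 x N; have cL := cosM_L2 (N.+1%:R * pi).
under eq_Rintegral => z _.
  have -> : cut_remainder x N.+1 z ^+ 2 = cut_remainder x N z ^+ 2
    + ((- (2 * c)) * (cut_remainder x N z * cos (N.+1%:R * pi * z))
    + c ^+ 2 * (cos (N.+1%:R * pi * z) * cos (N.+1%:R * pi * z))).
    by rewrite /= -/c; ring.
  over.
have i1 := int2 rL cL; have i2 := int2 cL cL; have [_ i0] := rL.
have i1' := integrable_scale mD (- (2 * c)) i1.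
have i2' := integrable_scale mD (c ^+ 2) i2.
rewrite RintegralD//; last exact: integrable_add.
rewrite RintegralD// !RintegralZl// IH cut_remainder_cos// Rintegral_cos_mul// eqxx.
rewrite /sin2_series [in RHS]big_nat_recr//= /c.
by move: (N.+1%:R * pi : R) w0 => w w0; field.
Qed.

Lemma sine_coefficient (f F : R -> R) (n : nat) : primitive 1 f F -> F 0 = 0 -> F 1 = 0 ->
  \int[leb]_(x in D) (f x * cos (n%:R * pi * x)) =
  n%:R * pi * \int[leb]_(x in D) (F x * sin (n%:R * pi * x)).
Proof.
move=> fF F0 F1.
have pc : primitive 1 (fun x : R => - (n%:R * pi * sin (n%:R * pi * x)))
    (fun x : R => cos (n%:R * pi * x)).
  apply: (@derive_primitive R); first by move=> x; exact: is_derive_cosM.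
  under eq_fun do rewrite -mulNr.
  by apply: continuous_mul; [exact: continuous_const|exact: continuous_sinM].
have := primitive_end ler01 (primitiveM fF pc).
rewrite F1 F0 !mul0r subrr.
have [fi _] := fF.
have i1 : leb.-integrable D (EFin \o (fun x => f x * cos (n%:R * pi * x))).
  apply: (integrable_ext _ _ (primitive_mul_integrable pc fi)) => // x _.
  exact: mulrC.
have i2 : leb.-integrable D (EFin \o (fun x => F x * sin (n%:R * pi * x))).
  by apply: (primitive_mul_integrable fF); apply: int1; exact: sinM_L2.
under eq_Rintegral do rewrite [F _ * - _]mulrN mulrCA -mulNr.
rewrite RintegralD//; last exact: integrable_scale.
by rewrite RintegralZl// mulNr => /eqP; rewrite subr_eq0 => /eqP.
Qed.

Definition sine_sum (F : R -> R) (N : nat) (x : R) : R :=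
  \sum_(1 <= n < N.+1) inner F (phi n) * phi n x.

Lemma sqrt2_sqr : Num.sqrt (2 : R) ^+ 2 = 2.
Proof. by rewrite sqr_sqrtr. Qed.

Lemma phi_L2 n : L2 leb D (phi n).
Proof. by apply: L2_scale => //; exact: sinM_L2. Qed.

Lemma inner_phi (F : R -> R) n : leb.-integrable D (EFin \o F) ->
  inner F (phi n) = Num.sqrt 2 * \int[leb]_(x in D) (F x * sin (n%:R * pi * x)).
Proof.
move=> Fi; rewrite /inner -RintegralZl//; last first.
  under [X in _.-integrable _ X]eq_fun do rewrite /= mulrC.
  apply: (@integrable_mul_bounded _ _ _ _ _ _ 1) => //; last by move=> x _; exact: sin_max.
  by apply: measurable_funTS; apply: continuous_measurable_fun; exact: continuous_sinM.
by apply: eq_Rintegral => x _; rewrite /phi mulrCA.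
Qed.

Lemma sine_sum_error (f F : R -> R) (N : nat) (x : R) : L2 leb D f ->
  primitive 1 f F -> F 0 = 0 -> F 1 = 0 -> 0 <= x <= 1 ->
  F x - sine_sum F N x = \int[leb]_(z in D) (f z * cut_remainder x N z).
Proof.
move=> fL fF F0 F1 /andP[x0 x1]; have [fi Fint] := fF.
elim: N => [|N IH].
  rewrite /sine_sum big_geq// subr0 /=.
  under eq_Rintegral => z _ do rewrite mulrBr [f z * _%:R]mulrC [f z * x]mulrC.
  rewrite RintegralB//; last 2 first.
  - by apply: int2 => //; exact: cut_L2.
  - exact: integrable_scale.
  rewrite RintegralZl// Rintegral_cut_D// (primitive_end ler01 fF) F1 F0 subrr mulr0 subr0.
  by rewrite Fint ?x0// F0 add0r.
have w0 := natpi_neq0 R (ltn0Sn N).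
rewrite /sine_sum big_nat_recr//= opprD addrA -/(sine_sum F N x) IH.
under [RHS]eq_Rintegral => z _.
  have -> : f z * (cut_remainder x N z -
      2 * sin (N.+1%:R * pi * x) / (N.+1%:R * pi) * cos (N.+1%:R * pi * z)) =
    f z * cut_remainder x N z - 2 * sin (N.+1%:R * pi * x) / (N.+1%:R * pi) *
      (f z * cos (N.+1%:R * pi * z)) by ring.
  over.
have ic : leb.-integrable D (EFin \o (fun z => f z * cos (N.+1%:R * pi * z))).
  by apply: int2 => //; exact: cosM_L2.
rewrite RintegralB//; last 2 first.
- by apply: int2 => //; exact: cut_remainder_L2.
- exact: integrable_scale.
rewrite RintegralZl// (sine_coefficient _ fF)//; congr (_ - _).
rewrite inner_phi; last exact: primitive_integrable fF.
rewrite /phi; have := sqrt2_sqr; rewrite expr2.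
move: (Num.sqrt 2) => q qq; set I := Rintegral _ _ _.
rewrite [LHS](_ : _ = q * q * I * sin (N.+1%:R * pi * x)); last by ring.
rewrite qq /I; move: (N.+1%:R * pi : R) w0 => w w0; clear I.
by field.
Qed.

(** The Cauchy-Schwarz inequality against the kernel [cut_remainder], whose norm is small
    uniformly in x by [sin2_series_rate]. *)
Lemma sine_sum_error_le (f F : R -> R) (N : nat) (x : R) : L2 leb D f ->
  primitive 1 f F -> F 0 = 0 -> F 1 = 0 -> 0 <= x <= 1 -> (0 < N)%N ->
  (F x - sine_sum F N x) ^+ 2 <= (\int[leb]_(z in D) (f z ^+ 2)) / N%:R.
Proof.
move=> fL fF F0 F1 x01 N0; rewrite (sine_sum_error _ fL fF)//.
apply: le_trans (Cauchy_Schwarz mD fL (cut_remainder_L2 x N)) _.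
rewrite ler_wpM2l//; first by apply: Rintegral_ge0 => z _; exact: sqr_ge0.
by rewrite cut_remainder_sqr// sin2_series_rate.
Qed.

Lemma primitive_sqr_le (f F : R -> R) (x : R) : L2 leb D f ->
  primitive 1 f F -> F 0 = 0 -> 0 <= x <= 1 ->
  F x ^+ 2 <= \int[leb]_(z in D) (f z ^+ 2).
Proof.
move=> fL fF F0 /andP[x0 x1]; have [fi Fint] := fF.
rewrite Fint ?x0// F0 add0r -(Rintegral_cut_D _ x1).
apply: le_trans (Cauchy_Schwarz mD (cut_L2 x) fL) _.
rewrite ler_piMl//; first by apply: Rintegral_ge0 => z _; exact: sqr_ge0.
under eq_Rintegral => z _.
  have -> : ((z < x)%R%:R ^+ 2 : R) = (z < x)%R%:R * 1.
    by case: (z < x); rewrite /= ?expr1n ?expr0n ?mulr1.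
  over.
by rewrite Rintegral_cut_D// Rintegral_const_oo// subr0 mul1r.
Qed.

(** Up to a constant, the coefficient with which modes n and p of y_1 drive mode k of y_2. *)
Definition trilinear (k n p : nat) : R :=
  \int[leb]_(x in D) (phi n x * phi p x * cos (k%:R * pi * x)).

Lemma trilinearE k n p : (0 < k)%N -> (0 < n)%N -> (0 < p)%N ->
  trilinear k n p = ((p == n + k)%N%:R + (n == p + k)%N%:R - (n + p == k)%N%:R) / 2.
Proof.
move=> k0 n0 p0; rewrite /trilinear.
under eq_Rintegral => x _.
  have -> : phi n x * phi p x * cos (k%:R * pi * x) =
     1 / 2 * (cos ((n%:Z - p%:Z + k%:Z)%:~R * pi * x) +
       cos ((n%:Z - p%:Z - k%:Z)%:~R * pi * x)
       - cos ((n%:Z + p%:Z + k%:Z)%:~R * pi * x) - cos ((n%:Z + p%:Z - k%:Z)%:~R * pi * x)).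
    rewrite !rmorphD !rmorphN /= -!pmulrn !mulrBl !mulrDl !mulNr !cosB !cosD !sinD !sinN !cosN /phi.
    have := sqrt2_sqr; rewrite expr2; move: (Num.sqrt 2) => q qq.
    set A := n%:R * pi * x; set B := p%:R * pi * x; set C := k%:R * pi * x.
    rewrite [LHS](_ : _ = q * q * (sin A * sin B * cos C)); last by ring.
    by rewrite qq; field.
  over.
have ci c : leb.-integrable D (EFin \o (fun x => cos (c * x))).
  by apply: int1; exact: cosM_L2.
have i1 := integrable_add mD (ci ((n%:Z - p%:Z + k%:Z)%:~R * pi))
  (ci ((n%:Z - p%:Z - k%:Z)%:~R * pi)).
have i2 := integrable_sub mD i1 (ci ((n%:Z + p%:Z + k%:Z)%:~R * pi)).
have i3 := integrable_sub mD i2 (ci ((n%:Z + p%:Z - k%:Z)%:~R * pi)).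
rewrite RintegralZl// RintegralB// RintegralB// RintegralD// !Rintegral_cos_int.
have -> : (n%:Z - p%:Z + k%:Z == 0) = (p == n + k)%N by apply/eqP/eqP; lia.
have -> : (n%:Z - p%:Z - k%:Z == 0) = (n == p + k)%N by apply/eqP/eqP; lia.
have -> : (n%:Z + p%:Z + k%:Z == 0) = false by apply/eqP; lia.
have -> : (n%:Z + p%:Z - k%:Z == 0) = (n + p == k)%N by apply/eqP/eqP; lia.
by rewrite subr0 mul1r mulrC.
Qed.

End sine_expansion.

(** * The quadratic nonlinearity on H^1_0 *)

Section H10_functions.
Variable R : realType.
Local Notation leb := (@lebesgue_measure R).
Local Notation mR := (measurableTypeR R).
Local Notation D := (`]0, 1[%classic : set mR).

Let mD : measurable D. Proof. exact: measurable_oo. Qed.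

Let lebD : (leb D < +oo)%E. Proof. exact: lebesgue_itv_lty. Qed.

Lemma inner_ae_eq (f g h : R -> R) : measurable_fun D f -> measurable_fun D g ->
  measurable_fun D h -> {ae leb, forall x : R, x \in `]0, 1[ -> f x = g x} ->
  inner f h = inner g h.
Proof.
move=> mf mg mh fg; apply: ae_eq_Rintegral => //.
- exact: measurable_funM.
- exact: measurable_funM.
- by apply: ae_imply fg => x fg Dx; rewrite fg.
Qed.

Definition dphi (n : nat) (x : R) : R := Num.sqrt 2 * (n%:R * pi * cos (n%:R * pi * x)).

Lemma is_derive_phi n (x : R) : is_derive x (1 : R) (phi n) (dphi n x).
Proof. by apply: is_derive_scale; exact: is_derive_sinM. Qed.

Lemma continuous_dphi n : continuous (@dphi n).
Proof.
apply: continuous_mul; first exact: continuous_const.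
by apply: continuous_mul; [exact: continuous_const|exact: continuous_cosM].
Qed.

Lemma primitive_phi T n : primitive T (@dphi n) (@phi R n).
Proof. by apply: (@derive_primitive R); [exact: is_derive_phi|exact: continuous_dphi]. Qed.

Lemma phi0 n : phi n 0 = 0 :> R.
Proof. by rewrite /phi mulr0 sin0 mulr0. Qed.

Lemma phi1 n : phi n 1 = 0 :> R.
Proof. by rewrite /phi mulr1 sin_natpi mulr0. Qed.

Lemma dphi_L2 n : L2 leb D (@dphi n).
Proof. by apply: L2_scale => //; apply: L2_scale => //; exact: cosM_L2. Qed.

Lemma primitive_H10 (f F : R -> R) : L2 leb D f -> primitive 1 f F ->
  F 0 = 0 -> F 1 = 0 -> H10 F f.
Proof.
move=> fL fF F0 F1; split => //.
- apply: (@bounded_L2 _ _ _ _ _ _ (`|F 0| + \int[leb]_(s in D) `|f s|)) => //.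
    exact: primitive_measurable fF.
  move=> x /=; rewrite in_itv/= => /andP[x0 x1].
  by apply: (primitive_bounded fF); rewrite !ltW.
- apply: aeW => x; rewrite in_itv/= => /andP[x0 x1].
  by have [_ ->] := fF; rewrite ?F0 ?add0r// !ltW.
- by rewrite (primitive_end ler01 fF) F0 F1 subrr.
Qed.

Lemma H10_phi n : H10 (@phi R n) (@dphi n).
Proof.
by apply: primitive_H10; [exact: dphi_L2|exact: primitive_phi|exact: phi0|exact: phi1].
Qed.

Lemma Rintegral_oo_empty (a : R) (f : R -> R) : \int[leb]_(x in `]a, a[) f x = 0.
Proof. by rewrite set_itv_ge ?bnd_simp// Rintegral_set0. Qed.

Lemma primitive_antiderivative (f : R -> R) : leb.-integrable D (EFin \o f) ->
  primitive 1 f (fun x => \int[leb]_(z in `]0, x[) f z).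
Proof.
move=> fi; split=> // t _.
by rewrite Rintegral_oo_empty add0r.
Qed.

(** The absolutely continuous representative of y, to which pointwise estimates and the
    rules for primitives apply. *)
Lemma H10_representative (y dy : R -> R) : H10 y dy ->
  exists F, [/\ primitive 1 dy F, F 0 = 0, F 1 = 0,
      {ae leb, forall x : R, x \in `]0, 1[ -> y x = F x}
    & forall g, measurable_fun D g -> inner y g = inner F g].
Proof.
move=> [yL dyL yF dy0]; exists (fun x => \int[leb]_(z in `]0, x[) dy z).
have pF := primitive_antiderivative (L2_integrable mD lebD dyL).
split=> //; first exact: Rintegral_oo_empty.
move=> g mg; apply: inner_ae_eq => //; first by case: yL.
exact: primitive_measurable pF.
Qed.

Lemma H10_lin (a : R) (f df g dg : R -> R) : H10 f df -> H10 g dg ->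
  H10 (fun x => a * f x + g x) (fun x => a * df x + dg x).
Proof.
move=> [fL dfL fF df0] [gL dgL gG dg0]; split.
- by apply: L2_add => //; exact: L2_scale.
- by apply: L2_add => //; exact: L2_scale.
- have := ae_and fF gG; apply: ae_imply => x [hf hg] xD.
  rewrite hf// hg//; move: xD; rewrite in_itv/= => /andP[x0 x1].
  have sub h : L2 leb D h -> leb.-integrable `]0, x[ (EFin \o h).
    by move=> hL; apply: (integrable_itv_sub (lexx 0) (ltW x1)); exact: L2_integrable.
  rewrite -RintegralZl//; last exact: sub.
  by rewrite -RintegralD//; [apply: integrable_scale => //|]; exact: sub.
- have i1 := L2_integrable mD lebD dfL; have i2 := L2_integrable mD lebD dgL.
  by rewrite RintegralD//; [rewrite RintegralZl// df0 dg0; ring|exact: integrable_scale].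
Qed.

Lemma H10_by_parts (y dy : R -> R) n : H10 y dy ->
  inner dy (@dphi n) = lambda R n * inner y (phi n).
Proof.
move=> yH; have [F [pF F0 F1 _ yE]] := H10_representative yH.
rewrite yE; last by case: (phi_L2 R n).
have dyL : L2 leb D dy by case: yH.
have dyi := L2_integrable mD lebD dyL.
rewrite inner_phi; last exact: primitive_integrable pF.
rewrite /inner; under eq_Rintegral => x _.
  have -> : dy x * dphi n x = Num.sqrt 2 * (n%:R * pi) * (dy x * cos (n%:R * pi * x)).
    by rewrite /dphi; ring.
  over.
rewrite RintegralZl//; last by apply: L2_mul_integrable => //; exact: cosM_L2.
rewrite (sine_coefficient n pF F0 F1) /lambda.
set I := Rintegral _ _ _; move: I => I; ring.
Qed.

(** The function F^2 phi_k vanishes at 0 and 1, so its derivative has integral 0. *)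
Lemma H10_nonlinearity (y dy F : R -> R) (k : nat) : H10 y dy ->
  primitive 1 dy F -> F 0 = 0 -> F 1 = 0 ->
  {ae leb, forall x : R, x \in `]0, 1[ -> y x = F x} ->
  - inner (fun x => y x * dy x) (phi k) =
    Num.sqrt 2 * (k%:R * pi) / 2 * \int[leb]_(x in D) (F x ^+ 2 * cos (k%:R * pi * x)).
Proof.
move=> yH pF F0 F1 yF.
have [yL dyL _ _] := yH; have [my _] := yL; have [mdy _] := dyL.
have FL : L2 leb D F by have [] := primitive_H10 dyL pF F0 F1.
have [mF _] := FL; have [mp _] := phi_L2 R k.
rewrite (@inner_ae_eq _ (fun x => F x * dy x))//; last 3 first.
- exact: measurable_funM.
- exact: measurable_funM.
- by apply: ae_imply yF => x yF xD; rewrite yF.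
have pFFp := primitiveM (primitiveM pF pF) (@primitive_phi 1 k).
have := primitive_end ler01 pFFp.
rewrite F0 F1 !mul0r subrr.
have i0 : leb.-integrable D (EFin \o (fun x => F x * dy x * phi k x)).
  have := primitive_mul_integrable (@primitive_phi 1 k) (L2_mul_integrable mD FL dyL).
  by apply: integrable_ext => // x _; rewrite mulrC.
have i1 : leb.-integrable D (EFin \o (fun x => F x ^+ 2 * cos (k%:R * pi * x))).
  have := primitive_mul_integrable (primitiveM pF pF) (L2_integrable mD lebD (cosM_L2 (k%:R * pi))).
  by apply: integrable_ext => // x _; rewrite expr2.
under eq_Rintegral => x _.
  have -> : (dy x * F x + F x * dy x) * phi k x + F x * F x * dphi k x =
    2 * (F x * dy x * phi k x) + Num.sqrt 2 * (k%:R * pi) * (F x ^+ 2 * cos (k%:R * pi * x)).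
    by rewrite /dphi; ring.
  over.
rewrite RintegralD//; last 2 first.
- exact: integrable_scale.
- exact: integrable_scale.
rewrite !RintegralZl// /inner => e.
set A := Rintegral _ _ _ in e *; set B := Rintegral _ _ _ in e *.
by move: e; clearbody A B; lra.
Qed.

Definition quadratic_sum (k N : nat) (a : nat -> R) : R :=
  \sum_(1 <= n < N.+1) \sum_(1 <= p < N.+1) a n * a p * trilinear R k n p.

Lemma sine_sum_quadratic (F : R -> R) k N :
  \int[leb]_(x in D) (sine_sum F N x ^+ 2 * cos (k%:R * pi * x)) =
  quadratic_sum k N (fun n => inner F (phi n)).
Proof.
have i0 n p : leb.-integrable D (EFin \o (fun x => phi n x * phi p x * cos (k%:R * pi * x))).
  have := primitive_mul_integrable (primitiveM (@primitive_phi 1 n) (@primitive_phi 1 p))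
    (L2_integrable mD lebD (cosM_L2 (k%:R * pi))).
  by [].
under eq_Rintegral => x _.
  have -> : sine_sum F N x ^+ 2 * cos (k%:R * pi * x) =
    \sum_(1 <= n < N.+1) \sum_(1 <= p < N.+1) inner F (phi n) * inner F (phi p) *
      (phi n x * phi p x * cos (k%:R * pi * x)).
    rewrite expr2 /sine_sum mulr_suml mulr_suml; apply: eq_bigr => n _.
    rewrite mulr_sumr mulr_suml; apply: eq_bigr => p _; ring.
  over.
rewrite Rintegral_sum//; last first.
  by move=> n _; apply: integrable_sum_real => // p _; exact: integrable_scale.
apply: eq_bigr => n _; rewrite Rintegral_sum//; last by move=> p _; exact: integrable_scale.
by apply: eq_bigr => p _; rewrite RintegralZl.
Qed.

Lemma sine_sum_L2 (F : R -> R) N : L2 leb D (sine_sum F N).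
Proof.
elim: N => [|N IH].
  have -> : sine_sum F 0 = (fun=> 0 : R).
    by apply/funext => x; rewrite /sine_sum big_geq.
  exact: const_L2.
have -> : sine_sum F N.+1 = (fun x => sine_sum F N x + inner F (phi N.+1) * phi N.+1 x).
  by apply/funext => x; rewrite /sine_sum big_nat_recr.
by apply: L2_add => //; apply: L2_scale => //; exact: phi_L2.
Qed.

(** With S the N-th sine sum, F^2 - S^2 = (F - S) (F + S), where
    |F - S| <= |F'| / sqrt N and |F + S| = |2 F - (F - S)| <= 3 |F'|. *)
Lemma H10_quadratic_error (y dy : R -> R) (k N : nat) : H10 y dy -> (0 < N)%N ->
  `| - inner (fun x => y x * dy x) (phi k) -
     Num.sqrt 2 * (k%:R * pi) / 2 * quadratic_sum k N (fun n => inner y (phi n)) | <=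
  Num.sqrt 2 * (k%:R * pi) / 2 * (3 * inner dy dy / Num.sqrt N%:R).
Proof.
move=> yH N0; have [F [pF F0 F1 yF yE]] := H10_representative yH.
rewrite (H10_nonlinearity k yH pF)//; have [_ dyL _ _] := yH.
have -> : quadratic_sum k N (fun n => inner y (phi n)) =
    quadratic_sum k N (fun n => inner F (phi n)).
  apply: eq_bigr => n _; apply: eq_bigr => p _.
  by rewrite !yE//; [case: (phi_L2 R p)|case: (phi_L2 R n)].
rewrite -sine_sum_quadratic -mulrBr normrM ger0_norm; last by nonneg.
rewrite ler_wpM2l//; first by nonneg.
have FL : L2 leb D F by have [] := primitive_H10 dyL pF F0 F1.
have SL := sine_sum_L2 F N.
have sqr_int (G : R -> R) : L2 leb D G ->
    leb.-integrable D (EFin \o (fun x => G x ^+ 2 * cos (k%:R * pi * x))).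
  move=> [_ Gi]; under [X in _.-integrable _ X]eq_fun do rewrite /= mulrC.
  apply: (@integrable_mul_bounded _ _ _ _ _ _ 1) => //; last by move=> x _; exact: cos_max.
  by apply: measurable_funTS; apply: continuous_measurable_fun; exact: continuous_cosM.
rewrite -RintegralB//; [|exact: sqr_int..].
set Q := inner dy dy.
have -> : 3 * Q / Num.sqrt N%:R = \int[leb]_(x in D) (3 * Q / Num.sqrt N%:R).
  by rewrite Rintegral_const_oo// subr0 mulr1.
apply: Rintegral_norm_le => //.
- by apply: integrable_sub => //; exact: sqr_int.
- exact: integrable_const.
move=> x /=; rewrite in_itv/= => /andP[x0 x1].
have x01 : 0 <= x <= 1 by rewrite !ltW.
have e1 := sine_sum_error_le dyL pF F0 F1 x01 N0.
have e2 := primitive_sqr_le dyL pF F0 x01.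
have QE : \int[leb]_(z in D) (dy z ^+ 2) = Q.
  by apply: eq_Rintegral => z _; rewrite expr2.
rewrite QE in e1 e2; move: (sine_sum F N x) (F x) e1 e2 => S Fx e1 e2.
rewrite -mulrBl normrM (le_trans (ler_piMr _ (cos_max _)))//.
have N1 : 1 <= (N%:R : R) by rewrite ler1n.
have s1 : 1 <= Num.sqrt (N%:R : R) by rewrite -[leLHS]sqrtr1 ler_sqrt ?ltr0n.
have ss : Num.sqrt (N%:R : R) ^+ 2 = N%:R by rewrite sqr_sqrtr.
have s0 : 0 < Num.sqrt (N%:R : R) by rewrite (lt_le_trans ltr01).
have Q0 : 0 <= Q by rewrite (le_trans (sqr_ge0 _) e2).
rewrite ler_pdivlMr//; rewrite -ss ler_pdivlMr ?exprn_gt0// in e1.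
move: (Num.sqrt N%:R) s1 ss s0 e1 => s s1 ss s0 e1.
pose q := Num.sqrt Q; have qq : q ^+ 2 = Q by rewrite sqr_sqrtr.
have q0 : 0 <= q by exact: sqrtr_ge0.
have f1 : `|Fx| <= q by rewrite -(@ler_sqr _ `|Fx|) ?nnegrE// real_normK ?num_real// qq.
have f2 : `|Fx - S| * s <= q.
  rewrite -(@ler_sqr _ (`|Fx - S| * s)) ?nnegrE//; last by nonneg.
  by rewrite exprMn real_normK ?num_real// qq.
have f3 : `|Fx + S| <= 3 * q.
  have -> : Fx + S = 2 * Fx - (Fx - S) by ring.
  apply: le_trans (ler_normB _ _) _; rewrite normrM normr_nat.
  have : `|Fx - S| <= `|Fx - S| * s by rewrite ler_peMr.
  lra.
rewrite subr_sqr normrM -qq expr2 mulrAC [3 * _]mulrCA.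
by apply: ler_pM => //; nonneg.
Qed.

End H10_functions.

(** * Sine coefficients of the two solutions *)

Section time_evolution.
Variable R : realType.
Local Notation leb := (@lebesgue_measure R).
Local Notation mR := (measurableTypeR R).
Local Notation D := (`]0, 1[%classic : set mR).
Variable T : R.
Hypothesis T0 : 0 < T.
Local Notation I := (`]0, T[%classic : set mR).
Local Notation leb2 := (leb \x leb)%E.

Let mD : measurable D. Proof. exact: measurable_oo. Qed.
Let mI : measurable I. Proof. exact: measurable_oo. Qed.
Let mID : measurable (I `*` D). Proof. exact: measurableX. Qed.

Lemma rectangle_lty : (leb2 (I `*` D) < +oo)%E.
Proof.
rewrite product_measure1E// lte_mul_pinfty//.
- by rewrite ge0_fin_numE//; exact: lebesgue_itv_lty.
- exact: lebesgue_itv_lty.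
Qed.

Lemma continuous_snd_L2 (g : R -> R) (M : R) : continuous g -> (forall x, `|g x| <= M) ->
  L2 leb2 (I `*` D) (fun p => g p.2).
Proof.
move=> cg gM; apply: (@bounded_L2 _ _ _ _ _ mID M).
- exact: rectangle_lty.
- apply: measurable_funTS; apply: (measurableT_comp _ measurable_snd).
  exact: continuous_measurable_fun.
- by move=> z _; exact: gM.
Qed.

Lemma integrable_inner_time (y : R -> R -> R) (g : R -> R) (M : R) :
  L2 leb2 (I `*` D) (fun p => y p.1 p.2) -> continuous g -> (forall x, `|g x| <= M) ->
  leb.-integrable I (EFin \o (fun s => inner (y s) g)).
Proof.
move=> yL cg gM.
have i0 := L2_mul_integrable mID yL (continuous_snd_L2 cg gM).
exact: (Fubini_integrable1 mI mD i0).
Qed.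

Lemma integrable_inner_mul_time (y z : R -> R -> R) (g : R -> R) (M : R) :
  L2 leb2 (I `*` D) (fun p => y p.1 p.2) -> L2 leb2 (I `*` D) (fun p => z p.1 p.2) ->
  continuous g -> (forall x, `|g x| <= M) ->
  leb.-integrable I (EFin \o (fun s => inner (fun x => y s x * z s x) g)).
Proof.
move=> yL zL cg gM.
have i0 := L2_mul_integrable mID yL zL.
have [mg _] := continuous_snd_L2 cg gM.
have i1 := integrable_mul_bounded mID mg (fun p _ => gM p.2) i0.
apply: (integrable_ext _ _ (Fubini_integrable1 mI mD i1)) => // s _.
by apply: eq_Rintegral => x _; rewrite /= mulrC.
Qed.

Lemma sqrt2_ge0 : 0 <= Num.sqrt (2 : R). Proof. exact: sqrtr_ge0. Qed.

Lemma phi_bound n (x : R) : `|phi n x| <= Num.sqrt 2.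
Proof. by rewrite normrM (ger0_norm sqrt2_ge0) ler_piMr ?sqrt2_ge0// sin_max. Qed.

Lemma continuous_phi n : continuous (@phi R n).
Proof. by move=> x; exact: is_derive_cont (is_derive_phi n x). Qed.

Lemma dphi_bound n (x : R) : `|dphi n x| <= Num.sqrt 2 * (n%:R * pi).
Proof.
rewrite normrM (ger0_norm sqrt2_ge0) ler_wpM2l ?sqrt2_ge0// normrM ger0_norm; last by nonneg.
by rewrite ler_piMr ?cos_max//; nonneg.
Qed.

Lemma energy_coefficient_integrable (y dy : R -> R -> R) n : energy_space T y dy ->
  leb.-integrable I (EFin \o (fun s => inner (y s) (phi n))).
Proof.
by move=> [_ _ yL _ _]; exact: (integrable_inner_time yL (@continuous_phi n) (phi_bound n)).
Qed.

(** The weak formulation is tested with phi_n; [H10_by_parts] replaces the gradient term at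
    almost every time. *)
Lemma heat_coefficient (F : R -> (R -> R) -> R) (y dy : R -> R -> R) n :
  heat_solution T F y dy ->
  leb.-integrable I (EFin \o (fun s => F s (phi n))) ->
  inner (y 0) (phi n) = 0 /\
  primitive T (fun s => F s (phi n) - lambda R n * inner (y s) (phi n))
    (fun t => inner (y t) (phi n)).
Proof.
move=> [yE _ yF] Fi; have [_ _ yL dyL yH] := yE.
have di := integrable_inner_time dyL (@continuous_dphi R n) (dphi_bound n).
have weak t : 0 <= t <= T -> inner (y t) (phi n) =
    \int[leb]_(s in `]0, t[) (F s (phi n) - inner (dy s) (@dphi R n)).
  move=> /andP[t0 tT]; have := yF _ _ (H10_phi R n) t; rewrite in_itv/= t0 tT => /(_ isT).
  have sub h : leb.-integrable I (EFin \o h) -> leb.-integrable `]0, t[ (EFin \o h).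
    exact: integrable_itv_sub.
  by rewrite RintegralB//; [move=> <-; rewrite addrK|exact: sub|exact: sub].
have y0 : inner (y 0) (phi n) = 0.
  by rewrite weak ?lexx ?(ltW T0)// Rintegral_oo_empty.
split=> //; apply: (@primitive_ae R T (fun s => F s (phi n) - inner (dy s) (@dphi R n))).
- apply: (integrable_measurable (m := leb)); apply: integrable_sub => //.
  by apply: integrable_scale => //; exact: energy_coefficient_integrable yE.
- by apply: ae_imply yH => s yH sT; rewrite (H10_by_parts n (yH sT)).
- split; first exact: integrable_sub.
  by move=> t tT; rewrite weak// y0 add0r.
Qed.

Lemma primitive_expR (c : R) : primitive T (fun s => c * expR (c * s)) (fun s => expR (c * s)).
Proof.
apply: (@derive_primitive R); first by move=> x; exact: is_derive_expRM.
by apply: continuous_mul; [exact: continuous_const|exact: continuous_expRM].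
Qed.

Lemma integrable_expR_mul (c : R) (f : R -> R) : leb.-integrable I (EFin \o f) ->
  leb.-integrable I (EFin \o (fun s => expR (c * s) * f s)).
Proof. exact: (primitive_mul_integrable (primitive_expR c)). Qed.

Lemma primitive_decay (c : R) (f a : R -> R) : primitive T (fun s => f s - c * a s) a ->
  primitive T (fun s => expR (c * s) * f s) (fun t => expR (c * t) * a t).
Proof.
move=> pa; apply: (primitive_ext _ (primitiveM (primitive_expR c) pa)) => s _; ring.
Qed.

Lemma primitive_at (f F : R -> R) (t : R) : primitive T f F -> 0 <= t <= T ->
  F t = F 0 + \int[leb]_(s in `]0, t[) f s.
Proof. by move=> [_]; apply. Qed.

Lemma duhamel (c : R) (f a : R -> R) (t : R) : a 0 = 0 ->
  primitive T (fun s => f s - c * a s) a -> 0 <= t <= T ->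
  a t = expR (- (c * t)) * \int[leb]_(s in `]0, t[) (expR (c * s) * f s).
Proof.
move=> a0 pa tT; have := primitive_at (primitive_decay pa) tT.
rewrite a0 mulr0 add0r => <-.
by rewrite mulrA [expR (- _) * _]mulrC expRxMexpNx_1 mul1r.
Qed.

Variables (u : R -> R) (m : nat -> R) (lam : nat -> R) (a : nat -> R -> R).
Hypothesis ui : leb.-integrable I (EFin \o u).
Hypothesis a0 : forall n, a n 0 = 0.
Hypothesis pa : forall n, primitive T (fun s => u s * m n - lam n * a n s) (a n).

Definition forcing_moment (c : R) (n : nat) : R :=
  \int[leb]_(s in I) (expR (c * s) * (u s * a n s)).

Let ua n : leb.-integrable I (EFin \o (fun s => u s * a n s)).
Proof.
by apply: (integrable_ext _ _ (primitive_mul_integrable (pa n) ui)) => // s _; exact: mulrC.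
Qed.

(** Integration over (0,T) of the derivative of e^{c s} a_n a_p: the damping terms produce
    the factor c - lam_n - lam_p, the control the forcing moments. *)
Lemma product_moment (c : R) n p :
  expR (c * T) * (a n T * a p T) =
  (c - lam n - lam p) * \int[leb]_(s in I) (expR (c * s) * (a n s * a p s))
  + (m n * forcing_moment c p + m p * forcing_moment c n).
Proof.
have pp := primitiveM (primitive_expR c) (primitiveM (pa n) (pa p)).
have := primitive_end (ltW T0) pp; rewrite !a0 !mulr0 subr0 => <-.
have i1 : leb.-integrable I (EFin \o (fun s => expR (c * s) * (a n s * a p s))).
  exact: (integrable_expR_mul _ (primitive_integrable (primitiveM (pa n) (pa p)))).
have i2 q : leb.-integrable I (EFin \o (fun s => expR (c * s) * (u s * a q s))).
  exact: integrable_expR_mul.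
under eq_Rintegral => s _.
  have -> : c * expR (c * s) * (a n s * a p s) + expR (c * s) *
    ((u s * m n - lam n * a n s) * a p s + a n s * (u s * m p - lam p * a p s)) =
    (c - lam n - lam p) * (expR (c * s) * (a n s * a p s)) +
    (m n * (expR (c * s) * (u s * a p s)) + m p * (expR (c * s) * (u s * a n s))) by ring.
  over.
have i3 := integrable_scale mI (m n) (i2 p); have i4 := integrable_scale mI (m p) (i2 n).
rewrite RintegralD//; [|exact: integrable_scale|exact: integrable_add].
by rewrite RintegralD// !RintegralZl.
Qed.

Lemma forcing_momentE (c : R) n : forcing_moment c n =
  m n * \int[leb]_(s in I) (expR (- (lam n - c) * s) * u s *
    \int[leb]_(t in `]0, s[) (expR (lam n * t) * u t)).
Proof.
have e1 (q : R) := integrable_expR_mul q ui.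
rewrite -RintegralZl//; last by apply: integrable_mul_primitive; exact: e1.
apply: eq_Rintegral => s; rewrite inE/= in_itv/= => /andP[s0 sT].
have sub h : leb.-integrable I (EFin \o h) -> leb.-integrable `]0, s[ (EFin \o h).
  by apply: integrable_itv_sub => //; exact: ltW.
rewrite (duhamel (a0 n) (pa n)); last by rewrite !ltW.
under [X in _ * (_ * (_ * X)) = _]eq_Rintegral => t _ do rewrite mulrA.
rewrite RintegralZr//; last by apply: sub; exact: e1.
have -> : - (lam n - c) * s = c * s + - (lam n * s) by ring.
by rewrite expRD; ring.
Qed.

End time_evolution.

Section quadratic_solution_limit.
Variable R : realType.
Local Notation leb := (@lebesgue_measure R).
Local Notation mR := (measurableTypeR R).
Variables (T : R) (T0 : 0 < T).
Local Notation I := (`]0, T[%classic : set mR).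
Variables (y1 dy1 y2 dy2 : R -> R -> R) (k : nat).
Hypothesis y1E : energy_space T y1 dy1.
Hypothesis y2Q : quadratic_solution T y1 dy1 y2 dy2.

Let mI : measurable I. Proof. exact: measurable_oo. Qed.

Let kappa : R := Num.sqrt 2 * (k%:R * pi) / 2.

Lemma quadratic_solution_coefficient :
  inner (y2 T) (phi k) = expR (- (lambda R k * T)) *
    \int[leb]_(s in I) (expR (lambda R k * s) *
      - inner (fun x => y1 s x * dy1 s x) (phi k)).
Proof.
have [_ _ yL dyL _] := y1E.
have fi : leb.-integrable I (EFin \o (fun s => - inner (fun x => y1 s x * dy1 s x) (phi k))).
  have h := integrable_inner_mul_time yL dyL (@continuous_phi R k) (phi_bound k).
  apply: (integrable_ext _ _ (integrable_scale mI (- 1) h)) => // s _.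
  by rewrite mulN1r.
have [b0 pb] := heat_coefficient T0 y2Q fi.
by rewrite (duhamel b0 pb)// lexx ltW.
Qed.

Hypothesis aa : forall n p, leb.-integrable I
  (EFin \o (fun s => inner (y1 s) (phi n) * inner (y1 s) (phi p))).

(** [H10_quadratic_error] at almost every time, multiplied by e^{lambda_k s} and integrated. *)
Lemma quadratic_solution_error (N : nat) : (0 < N)%N ->
  `| \int[leb]_(s in I) (expR (lambda R k * s) * - inner (fun x => y1 s x * dy1 s x) (phi k))
     - kappa * \sum_(1 <= n < N.+1) \sum_(1 <= p < N.+1) trilinear R k n p *
         \int[leb]_(s in I) (expR (lambda R k * s) *
           (inner (y1 s) (phi n) * inner (y1 s) (phi p))) | <=
  kappa * (3 * \int[leb]_(s in I) (expR (lambda R k * s) * inner (dy1 s) (dy1 s))) /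
    Num.sqrt N%:R.
Proof.
move=> N0; have [_ _ yL dyL yH] := y1E.
pose f s := - inner (fun x => y1 s x * dy1 s x) (phi k).
pose a n s := inner (y1 s) (phi n).
have fi : leb.-integrable I (EFin \o f).
  have h := integrable_inner_mul_time yL dyL (@continuous_phi R k) (phi_bound k).
  apply: (integrable_ext _ _ (integrable_scale mI (- 1) h)) => // s _.
  by rewrite mulN1r.
have Qi : leb.-integrable I (EFin \o (fun s => inner (dy1 s) (dy1 s))).
  exact: (Fubini_integrable1 mI (measurable_oo 0 1)
    (L2_mul_integrable (measurableX mI (measurable_oo 0 1)) dyL dyL)).
have S_int : \int[leb]_(s in I) (expR (lambda R k * s) * quadratic_sum k N (fun n => a n s)) =
    \sum_(1 <= n < N.+1) \sum_(1 <= p < N.+1) trilinear R k n p *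
       \int[leb]_(s in I) (expR (lambda R k * s) * (a n s * a p s)).
  have ei n p : leb.-integrable I (EFin \o
      (fun s => expR (lambda R k * s) * (a n s * a p s))).
    by apply: integrable_expR_mul; exact: aa.
  under eq_Rintegral => s _.
    have -> : expR (lambda R k * s) * quadratic_sum k N (fun n => a n s) =
      \sum_(1 <= n < N.+1) \sum_(1 <= p < N.+1) trilinear R k n p *
       (expR (lambda R k * s) * (a n s * a p s)).
      rewrite /quadratic_sum mulr_sumr; apply: eq_bigr => n _.
      by rewrite mulr_sumr; apply: eq_bigr => p _; ring.
    over.
  rewrite Rintegral_sum//; last first.
    move=> n _; apply: integrable_sum_real => // p _.
    by apply: integrable_scale => //; exact: ei.
  apply: eq_bigr => n _; rewrite Rintegral_sum//; last first.
    by move=> p _; apply: integrable_scale => //; exact: ei.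
  by apply: eq_bigr => p _; rewrite RintegralZl.
rewrite -S_int.
have qi : leb.-integrable I (EFin \o
    (fun s => expR (lambda R k * s) * quadratic_sum k N (fun n => a n s))).
  apply: integrable_expR_mul; apply: integrable_sum_real => // n _.
  apply: integrable_sum_real => // p _.
  under [X in _.-integrable _ X]eq_fun do rewrite /= mulrC.
  by apply: integrable_scale => //; exact: aa.
have ef := integrable_expR_mul (lambda R k) fi.
have eQ := integrable_expR_mul (lambda R k) Qi.
rewrite -RintegralZl// -RintegralB//; last exact: integrable_scale.
pose K := kappa * 3 / Num.sqrt N%:R.
have -> : kappa * (3 * \int[leb]_(s in I) (expR (lambda R k * s) * inner (dy1 s) (dy1 s))) /
    Num.sqrt N%:R = \int[leb]_(s in I) (K * (expR (lambda R k * s) * inner (dy1 s) (dy1 s))).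
  by rewrite RintegralZl// /K; ring.
apply: ae_Rintegral_norm_le => //.
- by apply: integrable_sub => //; exact: integrable_scale.
- exact: integrable_scale.
- apply: ae_imply yH => s yH sI.
  have := H10_quadratic_error k (yH sI) N0.
  have -> : expR (lambda R k * s) * f s - kappa *
      (expR (lambda R k * s) * quadratic_sum k N (fun n => a n s)) =
    expR (lambda R k * s) * (f s - kappa * quadratic_sum k N (fun n => a n s)) by ring.
  move=> h; rewrite normrM (gtr0_norm (expR_gt0 _)).
  have -> : K * (expR (lambda R k * s) * inner (dy1 s) (dy1 s)) =
    expR (lambda R k * s) * (kappa * (3 * inner (dy1 s) (dy1 s) / Num.sqrt N%:R)).
    by rewrite /K; ring.
  by rewrite ler_pM2l ?expR_gt0.
Qed.

End quadratic_solution_limit.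

(** * The causal quadratic form and the power spectrum *)

Section spectral_identity.
Variable R : realType.
Local Notation leb := (@lebesgue_measure R).
Local Notation mR := (measurableTypeR R).
Variable T : R.
Local Notation I := (`]0, T[%classic : set mR).
Variable v : R -> R.
Hypothesis vi : leb.-integrable I (EFin \o v).

Let mI : measurable I. Proof. exact: measurable_oo. Qed.

Let sub (s : R) (h : R -> R) : s <= T -> leb.-integrable I (EFin \o h) ->
  leb.-integrable `]0, s[ (EFin \o h).
Proof. exact: integrable_itv_sub. Qed.

(** Fubini's theorem for the square of an integral transform, applied once for each of the
    two time variables s and t. The two statements on integrability in the middle allow
    the cosine and sine parts of the power spectrum to be added under the integrals. *)
Lemma Rintegral_square (q : R -> R -> R) (rho : R -> R) :
  measurable_fun setT (fun z : mR * mR => q z.1 z.2) -> (forall w s, `|q w s| <= 1) ->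
  leb.-integrable setT (EFin \o rho) ->
  [/\ leb.-integrable setT (EFin \o (fun w => (\int[leb]_(s in I) (v s * q w s)) ^+ 2 * rho w)),
      (forall s, leb.-integrable I (EFin \o (fun t => v t *
        \int[leb]_w (q w s * q w t * rho w)))),
      leb.-integrable I (EFin \o (fun s => v s * \int[leb]_(t in I) (v t *
        \int[leb]_w (q w s * q w t * rho w)))) &
      \int[leb]_w ((\int[leb]_(s in I) (v s * q w s)) ^+ 2 * rho w) =
      \int[leb]_(s in I) (v s * \int[leb]_(t in I) (v t *
        \int[leb]_w (q w s * q w t * rho w)))].
Proof.
move=> mq q1 ri.
have mq1 w : measurable_fun (setT : set mR) (q w).
  exact: (measurable_fun_pair2 w mq).
have mq2 s : measurable_fun (setT : set mR) (q^~ s).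
  exact: (measurable_fun_pair1 s mq).
have vq w : leb.-integrable I (EFin \o (fun s => v s * q w s)).
  under [X in _.-integrable _ X]eq_fun do rewrite /= mulrC.
  apply: (@integrable_mul_bounded _ _ _ _ _ _ 1) => //.
  exact: measurable_funTS.
pose C w := \int[leb]_(s in I) (v s * q w s).
have mqS := measurable_funTS (D := setT `*` I) mq.
have i1 := integrable_tensor_bounded measurableT mI ri vi mqS (fun z => q1 z.1 z.2).
have gi : leb.-integrable setT (EFin \o (fun w => C w * rho w)).
  apply: (integrable_ext _ _ (Fubini_integrable1 measurableT mI i1)) => // w _ /=.
  rewrite /C -RintegralZr//; apply: eq_Rintegral => s _; ring.
have i2 := integrable_tensor_bounded measurableT mI gi vi mqS (fun z => q1 z.1 z.2).
have eqw w : \int[leb]_(s in I) (q w s * (C w * rho w * v s)) = C w ^+ 2 * rho w.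
  have -> : C w ^+ 2 * rho w = (C w * rho w) * C w by ring.
  rewrite {3}/C -RintegralZl//; apply: eq_Rintegral => s _; ring.
have mqq s : measurable_fun (setT `*` I) (fun z : mR * mR => q z.1 s * q z.1 z.2).
  apply: measurable_funM => //; apply: measurable_funTS.
  exact: (measurableT_comp (mq2 s) measurable_fst).
have qq1 s (z : mR * mR) : `|q z.1 s * q z.1 z.2| <= 1.
  by rewrite normrM mulr_ile1.
have i3 s := integrable_tensor_bounded measurableT mI ri vi (mqq s) (qq1 s).
have eqt s t : \int[leb]_w (q w s * q w t * (rho w * v t)) =
    v t * \int[leb]_w (q w s * q w t * rho w).
  rewrite -RintegralZl//; last first.
    apply: (@integrable_mul_bounded _ _ _ _ _ _ 1) => //; first exact: measurable_funM.
    by move=> w _; rewrite normrM mulr_ile1.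
  by apply: eq_Rintegral => w _; ring.
have eqs s : \int[leb]_w (q w s * (C w * rho w * v s)) =
    v s * \int[leb]_(t in I) (v t * \int[leb]_w (q w s * q w t * rho w)).
  have bq : leb.-integrable setT (EFin \o (fun w => q w s * (C w * rho w))).
    by apply: (@integrable_mul_bounded _ _ _ _ _ _ 1).
  have -> : \int[leb]_w (q w s * (C w * rho w * v s)) =
      v s * \int[leb]_w (q w s * (C w * rho w)).
    by rewrite -RintegralZl//; apply: eq_Rintegral => w _; ring.
  congr (_ * _); rewrite -(eq_Rintegral _ (fun (t : mR) _ => eqt s t)).
  rewrite -(Fubini_swap measurableT mI (i3 s)).
  apply: eq_Rintegral => w _.
  have -> : q w s * (C w * rho w) = q w s * rho w * C w by ring.
  by rewrite /C -RintegralZl//; apply: eq_Rintegral => t _; ring.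
have F1 := Fubini_integrable1 measurableT mI i2.
have F2 := Fubini_integrable2 measurableT mI i2.
split.
- by apply: (integrable_ext _ _ F1) => // w _ /=; rewrite eqw.
- move=> s; apply: (integrable_ext _ _ (Fubini_integrable2 measurableT mI (i3 s))) => // t _ /=.
  exact: eqt.
- by apply: (integrable_ext _ _ F2) => // s sI /=; rewrite eqs.
- rewrite -(eq_Rintegral _ (fun (w : mR) _ => eqw w)) -(eq_Rintegral _ (fun (s : mR) _ => eqs s)).
  exact: (Fubini_swap measurableT mI i2).
Qed.

Definition fourier_cos (w : R) : R := \int[leb]_(s in I) (v s * cos (w * s)).
Definition fourier_sin (w : R) : R := \int[leb]_(s in I) (v s * sin (w * s)).
(** The squared modulus of the Fourier transform of v restricted to (0,T). *)
Definition power_spectrum (w : R) : R := fourier_cos w ^+ 2 + fourier_sin w ^+ 2.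

Let measurable_mul_arg (f : R -> R) : continuous f ->
  measurable_fun setT (fun z : mR * mR => f (z.1 * z.2)).
Proof.
move=> cf; apply: (measurableT_comp (continuous_measurable_fun cf)).
by apply: measurable_funM; [exact: measurable_fst|exact: measurable_snd].
Qed.

Lemma power_spectrum_ge0 w : 0 <= power_spectrum w.
Proof. by rewrite addr_ge0// sqr_ge0. Qed.

Let L1 : R := \int[leb]_(s in I) `|v s|.

Lemma power_spectrum_le w : power_spectrum w <= 2 * L1 ^+ 2.
Proof.
have bound (f : R -> R) : continuous f -> (forall x, `|f x| <= 1) ->
    (\int[leb]_(s in I) (v s * f (w * s))) ^+ 2 <= L1 ^+ 2.
  move=> cf f1; rewrite -[leLHS]real_normK ?num_real//.
  rewrite lerXn2r ?nnegrE//; first by apply: Rintegral_ge0.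
  apply: Rintegral_norm_le => //.
  - under [X in _.-integrable _ X]eq_fun do rewrite /= mulrC.
    apply: (@integrable_mul_bounded _ _ _ _ _ _ 1) => //.
    apply: measurable_funTS; apply: continuous_measurable_fun.
    exact: (continuous_comp_fun cf (@continuous_lin R w)).
  - exact: (integrable_norm vi).
  - by move=> s _; rewrite normrM ler_piMr.
have := bound _ (@continuous_cos R) (@cos_max R).
have := bound _ (@continuous_sin R) (@sin_max R).
rewrite /power_spectrum /fourier_cos /fourier_sin; lra.
Qed.

(** The integral of e^{- l (s - t)} v(t) v(s) over 0 < t < s < T. *)
Definition causal_form (l : R) : R :=
  \int[leb]_(s in I) (expR (- l * s) * v s * \int[leb]_(t in `]0, s[) (expR (l * t) * v t)).

Definition exp_moment (l : R) : R := \int[leb]_(s in I) (expR (l * s) * v s).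

Let ev (l : R) : leb.-integrable I (EFin \o (fun s => expR (l * s) * v s)).
Proof. exact: integrable_expR_mul. Qed.

(** For - l the kernel is e^{- l (t - s)}: after exchanging the names of the variables the
    same separable function is integrated over the other triangle. *)
Lemma causal_form_opp l : causal_form l + causal_form (- l) = exp_moment (- l) * exp_moment l.
Proof.
by rewrite /causal_form /exp_moment opprK (Rintegral_mul_triangle (ev (- l)) (ev l)).
Qed.

Lemma Rintegral_exp_dist l s : s \in I ->
  \int[leb]_(t in I) (v t * expR (- (l * `|s - t|))) =
  expR (- l * s) * \int[leb]_(t in `]0, s[) (expR (l * t) * v t) +
  expR (l * s) * (exp_moment (- l) - \int[leb]_(t in `]0, s[) (expR (- l * t) * v t)).
Proof.
rewrite inE/= in_itv/= => /andP[s0 sT].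
have cutE f : \int[leb]_(t in `]0, s[) f t = \int[leb]_(t in I) ((t < s)%R%:R * f t).
  by rewrite (@Rintegral_cut _ T _ _ (ltW sT)).
rewrite (cutE (fun t => expR (l * t) * v t)) (cutE (fun t => expR (- l * t) * v t)).
have cutb (f : R -> R) : leb.-integrable I (EFin \o f) ->
    leb.-integrable I (EFin \o (fun t => (t < s)%R%:R * f t)).
  apply: (@integrable_mul_bounded _ _ _ _ _ _ 1) => //.
    by apply: measurable_boolR; exact: measurable_fun_ltr.
  by move=> t _; case: (t < s); rewrite ?normr1 ?normr0.
have c1 := cutb _ (ev l); have c2 := cutb _ (ev (- l)).
have c3 := integrable_sub mI (ev (- l)) c2.
rewrite /exp_moment -(RintegralB mI (ev (- l)) c2).
rewrite -(RintegralZl (expR (- l * s)) mI c1) -(RintegralZl (expR (l * s)) mI c3).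
rewrite -(RintegralD mI (integrable_scale mI _ c1) (integrable_scale mI _ c3)).
apply: eq_Rintegral => t _; have [ts|st] := ltP t s.
  rewrite gtr0_norm ?subr_gt0// !mul1r subrr mulr0 addr0.
  have -> : - (l * (s - t)) = - l * s + l * t by ring.
  by rewrite expRD; ring.
rewrite ler0_norm ?subr_le0// !mul0r mulr0 add0r subr0.
have -> : - (l * - (s - t)) = l * s + - l * t by ring.
by rewrite expRD; ring.
Qed.

(** |vhat(w)|^2 is the double integral of v(s) v(t) cos(w (s - t)), and integrating the cosine
    against the Lorentzian gives pi e^{- l |s - t|}. The triangles t < s and s < t
    contribute equally. *)
Lemma power_spectrum_lorentz_gt0 l : 0 < l ->
  leb.-integrable setT (EFin \o (fun w => power_spectrum w * lorentz l w)) /\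
  \int[leb]_w (power_spectrum w * lorentz l w) = 2 * pi * causal_form l.
Proof.
move=> l0.
have [ic1 ict ic2 ec] := Rintegral_square (measurable_mul_arg (@continuous_cos R))
  (fun w s => cos_max (w * s)) (integrable_lorentz l0).
have [is1 ist is2 es] := Rintegral_square (measurable_mul_arg (@continuous_sin R))
  (fun w s => sin_max (w * s)) (integrable_lorentz l0).
split.
  apply: (integrable_ext _ _ (integrable_add measurableT ic1 is1)) => // w _.
  by rewrite /power_spectrum mulrDl.
have -> : \int[leb]_w (power_spectrum w * lorentz l w) =
    \int[leb]_w (fourier_cos w ^+ 2 * lorentz l w) +
    \int[leb]_w (fourier_sin w ^+ 2 * lorentz l w).
  by rewrite -RintegralD//; apply: eq_Rintegral => w _; rewrite -mulrDl.
rewrite [X in X + _]ec [X in _ + X]es -(RintegralD mI ic2 is2).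
have mcos s : measurable_fun (setT : set mR) (fun w : mR => cos (w * s)).
  apply: continuous_measurable_fun; apply: continuous_comp_fun; first exact: continuous_cos.
  by under eq_fun do rewrite mulrC; exact: continuous_lin.
have msin s : measurable_fun (setT : set mR) (fun w : mR => sin (w * s)).
  apply: continuous_measurable_fun; apply: continuous_comp_fun; first exact: continuous_sin.
  by under eq_fun do rewrite mulrC; exact: continuous_lin.
have kernel s t : \int[leb]_w (cos (w * s) * cos (w * t) * lorentz l w) +
    \int[leb]_w (sin (w * s) * sin (w * t) * lorentz l w) = pi * expR (- (l * `|s - t|)).
  rewrite -cos_lorentzE// /cos_lorentz -RintegralD//; last 2 first.
  - apply: (integrable_bounded_lorentz l0); first exact: (measurable_funM (mcos s) (mcos t)).
    by move=> w; rewrite normrM mulr_ile1// cos_max.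
  - apply: (integrable_bounded_lorentz l0); first exact: (measurable_funM (msin s) (msin t)).
    by move=> w; rewrite normrM mulr_ile1// sin_max.
  by apply: eq_Rintegral => w _; rewrite mulrBr cosB; ring.
have inner_t s : s \in I ->
  v s * (\int[leb]_(t in I) (v t * \int[leb]_w (cos (w * s) * cos (w * t) * lorentz l w))) +
  v s * (\int[leb]_(t in I) (v t * \int[leb]_w (sin (w * s) * sin (w * t) * lorentz l w))) =
  pi * (expR (- l * s) * v s * (\int[leb]_(t in `]0, s[) (expR (l * t) * v t)) +
    (exp_moment (- l) * (expR (l * s) * v s) -
     expR (l * s) * v s * \int[leb]_(t in `]0, s[) (expR (- l * t) * v t))).
  move=> sI; rewrite -mulrDr -(RintegralD mI (ict s) (ist s)).
  under eq_Rintegral => t _ do rewrite -mulrDr kernel mulrCA.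
  rewrite RintegralZl//; last first.
    under [X in _.-integrable _ X]eq_fun do rewrite /= mulrC.
    apply: (@integrable_mul_bounded _ _ _ _ _ _ 1) => //.
      apply: measurable_funTS; apply: continuous_measurable_fun.
      under eq_fun do rewrite -mulNr; apply: continuous_comp_fun.
        exact: continuous_expR.
      apply: continuous_mul; first exact: continuous_const.
      apply: continuous_comp_fun; first exact: norm_continuous.
      by move=> t; apply: continuousB; [exact: cst_continuous|exact: cvg_id].
    move=> t _; rewrite ger0_norm ?expR_ge0// expR_le1 oppr_le0; nonneg.
  by rewrite Rintegral_exp_dist//; ring.
rewrite (eq_Rintegral _ inner_t).
have t1 := integrable_mul_primitive (ev (- l)) (ev l).
have t2 := integrable_mul_primitive (ev l) (ev (- l)).
have t3 := integrable_scale mI (exp_moment (- l)) (ev l).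
have t4 := integrable_sub mI t3 t2.
rewrite (RintegralZl pi mI (integrable_add mI t1 t4)) (RintegralD mI t1 t4) (RintegralB mI t3 t2).
rewrite (RintegralZl _ mI (ev l)) -/(causal_form l) -/(exp_moment l).
have := causal_form_opp l; rewrite {2}/causal_form opprK => e.
move: e; set X := Rintegral _ _ _ => e; clearbody X.
have -> : X = exp_moment (- l) * exp_moment l - causal_form l by rewrite -e; ring.
ring.
Qed.

(** The Lorentzian is odd in l. For l < 0 the identity for - l > 0 is combined with
    [causal_form_opp], which is where the product of exponential moments comes from. *)
Lemma causal_form_spectral l : l != 0 ->
  leb.-integrable setT (EFin \o (fun w => power_spectrum w * lorentz l w)) /\
  2 * pi * causal_form l = \int[leb]_w (power_spectrum w * lorentz l w) +
    (l < 0)%R%:R * (2 * pi) * (exp_moment (- l) * exp_moment l).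
Proof.
rewrite neq_lt => /orP[l0|l0]; last first.
  have [i1 ->] := power_spectrum_lorentz_gt0 l0; split => //.
  by rewrite ltNge (ltW l0) !mul0r addr0.
have nl0 : 0 < - l by rewrite oppr_gt0.
have [i1 e1] := power_spectrum_lorentz_gt0 nl0.
have lorN w : lorentz l w = - lorentz (- l) w by rewrite /lorentz sqrrN mulNr opprK.
split.
  apply: (integrable_ext _ _ (integrable_scale measurableT (- 1) i1)) => // w _.
  by rewrite lorN; ring.
have -> : \int[leb]_w (power_spectrum w * lorentz l w) =
    - 1 * \int[leb]_w (power_spectrum w * lorentz (- l) w).
  by rewrite -(RintegralZl _ measurableT i1); apply: eq_Rintegral => w _; rewrite lorN; ring.
rewrite e1 l0 -(causal_form_opp l).
by move: (causal_form l) (causal_form (- l)) => A B; rewrite /=; ring.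
Qed.

End spectral_identity.

(** * Series indexed by n >= 1 *)

Section series_from_one.
Variable R : realType.
Local Notation leb := (@lebesgue_measure R).
Local Notation mR := (measurableTypeR R).
Implicit Types c l : nat -> R.

Definition summable1 c := exists B : R, forall N, \sum_(1 <= n < N) `|c n| <= B.

Lemma partial1_series c N : \sum_(1 <= n < N.+1) c n = series (fun n => c n.+1) N.
Proof. by rewrite big_add1. Qed.

Lemma sum1_cvg c : summable1 c -> (fun N => \sum_(1 <= n < N) c n) @ \oo --> sum1 c.
Proof.
move=> [B cB]; suff h : cvgn (series (fun n => c n.+1)).
  suff : cvgn (fun N => \sum_(1 <= n < N) c n) by [].
  apply/cvg_ex; exists (limn (series (fun n => c n.+1))).
  rewrite -cvg_shiftS.
  have -> : (fun n => \sum_(1 <= i < n.+1) c i) = series (fun n => c n.+1).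
    by apply/funext => N; exact: partial1_series.
  exact: h.
apply: normed_cvg; apply: nondecreasing_is_cvgn.
  apply/nondecreasing_seqP => N; rewrite /series/= [leRHS]big_nat_recr//= lerDl.
  exact: normr_ge0.
exists B => _ [N _ <-]; have := cB N.+1.
by rewrite big_add1.
Qed.

Lemma partial_le_sum1 c N : summable1 c -> (forall n, 0 <= c n) ->
  \sum_(1 <= n < N) c n <= sum1 c.
Proof.
move=> cs c0; apply: (nondecreasing_cvgn_le _ (cvgP _ (sum1_cvg cs))).
apply/nondecreasing_seqP => -[|n]; first by rewrite !big_geq.
by rewrite [leRHS]big_nat_recr//= lerDl.
Qed.

Lemma term_le_sum1 c n : summable1 c -> (forall n, 0 <= c n) -> (0 < n)%N -> c n <= sum1 c.
Proof.
move=> cs c0 n0; apply: le_trans (partial_le_sum1 n.+1 cs c0).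
by rewrite big_nat_recr//= lerDr sumr_ge0.
Qed.

Lemma summable1_le c c' : summable1 c' -> (forall n, (0 < n)%N -> `|c n| <= `|c' n|) ->
  summable1 c.
Proof.
move=> [B c'B] cc'; exists B => N; apply: le_trans (c'B N).
rewrite big_nat_cond [leRHS]big_nat_cond; apply: ler_sum => n /andP[/andP[n0 _] _].
exact: cc'.
Qed.

Lemma summable1_finite c K : (forall n, (K < n)%N -> c n = 0) -> summable1 c.
Proof.
move=> c0; exists (\sum_(1 <= n < K.+1) `|c n|) => N.
have [NK|KN] := leqP N K.+1.
  case: N NK => [|N] NK; first by rewrite big_geq// sumr_ge0.
  by rewrite [leRHS](@big_cat_nat _ _ _ N.+1)//= lerDl sumr_ge0.
rewrite (@big_cat_nat _ _ _ K.+1)//=; last exact: ltnW.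
rewrite [X in _ + X]big_nat_cond [X in _ + X]big1 ?addr0// => n /andP[/andP[Kn _] _].
by rewrite c0// normr0.
Qed.

Lemma normr_lorentz (l w : R) : `|lorentz l w| = lorentz `|l| w.
Proof.
rewrite /lorentz normrM normfV real_normK ?num_real//.
by rewrite (@ger0_norm _ (_ + _))// addr_ge0 ?sqr_ge0.
Qed.

Lemma lorentz_le (l w : R) : l != 0 -> `|lorentz l w| <= `|l|^-1.
Proof.
move=> l0; have nl : 0 < `|l| by rewrite normr_gt0.
rewrite normr_lorentz /lorentz ler_pdivrMr; last first.
  by rewrite ltr_wpDr ?sqr_ge0// exprn_gt0.
by rewrite mulrC ler_pdivlMr// -expr2 lerDl sqr_ge0.
Qed.

(** Dominated convergence. Every |lorentz (l n)| has integral pi, so the sum of the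
    |c n| P |lorentz (l n)| is an integrable majorant; the lower bound d on |l n| makes the
    series converge at every point w. *)
Lemma lorentz_series_exchange c l (P : R -> R) (d Bp : R) :
  summable1 c -> 0 < d -> (forall n, (0 < n)%N -> d <= `|l n|) ->
  (forall n, (0 < n)%N -> leb.-integrable setT (EFin \o (fun w => P w * lorentz (l n) w))) ->
  (forall w, 0 <= P w <= Bp) ->
  (fun N => \sum_(1 <= n < N) c n * \int[leb]_w (P w * lorentz (l n) w)) @ \oo -->
  \int[leb]_w (P w * sum1 (fun n => c n * lorentz (l n) w)).
Proof.
move=> cs d0 ld Pi PB; have [B cB] := cs.
have ln0 n : (0 < n)%N -> l n != 0.
  by move=> /ld dl; rewrite -normr_gt0 (lt_le_trans d0).
have P0 w : 0 <= P w by have /andP[] := PB w.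
have Bp0 : 0 <= Bp by have /andP[h1 h2] := PB 0; exact: le_trans h2.
pose t n w := c n * (P w * lorentz (l n) w).
have ti n : (0 < n)%N -> leb.-integrable setT (EFin \o t n).
  by move=> n0; apply: integrable_scale => //; exact: Pi.
pose f N w := \sum_(1 <= n < N.+1) t n w.
have fi N : leb.-integrable setT (EFin \o f N).
  have : leb.-integrable setT (EFin \o (fun w => \sum_(0 <= n < N) t n.+1 w)).
    by apply: integrable_sum_real => // n _; exact: ti.
  by apply: integrable_ext => // w _; rewrite /f big_add1.
have tb n w : (0 < n)%N -> `|c n * lorentz (l n) w| <= `|c n| * d^-1.
  move=> n0; rewrite normrM ler_wpM2l// (le_trans (lorentz_le _ (ln0 _ n0)))//.
  by rewrite lef_pV2 ?posrE ?(lt_le_trans d0) ?ld.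
have ts w : summable1 (fun n => c n * lorentz (l n) w).
  exists (B * d^-1) => N; apply: le_trans (_ : \sum_(1 <= n < N) (`|c n| * d^-1) <= _).
    rewrite big_nat_cond [leRHS]big_nat_cond; apply: ler_sum => n /andP[/andP[n0 _] _].
    exact: tb.
  by rewrite -mulr_suml ler_wpM2r// invr_ge0 ltW.
pose F w := P w * sum1 (fun n => c n * lorentz (l n) w).
have fF w : f N w @[N --> \oo] --> F w.
  have h := sum1_cvg (ts w); rewrite -cvg_shiftS in h.
  have -> : (fun N => f N w) = (fun N => P w * \sum_(1 <= n < N.+1) c n * lorentz (l n) w).
    by apply/funext => N; rewrite /f mulr_sumr; apply: eq_bigr => n _; rewrite /t mulrCA.
  by apply: cvgM; [exact: cvg_cst|exact: h].
pose g w : \bar R := (\sum_(n <oo) (`|t n.+1 w|)%:E)%E.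
have mt n : measurable_fun setT (fun w => (`|t n.+1 w|)%:E).
  apply/measurable_EFinP; apply: measurableT_comp => //.
  exact: (integrable_measurable (ti n.+1 isT)).
have mg : measurable_fun setT g by apply: ge0_emeasurable_sum => // n _; exact: mt.
have int_t n : (\int[leb]_w (`|t n.+1 w|)%:E <= (`|c n.+1| * (Bp * pi))%:E)%E.
  have l0 : 0 < `|l n.+1| by rewrite normr_gt0 ln0.
  apply: le_trans (_ : \int[leb]_w ((`|c n.+1| * Bp)%:E * (lorentz `|l n.+1| w)%:E) <= _)%E.
    apply: ge0_le_integral => //.
    - exact: mt.
    - apply/measurable_EFinP; apply: measurable_funM => //.
      exact: (continuous_measurable_fun (continuous_lorentz l0)).
    - move=> w _; rewrite -EFinM lee_fin /t 2!normrM normr_lorentz mulrA.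
      rewrite ler_wpM2r ?lorentz_ge0// ler_wpM2l//.
      by rewrite ger0_norm//; have /andP[] := PB w.
  rewrite ge0_integralZl_EFin//; last 3 first.
  - by move=> w _; rewrite lee_fin lorentz_ge0.
  - by apply/measurable_EFinP; exact: (continuous_measurable_fun (continuous_lorentz l0)).
  - by rewrite mulr_ge0.
  by rewrite integral_lorentz// lee_fin mulrA.
have gi : leb.-integrable setT g.
  apply/integrableP; split=> //.
  under eq_integral => w _ do rewrite gee0_abs ?nneseries_ge0//.
  rewrite integral_nneseries//.
  apply: (@le_lt_trans _ _ (B * (Bp * pi))%:E); last exact: ltry.
  apply: lime_le.
    by apply: is_cvg_nneseries => n _ _; exact: integral_ge0.
  apply: nearW => N.
  apply: (@le_trans _ _ (\sum_(0 <= n < N) (`|c n.+1| * (Bp * pi))%:E)%E).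
    by apply: lee_sum => n _; exact: int_t.
  rewrite sumEFin lee_fin -mulr_suml ler_wpM2r//; first by rewrite mulr_ge0 ?pi_ge0.
  by have := cB N.+1; rewrite big_add1.
have fg N w : (`|(f N w)%:E| <= g w)%E.
  apply: le_trans (_ : (\sum_(0 <= n < N) (`|t n.+1 w|)%:E)%E <= _)%E.
    by rewrite sumEFin lee_fin /f big_add1; exact: ler_norm_sum.
  exact: (nneseries_lim_ge N).
have mF : measurable_fun setT (EFin \o F).
  apply: (emeasurable_fun_cvg (fun N => EFin \o f N)).
    by move=> N; exact: (measurable_int _ (fi N)).
  by move=> w _; apply: cvg_EFin; [exact: nearW|exact: fF].
have [] := @dominated_convergence _ _ _ leb setT measurableT (fun N => EFin \o f N) (EFin \o F) g.
- by move=> N; exact: (measurable_int _ (fi N)).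
- exact: mF.
- by apply: aeW => w _; apply: cvg_EFin; [exact: nearW|exact: fF].
- exact: gi.
- by apply: aeW => w N _; exact: fg.
move=> Fi _ lim.
rewrite -cvg_shiftS /=.
have -> : (fun N => \sum_(1 <= n < N.+1) c n * \int[leb]_w (P w * lorentz (l n) w)) =
    (fun N => fine (\int[leb]_w (EFin \o f N) w)%E).
  apply/funext => N; rewrite /f.
  transitivity (\int[leb]_w (\sum_(0 <= n < N) t n.+1 w)); last first.
    by congr fine; apply: eq_integral => w _; rewrite /= big_add1.
  rewrite Rintegral_sum//; last by move=> n _; exact: ti.
  rewrite big_add1; apply: eq_bigr => n _; rewrite /t RintegralZl//; exact: Pi.
apply: fine_cvg; rewrite fineK//.
exact: (integrable_fin_num _ Fi).
Qed.

End series_from_one.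

(** * The norm of H^{-1} *)

Section dual_norm.
Variable R : realType.
Local Notation leb := (@lebesgue_measure R).
Local Notation mR := (measurableTypeR R).
Local Notation D := (`]0, 1[%classic : set mR).

Let mD : measurable D. Proof. exact: measurable_oo. Qed.

Lemma inner_suml (h : nat -> R -> R) (g : R -> R) (b : nat -> R) N :
  (forall n, L2 leb D (h n)) -> L2 leb D g ->
  inner (fun x => \sum_(1 <= n < N) b n * h n x) g = \sum_(1 <= n < N) b n * inner (h n) g.
Proof.
move=> hL gL; rewrite /inner.
have hg n : leb.-integrable D (EFin \o (fun x => h n x * g x)) by exact: L2_mul_integrable.
transitivity (\int[leb]_(x in D) \sum_(1 <= n < N) b n * (h n x * g x)).
  apply: eq_Rintegral => x _; rewrite mulr_suml; apply: eq_bigr => n _.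
  by rewrite mulrA.
rewrite Rintegral_sum//; last by move=> n _; exact: integrable_scale.
by apply: eq_bigr => n _; rewrite RintegralZl.
Qed.

Lemma innerC (f g : R -> R) : inner f g = inner g f.
Proof. by apply: eq_Rintegral => x _; rewrite mulrC. Qed.

Lemma inner_dphi n p : (0 < n)%N -> (0 < p)%N ->
  inner (@dphi R n) (@dphi R p) = lambda R n * (n == p)%:R.
Proof.
move=> n0 p0; rewrite /inner.
transitivity (\int[leb]_(x in D) (2 * (n%:R * pi) * (p%:R * pi) *
    (cos (n%:R * pi * x) * cos (p%:R * pi * x)))).
  apply: eq_Rintegral => x _; rewrite /dphi -{3}(@sqr_sqrtr R 2)//; ring.
rewrite RintegralZl//; last by apply: L2_mul_integrable => //; exact: cosM_L2.
by rewrite Rintegral_cos_mul// /lambda; have [->|_] := eqVneq n p; rewrite /=; lra.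
Qed.

Variable l : (R -> R) -> R.

Local Notation sq := (fun n => (lambda R n)^-1 * l (phi n) ^+ 2).

Lemma lambda_ge0 n : 0 <= lambda R n. Proof. exact: sqr_ge0. Qed.

Lemma lambda_gt0 n : (0 < n)%N -> 0 < lambda R n.
Proof. by move=> n0; rewrite exprn_gt0// mulr_gt0 ?pi_gt0// ltr0n. Qed.

Let sq_ge0 n : 0 <= (lambda R n)^-1 * l (phi n) ^+ 2.
Proof. by rewrite mulr_ge0 ?sqr_ge0// invr_ge0 lambda_ge0. Qed.

Lemma Hm1_norm_sqr : summable1 sq -> Hm1_norm l ^+ 2 = sum1 sq.
Proof.
move=> sl; rewrite /Hm1_norm sqr_sqrtr//.
by apply: le_trans (partial_le_sum1 1 sl sq_ge0); rewrite big_geq.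
Qed.

Lemma quotient_sqr (x : R) n : (0 < n)%N -> (x / n%:R) ^+ 2 = pi ^+ 2 * ((lambda R n)^-1 * x ^+ 2).
Proof.
move=> n0; rewrite /lambda; have := @pi_gt0 R; move: (pi : R) => w w0; field.
by rewrite pnatr_eq0 -lt0n n0 gt_eqF.
Qed.

Lemma quotient_le_Hm1_norm n : summable1 sq -> (0 < n)%N ->
  `|l (phi n) / n%:R| <= pi * Hm1_norm l.
Proof.
move=> sl n0; have p0 := @pi_ge0 R.
rewrite -(@ler_pXn2r _ 2)// ?nnegrE ?normr_ge0 ?mulr_ge0 ?sqrtr_ge0//.
rewrite real_normK ?num_real// quotient_sqr// exprMn Hm1_norm_sqr// ler_wpM2l ?sqr_ge0//.
exact: term_le_sum1.
Qed.

Lemma quotient_sum_le_Hm1_norm N : summable1 sq ->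
  \sum_(1 <= n < N) (l (phi n) / n%:R) ^+ 2 <= pi ^+ 2 * Hm1_norm l ^+ 2.
Proof.
move=> sl; rewrite Hm1_norm_sqr//.
apply: le_trans (_ : pi ^+ 2 * \sum_(1 <= n < N) (lambda R n)^-1 * l (phi n) ^+ 2 <= _).
  rewrite mulr_sumr le_eqVlt; apply/orP; left; apply/eqP.
  by apply: eq_big_nat => n /andP[n0 _]; exact: quotient_sqr.
by rewrite ler_wpM2l ?sqr_ge0//; exact: partial_le_sum1.
Qed.

Hypothesis lH : Hm1 l.

Lemma Hm1_zero : H10 (fun=> 0 : R) (fun=> 0) /\ l (fun=> 0) = 0.
Proof.
have h := H10_phi R 1; have e := H10_lin (-1) h h.
have z f : (fun x => -1 * f x + f x) = (fun=> 0 : R) by apply/funext => x; ring.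
rewrite !z in e; split => //.
have [/(_ (-1) _ _ _ _ h h)] := lH; rewrite z => -> _; ring.
Qed.

Lemma Hm1_sine_sum (b : nat -> R) N :
  H10 (fun x => \sum_(1 <= n < N.+1) b n * phi n x) (fun x => \sum_(1 <= n < N.+1) b n * dphi n x)
  /\ l (fun x => \sum_(1 <= n < N.+1) b n * phi n x) = \sum_(1 <= n < N.+1) b n * l (phi n).
Proof.
elim: N => [|N [IH lE]].
  have z (h : nat -> R -> R) : (fun x => \sum_(1 <= n < 1) b n * h n x) = (fun=> 0).
    by apply/funext => x; rewrite big_geq.
  by rewrite !z big_geq//; exact: Hm1_zero.
have h := H10_phi R N.+1.
have z (g : nat -> R -> R) : (fun x => \sum_(1 <= n < N.+2) b n * g n x) =
    (fun x => b N.+1 * g N.+1 x + \sum_(1 <= n < N.+1) b n * g n x).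
  by apply/funext => x; rewrite big_nat_recr//= addrC.
rewrite !z; split; first exact: H10_lin.
have [lD _] := lH.
by rewrite (lD _ _ _ _ _ h IH) lE [in RHS]big_nat_recr//= addrC.
Qed.

Lemma inner_sine_sum (b : nat -> R) N :
  inner (fun x => \sum_(1 <= n < N.+1) b n * dphi n x)
        (fun x => \sum_(1 <= n < N.+1) b n * dphi n x) =
  \sum_(1 <= n < N.+1) lambda R n * b n ^+ 2.
Proof.
have [gH _] := Hm1_sine_sum b N; have [_ dgL _ _] := gH.
rewrite inner_suml//; last exact: dphi_L2.
rewrite big_nat_cond [RHS]big_nat_cond; apply: eq_bigr => n /andP[/andP[n0 nN] _].
rewrite innerC inner_suml; [|by move=> p; exact: dphi_L2|exact: dphi_L2].
rewrite (bigD1_seq n)//= ?mem_index_iota ?n0 ?iota_uniq// inner_dphi// eqxx mulr1.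
rewrite big_nat_cond big1 ?addr0; first by ring.
move=> p /andP[/andP[p0 _] pn].
by rewrite inner_dphi// (negbTE pn) !mulr0.
Qed.

(** The functional is tested on the sum of lambda_n^{-1} l(phi_n) phi_n for n <= N: its value
    and the square of the norm of the test function are both equal to the partial sum S,
    whence S <= M sqrt S and S <= M^2. *)
Lemma Hm1_summable : summable1 sq.
Proof.
have [_ [M lM]] := lH; exists (M ^+ 2) => -[|N]; first by rewrite big_geq// sqr_ge0.
pose b n := (lambda R n)^-1 * l (phi n).
have [gH gE] := Hm1_sine_sum b N; have := lM _ _ gH; rewrite gE inner_sine_sum.
set S := \sum_(1 <= n < N.+1) _ => SM.
have SE : S = \sum_(1 <= n < N.+1) (lambda R n)^-1 * l (phi n) ^+ 2.
  by apply: eq_bigr => n _; rewrite /b expr2; ring.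
have -> : \sum_(1 <= n < N.+1) `|(lambda R n)^-1 * l (phi n) ^+ 2| = S.
  by rewrite SE; apply: eq_bigr => n _; rewrite ger0_norm.
have S0 : 0 <= S by rewrite SE sumr_ge0.
have E : \sum_(1 <= n < N.+1) lambda R n * b n ^+ 2 = S.
  rewrite SE; apply: eq_big_nat => n /andP[n0 _]; rewrite /b.
  have := lambda_gt0 n0; move: (lambda R n) (l _) => x y x0; field.
  by rewrite gt_eqF.
move: SM; rewrite E (ger0_norm S0) -{1}(sqr_sqrtr S0).
move: (sqr_sqrtr S0) (sqrtr_ge0 S); move: (Num.sqrt S) => q qS q0 qM.
by rewrite -qS; nra.
Qed.

End dual_norm.

(** * Coupling of the modes *)

Section coupling.
Variables (R : realType) (k : nat).
Hypothesis k0 : (0 < k)%N.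

(** At most one of the three conditions holds when n, p, k > 0; the last two
    amount to p = |n - k|. *)
Definition coupling (n p : nat) : R :=
  (p == n + k)%N%:R + (n == p + k)%N%:R + (n + p == k)%N%:R.

Lemma couplingC n p : coupling n p = coupling p n.
Proof. by rewrite /coupling (addnC p n) [(p == _)%:R + _]addrC. Qed.

Lemma coupling_ge0 n p : 0 <= coupling n p.
Proof. by rewrite !addr_ge0. Qed.

(** The resonance identity. If p = n + k then k^2 - n^2 - p^2 = - 2 n p, and if n + p = k
    it is 2 n p, which matches the signs in [trilinearE]. *)
Lemma trilinear_coupling n p : (0 < n)%N -> (0 < p)%N ->
  4 * pi ^+ 2 * trilinear R k n p =
  - (coupling n p / (n%:R * p%:R)) * (lambda R k - lambda R n - lambda R p).
Proof.
move=> n0 p0; rewrite trilinearE// /lambda /coupling.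
have nz : n%:R != 0 :> R by rewrite pnatr_eq0 -lt0n.
have pz : p%:R != 0 :> R by rewrite pnatr_eq0 -lt0n.
move: (pi : R) => w.
have [e1|e1] := eqVneq p (n + k)%N.
  have -> : (n == p + k)%N = false by lia.
  have -> : (n + p == k)%N = false by lia.
  have -> : k%:R = p%:R - n%:R :> R by rewrite e1 natrD addrC addKr.
  by rewrite /=; field; rewrite nz pz.
have [e2|e2] := eqVneq n (p + k)%N.
  have -> : (n + p == k)%N = false by lia.
  have -> : k%:R = n%:R - p%:R :> R by rewrite e2 natrD addrC addKr.
  by rewrite /=; field; rewrite nz pz.
have [e3|e3] := eqVneq (n + p)%N k; last by rewrite /=; ring.
have -> : k%:R = n%:R + p%:R :> R by rewrite -e3 natrD.
by rewrite /=; field; rewrite nz pz.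
Qed.

Lemma coupling_row n N (F : nat -> R) : (0 < n)%N ->
  \sum_(1 <= p < N) coupling n p * F p =
  (n + k < N)%N%:R * F (n + k)%N + ((n != k) && (`|n - k| < N))%N%:R * F `|n - k|%N.
Proof.
move=> n0.
have point (q : nat) : \sum_(1 <= p < N) (p == q)%:R * F p = ((0 < q) && (q < N))%N%:R * F q.
  have [qN|qN] := boolP ((0 < q) && (q < N))%N.
    rewrite (bigD1_seq q)//= ?mem_index_iota ?iota_uniq// eqxx big1 ?addr0//.
    by move=> p /negbTE ->; rewrite mul0r.
  rewrite big_nat_cond big1 ?mul0r// => p; rewrite andbT => pN.
  have -> : (p == q) = false by apply/negP => /eqP pq; rewrite -pq pN in qN.
    by rewrite mul0r.
transitivity (\sum_(1 <= p < N) ((p == n + k)%N%:R * F p + (p == `|n - k|)%N%:R * F p)).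
  rewrite big_nat_cond [RHS]big_nat_cond; apply: eq_bigr => p /andP[/andP[p0 _] _].
  rewrite -mulrDl /coupling -addrA; congr ((_ + _) * _).
  have -> : (p == `|n - k|)%N = (n == p + k)%N || (n + p == k)%N by lia.
  have [e|e] := eqVneq n (p + k)%N; last by rewrite add0r.
  have -> : (n + p == k)%N = false by lia.
  by rewrite addr0.
rewrite big_split/= !point; congr (_%:R * _ + _%:R * _); lia.
Qed.

Lemma coupling_row_le2 n N : (0 < n)%N -> \sum_(1 <= p < N) coupling n p <= 2.
Proof.
move=> n0; have := coupling_row N (fun=> 1) n0; rewrite !mulr1.
under eq_bigr do rewrite mulr1.
move=> ->; have b (x : bool) : x%:R <= 1 :> R by case: x.
by rewrite -[2]/(1 + 1); exact: lerD.
Qed.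

(** Schur's test, with 2 |x_n x_p| <= x_n^2 + x_p^2 and [coupling_row_le2]. *)
Lemma coupling_form_le N (x : nat -> R) :
  `|\sum_(1 <= n < N) \sum_(1 <= p < N) coupling n p * (x n * x p)| <=
  2 * \sum_(1 <= n < N) x n ^+ 2.
Proof.
apply: le_trans (ler_norm_sum _ _ _) _.
apply: le_trans (_ : \sum_(1 <= n < N) \sum_(1 <= p < N)
   (coupling n p * x n ^+ 2 / 2 + coupling n p * x p ^+ 2 / 2) <= _).
  apply: ler_sum => n _; apply: le_trans (ler_norm_sum _ _ _) _; apply: ler_sum => p _.
  rewrite normrM ger0_norm ?coupling_ge0// -mulrDl -mulrDr -mulrA ler_wpM2l ?coupling_ge0//.
  by rewrite ler_norml; have := sqr_ge0 (x n - x p); have := sqr_ge0 (x n + x p);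
     rewrite !expr2; lra.
under eq_bigr do rewrite big_split/=.
rewrite big_split/= [X in _ + X]exchange_big_nat/=.
under [X in _ + X]eq_bigr do under eq_bigr do rewrite couplingC.
have dbl (z : R) : z + z = 2 * z by lra.
rewrite dbl ler_wpM2l// big_nat_cond [leRHS]big_nat_cond.
apply: ler_sum => n /andP[/andP[n0 _] _].
under eq_bigr do rewrite -mulrA.
rewrite -mulr_suml.
apply: le_trans (_ : 2 * (x n ^+ 2 / 2) <= _); last by lra.
by rewrite ler_wpM2r ?divr_ge0 ?sqr_ge0//; exact: coupling_row_le2.
Qed.

(** [trilinear_coupling] supplies the factor of A n p in the product formula, so that A n p is
    traded for a n * a p and forcing terms; the two forcing terms are merged by the
    symmetry of [coupling]. *)
Lemma trilinear_sum_identity (lam_ a m J Lc : nat -> R) (A : nat -> nat -> R) (K : R) N :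
  (forall n, lam_ n = lambda R n) ->
  (forall n p, K * (a n * a p) = (lam_ k - lam_ n - lam_ p) * A n p + (m n * J p + m p * J n)) ->
  (forall n, J n = m n * Lc n) ->
  4 * pi ^+ 2 * \sum_(1 <= n < N) \sum_(1 <= p < N) trilinear R k n p * A n p =
  2 * \sum_(1 <= n < N) Lc n * (m n / n%:R) *
        \sum_(1 <= p < N) coupling n p * (m p / p%:R)
  - K * \sum_(1 <= n < N) \sum_(1 <= p < N) coupling n p * (a n / n%:R * (a p / p%:R)).
Proof.
move=> lamE prod JE.
pose f n p := coupling n p * (m n / n%:R * (m p / p%:R)).
have fC n p : f n p = f p n by rewrite /f couplingC [m n / _ * _]mulrC.
have sym : \sum_(1 <= n < N) \sum_(1 <= p < N) f n p * Lc p =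
    \sum_(1 <= n < N) \sum_(1 <= p < N) f n p * Lc n.
  by rewrite exchange_big_nat/=; apply: eq_bigr => n _; apply: eq_bigr => p _; rewrite fC.
transitivity (\sum_(1 <= n < N) \sum_(1 <= p < N)
   (f n p * Lc p + f n p * Lc n - K * (coupling n p * (a n / n%:R * (a p / p%:R))))).
  rewrite mulr_sumr big_nat_cond [RHS]big_nat_cond; apply: eq_bigr => n /andP[/andP[n0 _] _].
  rewrite mulr_sumr big_nat_cond [RHS]big_nat_cond; apply: eq_bigr => p /andP[/andP[p0 _] _].
  rewrite mulrA trilinear_coupling// -!lamE.
  have -> : f n p * Lc p + f n p * Lc n =
      coupling n p / (n%:R * p%:R) * (m n * J p + m p * J n).
    rewrite /f !JE invfM; ring.
  have -> : K * (coupling n p * (a n / n%:R * (a p / p%:R))) =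
      coupling n p / (n%:R * p%:R) * (K * (a n * a p)) by rewrite invfM; ring.
  rewrite prod; ring.
transitivity (\sum_(1 <= n < N) (\sum_(1 <= p < N) f n p * Lc p + \sum_(1 <= p < N) f n p * Lc n
   - \sum_(1 <= p < N) K * (coupling n p * (a n / n%:R * (a p / p%:R))))).
  by apply: eq_bigr => n _; rewrite sumrB big_split.
rewrite sumrB big_split/= sym.
have dbl (z : R) : z + z = 2 * z by lra.
rewrite dbl; congr (2 * _ - _).
  apply: eq_bigr => n _; rewrite mulr_sumr; apply: eq_bigr => p _; rewrite /f; ring.
by rewrite mulr_sumr; apply: eq_bigr => n _; rewrite mulr_sumr.
Qed.

End coupling.

(** * Lower bound on the modal gaps *)

Section modal_gap.
Variables (R : realType) (n k : nat).

Let dbl : lambda2 R n k = pi ^+ 2 / 2 * ((2 * n ^ 2)%:R - (k ^ 2)%:R).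
Proof. by rewrite /lambda2 /lambda natrM !natrX; move: (pi : R) => w; field. Qed.

Lemma lambda2_lt0 : (lambda2 R n k < 0) = ((n ^ 2)%:R < (k ^ 2)%:R / 2 :> R).
Proof.
have p0 : 0 < pi ^+ 2 / 2 :> R by rewrite divr_gt0// exprn_gt0 ?pi_gt0.
rewrite dbl pmulr_rlt0// subr_lt0 ltr_pdivlMr// natrM mulrC; congr (_ < _).
Qed.

(** 2 n^2 - k^2 is an integer, and it is not 0 because the exponent of 2 is odd in 2 n^2 and
    even in k^2. *)
Lemma lambda2_gap : (0 < n)%N -> pi ^+ 2 / 2 <= `|lambda2 R n k|.
Proof.
move=> n0; have p0 : 0 < pi ^+ 2 / 2 :> R by rewrite divr_gt0// exprn_gt0 ?pi_gt0.
rewrite dbl normrM (gtr0_norm p0) ler_pMr//.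
have neq : (2 * n ^ 2)%N != (k ^ 2)%N.
  apply/eqP => /(congr1 (logn 2)); case: (posnP k) => [->|k0].
    by rewrite logn0 lognM ?expn_gt0 ?n0// logn_prime.
  by rewrite lognM ?expn_gt0 ?n0// !lognX logn_prime//=; lia.
have [h|h] := ltnP (2 * n ^ 2) (k ^ 2).
  by rewrite distrC -natrB ?normr_nat ?ler1n ?subn_gt0// ltnW.
by rewrite -natrB// normr_nat ler1n subn_gt0 ltn_neqAle eq_sym neq.
Qed.

End modal_gap.

(** * Limit of the forcing terms *)

Section interaction_limit.
Variables (R : realType) (k : nat).
Hypothesis k0 : (0 < k)%N.
Local Notation leb := (@lebesgue_measure R).
Local Notation coupling := (coupling R k).

(** With M n = <mu, phi_n> / n, this is the coefficient of the n-th Lorentzian in [Kmu]. *)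
Definition interaction (M : nat -> R) (n : nat) : R :=
  M n * (M (n + k)%N + M `|n - k|%N * (n != k)%:R).

Variable M : nat -> R.
Hypothesis MS : summable1 (fun n => M n ^+ 2).

Let r n : R := `|M n| * (`|M (n + k)%N| + `|M `|n - k|%N| * (n != k)%:R).

Let r_summable : summable1 r.
Proof.
have [B MB] := MS; exists (2 * B) => N.
have r0 n : 0 <= r n by rewrite mulr_ge0// addr_ge0// mulr_ge0.
apply: le_trans (_ : \sum_(1 <= n < N + k) \sum_(1 <= p < N + k)
    coupling n p * (`|M n| * `|M p|) <= _); last first.
  apply: le_trans (ler_norm _) (le_trans (coupling_form_le k0 _ _) _).
  rewrite ler_wpM2l//; apply: le_trans (MB (N + k)%N).
  by apply: ler_sum => n _; rewrite real_normK ?num_real// ler_norm.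
have pos n : 0 <= \sum_(1 <= p < N + k) coupling n p * (`|M n| * `|M p|).
  by apply: sumr_ge0 => p _; rewrite !mulr_ge0// coupling_ge0.
have [N0|N0] := posnP N.
  by move: pos; rewrite N0 => pos; rewrite big_geq//; apply: sumr_ge0 => n _; exact: pos.
rewrite [leRHS](@big_cat_nat _ _ _ N)//=; last exact: leq_addr.
rewrite -[leLHS]addr0 lerD//; last by rewrite sumr_ge0.
rewrite big_nat_cond [leRHS]big_nat_cond; apply: ler_sum => n /andP[/andP[n0 nN] _].
rewrite ger0_norm// /r.
have -> : \sum_(1 <= p < N + k) coupling n p * (`|M n| * `|M p|) =
    `|M n| * \sum_(1 <= p < N + k) coupling n p * `|M p|.
  by rewrite mulr_sumr; apply: eq_bigr => p _; ring.
(* the columns p < N + k contain all the neighbours n + k and |n - k| of a row n < N *)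
rewrite coupling_row// ltn_add2r nN mul1r.
have -> : (`|n - k| < N + k)%N by lia.
by rewrite andbT [_%:R * _]mulrC.
Qed.

Lemma summable1_interaction : summable1 (interaction M).
Proof.
apply: (summable1_le r_summable) => n _; rewrite /interaction /r normrM.
rewrite [leRHS]ger0_norm; last by rewrite mulr_ge0// addr_ge0// mulr_ge0.
rewrite ler_wpM2l//; apply: le_trans (ler_normD _ _) _.
by rewrite lerD2l normrM ler_wpM2l// normr_nat.
Qed.

(** When both indices run up to N + k, the row n is incomplete if n > N: the term p = n + k is
    missing. The missing terms add up to the difference of two partial sums of one
    convergent series, hence to something that tends to 0. *)
Lemma coupling_rows_cvg (Lc : nat -> R) (B Y : R) :
  (forall n, (0 < n)%N -> `|Lc n| <= B) ->
  (fun N => \sum_(1 <= n < N) interaction M n * Lc n) @ \oo --> Y ->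
  (fun N => \sum_(1 <= n < N) Lc n * M n * \sum_(1 <= p < N) coupling n p * M p) @ \oo --> Y.
Proof.
move=> LB cY; pose S n := Lc n * (M n * M (n + k)%N).
have Ssum : summable1 S.
  have [C rC] := r_summable; exists (C * B) => N.
  apply: le_trans (_ : \sum_(1 <= n < N) `|r n| * B <= _); last first.
    rewrite -mulr_suml ler_wpM2r//; exact: le_trans (LB 1%N isT).
  rewrite big_nat_cond [leRHS]big_nat_cond; apply: ler_sum => n /andP[/andP[n0 _] _].
  rewrite /S normrM mulrC; apply: ler_pM => //; last exact: LB.
  rewrite normrM [leRHS]ger0_norm; last by rewrite mulr_ge0// addr_ge0// mulr_ge0.
  by rewrite /r ler_wpM2l// lerDl mulr_ge0.
rewrite -(cvg_shiftn k.+1).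
have -> : (fun N => \sum_(1 <= n < N + k.+1) Lc n * M n *
    \sum_(1 <= p < N + k.+1) coupling n p * M p) =
  (fun N => \sum_(1 <= n < N + k.+1) interaction M n * Lc n
     - (\sum_(1 <= n < N + k.+1) S n - \sum_(1 <= n < N + 1) S n)).
  apply/funext => N.
  have -> : \sum_(1 <= n < N + 1) S n =
      \sum_(1 <= n < N + k.+1) (n + k < N + k.+1)%N%:R * S n.
    rewrite [RHS](@big_cat_nat _ _ _ (N + 1))//= ?addn1 ?leq_add2l//; last first.
      by rewrite addnS ltnS leq_addr.
    rewrite [X in _ = _ + X]big_nat_cond [X in _ = _ + X]big1 ?addr0; last first.
      move=> n /andP[/andP[Nn _] _].
      have -> : (n + k < N + k.+1)%N = false by lia.
      by rewrite mul0r.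
    rewrite big_nat_cond [RHS]big_nat_cond; apply: eq_bigr => n /andP[/andP[_ nN] _].
    have -> : (n + k < N + k.+1)%N by lia.
    by rewrite mul1r.
  rewrite -!sumrB big_nat_cond [RHS]big_nat_cond; apply: eq_bigr => n /andP[/andP[n0 nN] _].
  rewrite coupling_row//.
  have -> : (`|n - k| < N + k.+1)%N by lia.
  rewrite andbT /S /interaction; ring.
have shift j (f : nat -> R) (l : R) : f @ \oo --> l -> (fun N => f (N + j)%N) @ \oo --> l.
  by rewrite -{1}(cvg_shiftn j).
have cS := sum1_cvg Ssum.
have := cvgB (shift k.+1 _ _ cY) (cvgB (shift k.+1 _ _ cS) (shift 1%N _ _ cS)).
by rewrite subrr subr0; apply.
Qed.

Lemma bounded_lorentz_integral (P : R -> R) (Bp l : R) : l != 0 ->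
  (forall w, 0 <= P w <= Bp) ->
  leb.-integrable setT (EFin \o (fun w => P w * lorentz l w)) ->
  `|\int[leb]_w (P w * lorentz l w)| <= Bp * pi.
Proof.
move=> l0 PB Pi; have nl : 0 < `|l| by rewrite normr_gt0.
have iL := integrable_lorentz nl.
have <- : \int[leb]_w (Bp * lorentz `|l| w) = Bp * pi.
  by rewrite RintegralZl//; congr (_ * _); rewrite /Rintegral integral_lorentz.
apply: Rintegral_norm_le => //; first exact: integrable_scale.
move=> w _; have /andP[P0 PBw] := PB w.
by rewrite normrM ger0_norm// normr_lorentz ler_pM// lorentz_ge0.
Qed.

End interaction_limit.

(** * The second-order expansion *)

Section second_order_expansion.
Variables (R : realType) (k : nat).
Hypothesis k0 : (0 < k)%N.
Local Notation leb := (@lebesgue_measure R).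
Local Notation mR := (measurableTypeR R).
Variables (mu : (R -> R) -> R) (T : R) (u : R -> R).
Hypothesis muH : Hm1 mu.
Hypothesis T0 : 0 < T.
Local Notation I := (`]0, T[%classic : set mR).
Hypothesis uL : L2 leb `]0, T[ u.

Let mI : measurable I. Proof. exact: measurable_oo. Qed.

Let ui : leb.-integrable I (EFin \o u).
Proof. exact: (L2_integrable mI (lebesgue_itv_lty _ _) uL). Qed.

Let m n := mu (phi n).
Let M n := m n / n%:R.
Let v s := u s * expR (lambda R k * s / 2).
Local Notation l n := (lambda2 R n k).
Let L n := causal_form T v (l n).
Let U n := \int[leb]_(t in `]0, T[) (u t * expR ((lambda R k - lambda R n) * t)).
Let W n := \int[leb]_(t in `]0, T[) (expR (lambda R n * t) * u t).

Let vE s : v s = expR (lambda R k / 2 * s) * u s.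
Proof. by rewrite /v mulrC mulrAC. Qed.

Let vi : leb.-integrable I (EFin \o v).
Proof.
by apply: (integrable_ext _ _ (integrable_expR_mul (lambda R k / 2) ui)).
Qed.

Let mu_summable := Hm1_summable muH.

Let M_le n : (0 < n)%N -> `|M n| <= pi * Hm1_norm mu.
Proof. exact: quotient_le_Hm1_norm. Qed.

Let MS : summable1 (fun n => M n ^+ 2).
Proof.
exists (pi ^+ 2 * Hm1_norm mu ^+ 2) => N.
under eq_bigr do rewrite ger0_norm ?sqr_ge0//.
exact: quotient_sum_le_Hm1_norm.
Qed.

Lemma exp_moment_opp n : exp_moment T v (- l n) = U n.
Proof.
apply: eq_Rintegral => s _; rewrite vE mulrA -expRD mulrC; congr (_ * expR _).
by rewrite /lambda2; field.
Qed.

Lemma exp_moment_pos n : exp_moment T v (l n) = W n.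
Proof.
apply: eq_Rintegral => s _; rewrite vE mulrA -expRD; congr (expR _ * _).
by rewrite /lambda2; field.
Qed.

Lemma normc_fourier w : Normc.normc (fourier (weighted_control k T u) w) ^+ 2 =
  power_spectrum T v w.
Proof.
have cut f : \int[leb]_t (weighted_control k T u t * f t) = \int[leb]_(t in I) (v t * f t).
  rewrite [RHS]Rintegral_mkcond; apply: eq_Rintegral => t _.
  rewrite /weighted_control /patch indicE -/(v t).
  by case: (t \in I); rewrite ?mulr1// mulr0 mul0r.
rewrite /fourier !cut /Normc.normc sqr_sqrtr; last by rewrite addr_ge0// sqr_ge0.
by rewrite sqrrN.
Qed.

Let e n := (l n < 0)%R%:R * (2 * pi) * (U n * W n).

Lemma causal_form_split n : (0 < n)%N ->
  leb.-integrable setT (EFin \o (fun w => power_spectrum T v w * lorentz (l n) w)) /\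
  2 * pi * L n = \int[leb]_w (power_spectrum T v w * lorentz (l n) w) + e n.
Proof.
move=> n0; have ln : l n != 0.
  rewrite -normr_gt0; apply: lt_le_trans (lambda2_gap R k n0).
  by rewrite divr_gt0// exprn_gt0// pi_gt0.
by rewrite /e -exp_moment_opp -exp_moment_pos; exact: (causal_form_spectral vi).
Qed.

Lemma lambda2_ge0 n : (k < n)%N -> (l n < 0) = false.
Proof.
move=> kn; apply/negbTE; rewrite -leNgt /lambda2 /lambda.
have h : (k%:R * pi) ^+ 2 <= (n%:R * pi) ^+ 2 :> R.
  by rewrite lerXn2r ?nnegrE ?mulr_ge0 ?pi_ge0// ler_wpM2r ?pi_ge0// ler_nat ltnW.
have := sqr_ge0 (k%:R * pi : R); lra.
Qed.

Let e0 n : (k < n)%N -> e n = 0.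
Proof. by move=> kn; rewrite /e lambda2_ge0// !mul0r. Qed.

Let Bp := 2 * (\int[leb]_(s in I) `|v s|) ^+ 2.

Let PB w : 0 <= power_spectrum T v w <= Bp.
Proof. by rewrite power_spectrum_ge0 (power_spectrum_le vi). Qed.

Let Espec := \int[leb]_w (power_spectrum T v w * Kmu mu k w).
Let Elow := \sum_(1 <= n < k.+1) interaction k M n * e n.

Lemma interaction_causal_cvg :
  (fun N => \sum_(1 <= n < N) interaction k M n * L n) @ \oo --> (Espec + Elow) / (2 * pi).
Proof.
have d0 : 0 < pi ^+ 2 / 2 :> R by rewrite divr_gt0// exprn_gt0 ?pi_gt0.
have ex : (fun N => \sum_(1 <= n < N) interaction k M n *
    \int[leb]_w (power_spectrum T v w * lorentz (l n) w)) @ \oo --> Espec.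
  apply: (lorentz_series_exchange (summable1_interaction k0 MS) d0 _ _ PB) => n n0.
    exact: lambda2_gap.
  by have [] := causal_form_split n0.
have ee : (fun N => \sum_(1 <= n < N) interaction k M n * e n) @ \oo --> Elow.
  rewrite -(cvg_shiftn k.+1).
  have -> : (fun N => \sum_(1 <= n < N + k.+1) interaction k M n * e n) = (fun=> Elow).
    apply/funext => N; rewrite (@big_cat_nat _ _ _ k.+1)//=; last by rewrite leq_addl.
    rewrite [X in _ + X]big_nat_cond [X in _ + X]big1 ?addr0// => n /andP[/andP[kn _] _].
    by rewrite e0// mulr0.
  exact: cvg_cst.
have -> : (fun N => \sum_(1 <= n < N) interaction k M n * L n) =
  (fun N => (\sum_(1 <= n < N) interaction k M n *
    \int[leb]_w (power_spectrum T v w * lorentz (l n) w)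
    + \sum_(1 <= n < N) interaction k M n * e n) * (2 * pi)^-1).
  apply/funext => N; rewrite -big_split/= mulr_suml big_nat_cond [RHS]big_nat_cond.
  apply: eq_bigr => n /andP[/andP[n0 _] _]; have [_ h] := causal_form_split n0.
  rewrite -mulrDr -h; have := @pi_gt0 R; move: (pi : R) => w w0; field.
  by rewrite gt_eqF.
by apply: cvgM; [exact: cvgD|exact: cvg_cst].
Qed.

(** The exponential moments are not bounded uniformly in n, but they only contribute for
    n <= k. *)
Lemma causal_form_bounded : exists B, forall n, (0 < n)%N -> `|L n| <= B.
Proof.
exists ((Bp * pi + \sum_(1 <= n < k.+1) `|e n|) / (2 * pi)) => n n0.
have p0 := @pi_gt0 R; rewrite ler_pdivlMr ?mulr_gt0//.
have [iP h] := causal_form_split n0.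
have -> : `|L n| * (2 * pi) = `|2 * pi * L n|.
  by rewrite normrM (@gtr0_norm _ (2 * pi)) ?mulr_gt0// mulrC.
rewrite h; apply: le_trans (ler_normD _ _) _; apply: lerD.
  apply: bounded_lorentz_integral => //.
  rewrite -normr_gt0; apply: lt_le_trans (lambda2_gap R k n0).
  by rewrite divr_gt0// exprn_gt0.
have [nk|kn] := leqP n k; last by rewrite (e0 kn) normr0 sumr_ge0.
by rewrite (bigD1_seq n)//= ?mem_index_iota ?n0 ?iota_uniq// lerDl sumr_ge0.
Qed.

Lemma causal_rows_cvg :
  (fun N => \sum_(1 <= n < N) L n * M n * \sum_(1 <= p < N) coupling R k n p * M p) @ \oo -->
  (Espec + Elow) / (2 * pi).
Proof.
have [B LB] := causal_form_bounded.
exact: (coupling_rows_cvg k0 MS LB interaction_causal_cvg).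
Qed.

Variables y1 dy1 y2 dy2 : R -> R -> R.
Hypothesis y1S : linearized_solution T mu u y1 dy1.
Hypothesis y2S : quadratic_solution T y1 dy1 y2 dy2.

Let a n t := inner (y1 t) (phi n).

Lemma linearized_coefficient n :
  a n 0 = 0 /\ primitive T (fun s => u s * m n - lambda R n * a n s) (a n).
Proof.
apply: (heat_coefficient T0 y1S).
by apply: (integrable_ext _ _ (integrable_scale mI (m n) ui)) => // s _; rewrite mulrC.
Qed.

Let a0 n := (linearized_coefficient n).1.
Let pa n := (linearized_coefficient n).2.

Lemma linearized_endpoint n : expR (lambda R n * T) * a n T = m n * W n.
Proof.
have T01 : 0 <= T <= T by rewrite lexx ltW.
rewrite (duhamel (a0 n) (pa n) T01) mulrA expRxMexpNx_1 mul1r.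
rewrite /W -RintegralZl//; last exact: integrable_expR_mul.
by apply: eq_Rintegral => s _; ring.
Qed.

Lemma forcing_moment_causal n : forcing_moment T u a (lambda R k) n = m n * L n.
Proof.
rewrite (forcing_momentE ui a0 pa); congr (_ * _).
apply: eq_Rintegral => s _; rewrite vE mulrA -expRD.
congr (expR _ * _ * _); first by rewrite /lambda2; field.
apply: eq_Rintegral => t _; rewrite vE mulrA -expRD.
by congr (expR _ * _); rewrite /lambda2; field.
Qed.

(** The weights e^{- lambda_n (T - s)} are at most 1, so |a_n(T)| is at most |m_n| times the
    integral of |u|. *)
Lemma endpoint_summable :
  summable1 (fun n => (lambda R n)^-1 * inner (y1 T) (phi n) ^+ 2).
Proof.
pose u1 := \int[leb]_(s in I) `|u s|.
have [B MB] := mu_summable; exists (B * u1 ^+ 2) => N.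
apply: le_trans (_ : \sum_(1 <= n < N) `|(lambda R n)^-1 * m n ^+ 2| * u1 ^+ 2 <= _); last first.
  by rewrite -mulr_suml ler_wpM2r ?sqr_ge0.
apply: ler_sum => n _; rewrite [leLHS]normrM [in leRHS]normrM -mulrA ler_wpM2l// -/(a n T).
rewrite !normrX -exprMn lerXn2r ?nnegrE//.
  by rewrite mulr_ge0//; apply: Rintegral_ge0.
have -> : a n T = m n * (expR (- (lambda R n * T)) * W n).
  by rewrite mulrCA -linearized_endpoint mulrA [expR (- _) * _]mulrC expRxMexpNx_1 mul1r.
rewrite normrM ler_wpM2l// /W -RintegralZl//; last exact: integrable_expR_mul.
apply: Rintegral_norm_le => //.
- by apply: integrable_scale => //; exact: integrable_expR_mul.
- exact: (integrable_norm ui).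
move=> s; rewrite /= in_itv/= => /andP[s0 sT].
rewrite mulrA -expRD normrM ger0_norm ?expR_ge0// ler_piMl// -expR0 ler_expR.
by rewrite addrC subr_le0 ler_wpM2l ?lambda_ge0// ltW.
Qed.

Let A n p := \int[leb]_(s in I) (expR (lambda R k * s) * (a n s * a p s)).
Let kappa : R := Num.sqrt 2 * (k%:R * pi) / 2.
Let Q := \int[leb]_(s in I) (expR (lambda R k * s) *
   - inner (fun x => y1 s x * dy1 s x) (phi k)).

Lemma trilinear_sum_cvg :
  (fun N => kappa * \sum_(1 <= n < N.+1) \sum_(1 <= p < N.+1) trilinear R k n p * A n p)
    @ \oo --> Q.
Proof.
have [y1E _ _] := y1S.
have aa n p : leb.-integrable I (EFin \o (fun s => a n s * a p s)).
  exact: (primitive_mul_integrable (pa n) (primitive_integrable (pa p))).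
pose E := kappa * (3 * \int[leb]_(s in I) (expR (lambda R k * s) * inner (dy1 s) (dy1 s))).
have err N : (0 < N)%N -> `|Q - kappa * \sum_(1 <= n < N.+1) \sum_(1 <= p < N.+1)
    trilinear R k n p * A n p| <= E / Num.sqrt N%:R.
  by move=> N0; exact: (quadratic_solution_error k y1E aa N0).
apply/cvgrPdist_le => eps eps0; near=> N.
have N0 : (0 < N)%N by near: N; exact: nbhs_infty_gt.
apply: le_trans (err N N0) _; rewrite ler_pdivrMr ?sqrtr_gt0 ?ltr0n//.
rewrite mulrC -ler_pdivrMr//; apply: le_trans (ler_norm _) _.
rewrite -sqrtr_sqr ler_wsqrtr//; near: N; exact: nbhs_infty_ger.
Unshelve. all: by end_near.
Qed.

Let K := expR (lambda R k * T).

(** What is left once the forcing terms are subtracted is the quadratic form of [coupling] at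
    time T, bounded uniformly in the truncation by [coupling_form_le]. *)
Lemma quadratic_coefficient_bound :
  `|Q - kappa / (4 * pi ^+ 2) * (2 * ((Espec + Elow) / (2 * pi)))| <=
  kappa / (4 * pi ^+ 2) * (K * (2 * (pi ^+ 2 * Hm1_norm (inner (y1 T)) ^+ 2))).
Proof.
have p0 := @pi_gt0 R.
have kap0 : 0 <= kappa / (4 * pi ^+ 2) by rewrite /kappa; nonneg.
pose X N := \sum_(1 <= n < N.+1) L n * M n * \sum_(1 <= p < N.+1) coupling R k n p * M p.
pose Y N := \sum_(1 <= n < N.+1) \sum_(1 <= p < N.+1) trilinear R k n p * A n p.
have cX : X @ \oo --> (Espec + Elow) / (2 * pi).
  by have := causal_rows_cvg; rewrite -cvg_shiftS.
have cn : (fun N => `|kappa * Y N - kappa / (4 * pi ^+ 2) * (2 * X N)|) @ \oo -->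
    `|Q - kappa / (4 * pi ^+ 2) * (2 * ((Espec + Elow) / (2 * pi)))|.
  exact: (cvg_norm (cvgB trilinear_sum_cvg
  (cvgM (cvg_cst (kappa / (4 * pi ^+ 2))) (cvgM (cvg_cst (2 : R)) cX)))).
apply: (cvgr_to_le cn); apply: nearW => N /=.
have id := trilinear_sum_identity k0 N.+1 (fun n => erefl (lambda R n))
   (fun n p => product_moment T0 ui a0 pa (lambda R k) n p) forcing_moment_causal.
have -> : kappa * Y N = kappa / (4 * pi ^+ 2) * (4 * pi ^+ 2 * Y N).
  move: (Y N) p0; move: (pi : R) kappa => w q z w0; field.
  by rewrite gt_eqF.
rewrite {1}/Y id -/(X N) -mulrBr normrM (ger0_norm kap0) ler_wpM2l//.
rewrite addrAC subrr add0r normrN normrM ger0_norm ?expR_ge0// ler_wpM2l ?expR_ge0//.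
apply: le_trans (coupling_form_le k0 _ _) _; rewrite ler_wpM2l//.
exact: quotient_sum_le_Hm1_norm endpoint_summable.
Qed.

Let low n : R := ((n ^ 2)%:R < (k ^ 2)%:R / 2 :> R)%:R * `|a n T| * `|U n|.

Let low_ge0 n : 0 <= low n.
Proof. by rewrite !mulr_ge0. Qed.

Let low_summable : summable1 low.
Proof.
by apply: (@summable1_finite _ _ k) => n kn; rewrite /low -lambda2_lt0 lambda2_ge0// !mul0r.
Qed.

(** m_n W_n is e^{lambda_n T} a_n(T), and lambda_n < lambda_k for the modes that occur, so the
    exponential is at most K. The two factors M in [interaction] give the norm of mu. *)
Lemma low_mode_bound :
  `|Elow| <= 4 * pi ^+ 2 * Hm1_norm mu * (K * sum1 low).
Proof.
have p0 := @pi_ge0 R; have mu0 : 0 <= Hm1_norm mu by exact: sqrtr_ge0.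
apply: le_trans (ler_norm_sum _ _ _) _; rewrite mulrA.
apply: le_trans (_ : 4 * pi ^+ 2 * Hm1_norm mu * K * \sum_(1 <= n < k.+1) low n <= _); last first.
  rewrite ler_wpM2l ?mulr_ge0 ?expR_ge0 ?sqr_ge0//.
  exact: partial_le_sum1.
rewrite mulr_sumr big_nat_cond [leRHS]big_nat_cond; apply: ler_sum => n /andP[/andP[n0 _] _].
rewrite /e /low -lambda2_lt0; have [ln|_] := boolP (l n < 0); last first.
  by rewrite !mul0r mulr0 normr0 mulr0.
have -> : interaction k M n * (true%:R * (2 * pi) * (U n * W n)) =
  (M (n + k)%N + M `|n - k|%N * (n != k)%:R) * (2 * pi) * (M n * W n * U n).
  rewrite /interaction/=; move: (M n) (M (n + k)%N) (M _) (U n) (W n) (_%:R : R) (pi : R).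
  by move=> x y z x' y' b w; ring.
have -> : 4 * pi ^+ 2 * Hm1_norm mu * K * (true%:R * `|a n T| * `|U n|) =
  (2 * (pi * Hm1_norm mu)) * (2 * pi) * (K * `|a n T| * `|U n|).
  by rewrite /=; move: (pi : R) `|a n T| `|U n| (Hm1_norm mu) K => w x y z t; ring.
rewrite 2!normrM (@ger0_norm _ (2 * pi)) ?mulr_ge0//.
apply: ler_pM => //; first by rewrite !mulr_ge0.
  rewrite ler_wpM2r ?mulr_ge0//; apply: le_trans (ler_normD _ _) _.
  rewrite mulr_natl mulr2n; apply: lerD; first by apply: M_le; rewrite addn_gt0 n0.
  have [->|nk] := eqVneq n k; first by rewrite mulr0 normr0 mulr_ge0.
  by rewrite mulr1; apply: M_le; lia.
rewrite normrM ler_wpM2r//.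
have -> : M n * W n = expR (lambda R n * T) * a n T / n%:R.
  by rewrite linearized_endpoint /M mulrAC.
rewrite !normrM normfV normr_nat (ger0_norm (expR_ge0 _)).
rewrite ler_pdivrMr ?ltr0n//; apply: le_trans (_ : K * `|a n T| <= _).
  rewrite ler_wpM2r// /K ler_expR ler_wpM2r ?ltW//.
  by move: ln (lambda_ge0 R k); rewrite /lambda2; lra.
by rewrite ler_peMr ?mulr_ge0 ?expR_ge0// ler1n.
Qed.

Lemma second_order_estimate :
  `| inner (y2 T) (phi k)
     - k%:R * expR (- (lambda R k * T)) / (4 * pi ^+ 2 * Num.sqrt 2) * Espec |
  <= k%:R * pi * Hm1_norm (inner (y1 T)) ^+ 2
     + k%:R * pi * Hm1_norm mu * sum1 low.
Proof.
have [y1E _ _] := y1S.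
rewrite (quadratic_solution_coefficient T0 k y1E y2S) -/Q.
have := quadratic_coefficient_bound; have := low_mode_bound.
have hK : expR (- (lambda R k * T)) * K = 1 by rewrite /K expRN mulVf// gt_eqF ?expR_gt0.
have low0 : 0 <= sum1 low.
  apply: le_trans (partial_le_sum1 1 low_summable low_ge0).
  by rewrite big_geq.
have mu0 : 0 <= Hm1_norm mu by exact: sqrtr_ge0.
have x0 : 0 <= expR (- (lambda R k * T)) by exact: expR_ge0.
move: (@sqr_sqrtr R 2 (ler0n _ _)) (@sqrtr_ge0 R 2) (@pi_ge2 R) hK low0 mu0 x0; rewrite /kappa.
move: (pi : R) (sum1 low) (Hm1_norm mu) (Hm1_norm (inner (y1 T))) Espec Elow
  (expR (- (lambda R k * T))) Q K (Num.sqrt 2) (ler0n R k) => w s nm n1 sp hi x q kk r.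
move: (k%:R : R) => j j0 rr r0 w2 hK s0 nm0 x0 hiB qB.
have w0 : 0 < w by lra.
(* r, w, j and x stand for sqrt 2, pi, k and e^{- lambda_k T} *)
have rnz : r != 0 by apply/eqP => re; move: rr; rewrite re expr2; lra.
have r2 : r <= 2 by nra.
pose g := r * j / (8 * w ^+ 2).
have gE : j * x / (4 * w ^+ 2 * r) = g * x.
  apply: (mulIf rnz); have -> : g * x * r = r ^+ 2 * j * x / (8 * w ^+ 2) by rewrite /g; ring.
  by rewrite rr; field; rewrite rnz gt_eqF.
have qE : r * (j * w) / 2 / (4 * w ^+ 2) * (2 * ((sp + hi) / (2 * w))) = g * (sp + hi).
  by rewrite /g; field; rewrite gt_eqF.
have cE : r * (j * w) / 2 / (4 * w ^+ 2) * (kk * (2 * (w ^+ 2 * n1 ^+ 2))) =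
    r * (j * w) / 4 * n1 ^+ 2 * kk by field; rewrite gt_eqF.
rewrite qE cE in qB.
have -> : x * q - j * x / (4 * w ^+ 2 * r) * sp = x * (q - g * (sp + hi)) + x * g * hi.
  by rewrite gE; ring.
(* The exact constants r j w / 4 and r j / 2 are at most j w since r <= 2 <= w. *)
have g0 : 0 <= g by rewrite /g; nonneg.
apply: le_trans (ler_normD _ _) _; apply: lerD.
  rewrite normrM (ger0_norm x0).
  apply: le_trans (_ : x * (r * (j * w) / 4 * n1 ^+ 2 * kk) <= _); first by rewrite ler_wpM2l.
  have -> : x * (r * (j * w) / 4 * n1 ^+ 2 * kk) = x * kk * (r / 4 * (j * w * n1 ^+ 2)) by ring.
  rewrite hK mul1r; apply: ler_piMl; last by lra.
  by rewrite mulr_ge0 ?sqr_ge0// mulr_ge0// ltW.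
rewrite normrM (ger0_norm (mulr_ge0 x0 g0)).
apply: le_trans (_ : x * g * (4 * w ^+ 2 * nm * (kk * s)) <= _).
  by apply: ler_wpM2l hiB; exact: mulr_ge0.
have -> : x * g * (4 * w ^+ 2 * nm * (kk * s)) = x * kk * (r / 2 * (j * nm * s)).
  by rewrite /g; field; rewrite gt_eqF.
have -> : j * w * nm * s = w * (j * nm * s) by ring.
rewrite hK mul1r ler_wpM2r ?mulr_ge0//; lra.
Qed.

End second_order_expansion.

Theorem proposition2p1 (R : realType) (k : nat) (k_ge1 : (1 <= k)%N) :
  exists C : R, 0 < C /\
  forall (mu : (R -> R) -> R) (T : R) (u : R -> R),
    Hm1 mu -> 0 < T -> L2 (@lebesgue_measure R) `]0, T[ u ->
  forall y1 dy1 y2 dy2 : R -> R -> R,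
    linearized_solution T mu u y1 dy1 ->
    quadratic_solution T y1 dy1 y2 dy2 ->
  `| inner (y2 T) (phi k)
     - k%:R * expR (- (lambda R k * T)) / (4 * pi ^+ 2 * Num.sqrt 2)
       * \int[@lebesgue_measure R]_w
           (Normc.normc (fourier (weighted_control k T u) w) ^+ 2
            * Kmu mu k w) |
  <= C * Hm1_norm (inner (y1 T)) ^+ 2
     + C * Hm1_norm mu
       * sum1 (fun n =>
           ((n ^ 2)%:R < (k ^ 2)%:R / 2 :> R)%:R
           * `| inner (y1 T) (phi n) |
           * `| \int[@lebesgue_measure R]_(t in `]0, T[)
                  (u t * expR ((lambda R k - lambda R n) * t)) |).
Proof.
exists (k%:R * pi); split; first by rewrite mulr_gt0 ?pi_gt0 ?ltr0n.
move=> mu T u muH T0 uL y1 dy1 y2 dy2 y1S y2S.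
under eq_Rintegral do rewrite normc_fourier.
exact: (second_order_estimate k_ge1 muH T0 uL y1S y2S).
Qed.
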